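(* Let $v_0,B_0,E_0\in X^0$ be $\mathbb{R}^3$-valued periodic vector fields on $\mathbb{T}^3$ with $\operatorname{div} v_0=\operatorname{div} B_0=0$ and $\hat B_0(0)=0$. Then there exist $T>0$ and a unique mild solution $(v,B,E)\in C([0,T]; X^0\times X^0\times X^0)$ of the full MHD system below with initial data $(v_0,B_0,E_0)$. Moreover, if $v_0,B_0,E_0\in C^\infty$, then $(v,B,E)\in C^\infty([0,T]\times\mathbb{R}^3)$ (viewing the fields as periodic functions on $\mathbb{R}^3$).
   Context: The system (full MHD / Navier–Stokes–Maxwell) for $v,E,B:\mathbb{R}^+\times\mathbb{T}^3\to\mathbb{R}^3$ and scalar pressure $p$, with viscosity $\nu>0$ and conductivity normalized to $\sigma=1$, is: $\partial_t v+v\cdot\nabla v-\nu\Delta v+\nabla p=j\times B$, $\partial_t E-\nabla\times B=-j$, $\partial_t B+\nabla\times E=0$, $\operatorname{div}v=\operatorname{div}B=0$, $j=\sigma(E+v\times B)$, with $v(0)=v_0$, $B(0)=B_0$, $E(0)=E_0$. Periodic functions are expanded as $f(x)=\sum_{n\in\mathbb{Z}^3}\hat f(n)e^{in\cdot x}$, and $X^0:=\{u: \|u\|:=\sum_{n\in\mathbb{Z}^3}|\hat u(n)|<\infty\}$. $\mathbf P$ is the Leray projection onto divergence-free fields, and $E=\tilde E+\bar E$ with $\tilde E=\mathbf P E$, $\bar E=\nabla(-\Delta)^{-1}\operatorname{div}E$. Let $\mathcal L_1(t),\mathcal L_2(t)$ be the Fourier multipliers with symbols $\Phi_1(t,n)=e^{-t/2}\cos(\sqrt{|n|^2-1/4}\,t)$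 and $\Phi_2(t,n)=e^{-t/2}\sin(\sqrt{|n|^2-1/4}\,t)/\sqrt{|n|^2-1/4}$ (the propagators of the damped wave equation $\partial_{tt}w-\Delta w+\partial_t w=0$). A mild solution is a triple $(v,B,E)$ satisfying the Duhamel formulation: $v(t)=e^{t\nu\Delta}v_0-\int_0^t e^{(t-s)\nu\Delta}\mathbf P[\nabla\cdot(v\otimes v)-E\times B-(v\times B)\times B](s)\,ds$; $B(t)=\mathcal L_1(t)B_0+\mathcal L_2(t)(B_0/2+B_1)+\int_0^t\mathcal L_2(t-s)[\nabla\times(v\times B)](s)\,ds$ with $B_1=-\nabla\times E_0$; $\tilde E$ is the Duhamel solution of $\partial_{tt}\tilde E-\Delta\tilde E+\partial_t\tilde E=-\partial_t\mathbf P(v\times B)$ with $\tilde E(0)=\mathbf P E_0$ and $\partial_t\tilde E(0)=\tilde E_1:=\mathbf P(\nabla\times B_0-E_0-v_0\times B_0)$, i.e. $\tilde E(t)=\mathcal L_1(t)\tilde E(0)+\mathcal L_2(t)(\tilde E(0)/2+\tilde E_1)-\int_0^t\mathcal L_2(t-s)\partial_s\mathbf P(v\times B)(s)\,ds$; and $\bar E(t)=e^{-t}\bar E(0)-\int_0^t e^{-(t-s)}\nabla(-\Delta)^{-1}\operatorname{div}(v\times B)(s)\,ds$, with $E=\tilde E+\bar E$.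
   Formalization: The gradient part is taken as Ē = −∇(−Δ)^{-1}div E (symbol +nnᵀ/|n|²), also in the v×B term, so that E = PE + Ē holds; the term −∫L₂(t−s)∂_sP(v×B)ds is read after integration by parts, as solutions are only continuous in time. *)

(* Defs.v *)
From HB Require Import structures.
From mathcomp Require Import all_boot all_order all_algebra.
From mathcomp Require Import all_classical all_reals all_analysis.
From mathcomp Require Import complex.
Set Implicit Arguments. Unset Strict Implicit. Unset Printing Implicit Defensive.
Import Order.TTheory GRing.Theory Num.Theory.
Import numFieldNormedType.Exports.
Local Open Scope classical_set_scope.
Local Open Scope ring_scope.

Section MHD.
Variable R : realType.

Definition Z3 := 'rV[int]_3.
Definition cvec := 'rV[R[i]]_3.
(* a periodic vector field on T^3, given by its Fourier coefficients
   f(x) = sum_n fhat(n) e^{i n.x} *)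
Definition field := Z3 -> cvec.

Definition rC (x : R) : R[i] := Complex x 0.
Definition iC : R[i] := Complex 0 1.
Definition expi (th : R) : R[i] := Complex (cos th) (sin th).

Definition zr (n : Z3) (k : 'I_3) : R := (n 0 k)%:~R.
Definition nsq (n : Z3) : R := \sum_k zr n k ^+ 2.
Definition nvec (n : Z3) : cvec := \row_k rC (zr n k).
Definition ndot (n : Z3) (w : cvec) : R[i] := \sum_j rC (zr n j) * w 0 j.

Definition cabs2 (c : R[i]) : R := complex.Re c ^+ 2 + complex.Im c ^+ 2.
Definition vnorm (w : cvec) : R := Num.sqrt (\sum_k cabs2 (w 0 k)).

Definition X0norm (u : field) : \bar R := \esum_(n in [set: Z3]) (vnorm (u n))%:E.
Definition inX0 (u : field) : Prop := (X0norm u < +oo)%E.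

Definition real_field (u : field) : Prop :=
  forall n k, u (- n) 0 k = conjc (u n 0 k).
Definition divfree (u : field) : Prop := forall n, ndot n (u n) = 0.

(* unordered sums over Z^3 (meaningful for absolutely summable families) *)
Definition rsum (f : Z3 -> R) : R :=
  fine (\esum_(n in [set: Z3]) (Num.max (f n) 0)%:E)
  - fine (\esum_(n in [set: Z3]) (Num.max (- f n) 0)%:E).
Definition csum (a : Z3 -> R[i]) : R[i] :=
  Complex (rsum (fun n => complex.Re (a n))) (rsum (fun n => complex.Im (a n))).
(* Fourier coefficients of a product: convolution *)
Definition conv (a b : Z3 -> R[i]) (n : Z3) : R[i] :=
  csum (fun m => a m * b (n - m)).
Definition comp (u : field) (k : 'I_3) : Z3 -> R[i] := fun n => u n 0 k.

Definition fadd (u w : field) : field := fun n => u n + w n.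
Definition fsub (u w : field) : field := fun n => u n - w n.
Definition fscale (c : R[i]) (u : field) : field := fun n => c *: u n.
Definition mult (m : Z3 -> R) (u : field) : field := fun n => rC (m n) *: u n.

Definition cross (u w : field) : field := fun n =>
  \row_k (conv (comp u (k + 1)) (comp w (k + 2)) n
          - conv (comp u (k + 2)) (comp w (k + 1)) n).
Definition curl (u : field) : field := fun n =>
  \row_k (iC * (rC (zr n (k + 1)) * u n 0 (k + 2)
                - rC (zr n (k + 2)) * u n 0 (k + 1))).
(* div (u (x) w), i.e. the k-th component is sum_j d_j (u_j w_k) *)
Definition divtens (u w : field) : field := fun n =>
  \row_k (iC * \sum_j rC (zr n j) * conv (comp u j) (comp w k) n).
Definition gradpart (u : field) : field := fun n =>
  if n == 0 then 0 else ((rC (nsq n))^-1 * ndot n (u n)) *: nvec n.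
Definition leray (u : field) : field := fun n => u n - gradpart u n.

(* propagators of  w'' - Delta w + w' = 0  (symbols Phi_1, Phi_2);
   for the mode n = 0 (|n|^2 - 1/4 < 0) the formulas are read through
   their analytic continuation (cosh / sinh). *)
Definition Phi1 (t : R) (n : Z3) : R :=
  let l := nsq n - 4^-1 in
  if 0 < l then expR (- t / 2) * cos (Num.sqrt l * t)
  else if l < 0 then
    expR (- t / 2) * ((expR (Num.sqrt (- l) * t) + expR (- (Num.sqrt (- l) * t))) / 2)
  else expR (- t / 2).
Definition Phi2 (t : R) (n : Z3) : R :=
  let l := nsq n - 4^-1 in
  if 0 < l then expR (- t / 2) * sin (Num.sqrt l * t) / Num.sqrt l
  else if l < 0 then
    expR (- t / 2) * ((expR (Num.sqrt (- l) * t) - expR (- (Num.sqrt (- l) * t))) / 2)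
      / Num.sqrt (- l)
  else expR (- t / 2) * t.
Definition dPhi2 (t : R) (n : Z3) : R := derive1 (fun tau => Phi2 tau n) t.

Definition tint (t : R) (G : R -> field) : field := fun n =>
  \row_k Complex (\int[lebesgue_measure]_(s in `[0, t]) complex.Re (G s n 0 k))
                 (\int[lebesgue_measure]_(s in `[0, t]) complex.Im (G s n 0 k)).
Definition duhamel (K : R -> Z3 -> R) (t : R) (F : R -> field) : field :=
  tint t (fun s => mult (K (t - s)) (F s)).

Definition contX0 (T : R) (u : R -> field) : Prop :=
  (forall t, 0 <= t <= T -> inX0 (u t)) /\
  forall t0, 0 <= t0 <= T -> forall e : R, 0 < e ->
    exists d : R, 0 < d /\ forall t, 0 <= t <= T -> `|t - t0| < d ->
      (X0norm (fsub (u t) (u t0)) < e%:E)%E.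

Definition mild_solution (nu : R) (v0 B0 E0 : field) (T : R)
    (v B E : R -> field) : Prop :=
  let heat := fun (s : R) (n : Z3) => expR (- (nu * nsq n * s)) in
  let Fv := fun s => leray (fsub (fsub (divtens (v s) (v s))
                                       (cross (E s) (B s)))
                                 (cross (cross (v s) (B s)) (B s))) in
  let B1 := fscale (-1) (curl E0) in
  let g := fun s => leray (cross (v s) (B s)) in
  let Et0 := leray E0 in
  let Et1 := leray (fsub (fsub (curl B0) E0) (cross v0 B0)) in
  [/\ contX0 T v, contX0 T B, contX0 T E,
      (forall t, 0 <= t <= T -> [/\ real_field (v t), real_field (B t) & real_field (E t)]) &
      forall t, 0 <= t <= T -> [/\
        v t = fsub (mult (heat t) v0) (duhamel heat t Fv),
        B t = fadd (fadd (mult (Phi1 t) B0)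
                         (mult (Phi2 t) (fadd (fscale (rC 2^-1) B0) B1)))
                   (duhamel Phi2 t (fun s => curl (cross (v s) (B s)))) &
        E t = fadd
          (* tilde E; the term - int_0^t L2(t-s) d_s g(s) ds is integrated by parts *)
          (fsub (fadd (fadd (mult (Phi1 t) Et0)
                            (mult (Phi2 t) (fadd (fscale (rC 2^-1) Et0) Et1)))
                      (mult (Phi2 t) (g 0)))
                (duhamel dPhi2 t g))
          (fsub (mult (fun _ => expR (- t)) (gradpart E0))
                (duhamel (fun tau _ => expR (- tau)) t
                   (fun s => gradpart (cross (v s) (B s)))))]].

(* physical-space value of a field: x |-> sum_n uhat(n)_k e^{i n.x}
   (real for real fields) *)
Definition phys (u : field) (x : 'rV[R]_3) (k : 'I_3) : R :=
  complex.Re (csum (fun n => u n 0 k * expi (\sum_j zr n j * x 0 j))).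

(* C^infinity on a set D of R^m (one-sided derivatives at boundary points of D) *)
Definition pderiv_within (m : nat) (D : set 'rV[R]_m) (f : 'rV[R]_m -> R)
    (j : 'I_m) (p : 'rV[R]_m) (l : R) : Prop :=
  (fun h : R => h^-1 * (f (p + h *: delta_mx 0 j) - f p))
    @ within [set h | D (p + h *: delta_mx 0 j)] (dnbhs (0 : R)) --> l.
Fixpoint Ck_on (m : nat) (D : set 'rV[R]_m) (k : nat) (f : 'rV[R]_m -> R) : Prop :=
  {within D, continuous f} /\
  match k with
  | 0 => True
  | k'.+1 => forall j : 'I_m, exists g : 'rV[R]_m -> R,
      (forall p, D p -> pderiv_within D f j p (g p)) /\ Ck_on D k' g
  end.
Definition smooth_on (m : nat) (D : set 'rV[R]_m) (f : 'rV[R]_m -> R) : Prop :=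
  forall k, Ck_on D k f.

Definition smooth_data (u : field) : Prop :=
  forall k, smooth_on [set: 'rV[R]_3] (fun x => phys u x k).
(* u in C^infinity([0,T] x R^3); a point is p = (t, x1, x2, x3) *)
Definition smooth_sol (T : R) (u : R -> field) : Prop :=
  forall k, smooth_on [set p : 'rV[R]_4 | 0 <= p 0 0 <= T]
    (fun p => phys (u (p 0 0)) (\row_(j < 3) p 0 (lift ord0 j)) k).

End MHD.

(* Main.v *)
(* Frequency by frequency, the Duhamel formulas solve the first-order system
     v' = - nu |n|^2 v - P F,   B' = - curl E,   E' = curl B - E - v x B,
   with F = div(v (x) v) - E x B - (v x B) x B.  In the energy |v|^2 + |B|^2 + |E|^2
   the two curl terms cancel and the derivative in div(v (x) v) is absorbed by the
   viscosity, so a forcing of size g e^{lam t} contributes at most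
   sqrt(K / lam) g e^{lam t}: for lam large every perturbation argument contracts
   in the norm weighted by e^{- lam t}.  Comparing two solutions in the supremum over
   frequencies gives uniqueness; Picard iterates are dominated by an increasing
   sequence of l^1 majorants and converge; the same estimate with a truncated
   polynomial weight in n propagates rapid decay of the data.  Time regularity is
   then read off the ODEs, and the fields are smooth sums of rapidly decaying series.
   Smooth data have rapidly decaying coefficients because k-th differences with step h
   are O(h^k) and multiply the coefficient at n by (e^{i h n_j} - 1)^k, which has
   modulus 2^k for h = pi / n_j. *)

Require Import Defs.
From HB Require Import structures.
From mathcomp Require Import all_boot all_order all_algebra.
From mathcomp Require Import all_classical all_reals all_analysis.
From mathcomp Require Import complex ring lra.
From mathcomp Require finmap.
Import Order.TTheory GRing.Theory Num.Theory.
Import numFieldNormedType.Exports.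
Local Open Scope classical_set_scope.
Local Open Scope ring_scope.
Set Implicit Arguments.
Unset Strict Implicit.
Unset Printing Implicit Defensive.

(* mathcomp has its own [conv] and [comp], which shadow those of Defs. *)
Local Notation conv := Defs.conv.
Local Notation comp := Defs.comp.

(** * Real calculus and Duhamel integrals *)

Section Calculus.
Variable R : realType.
Implicit Types (f g : R -> R) (x t l m c : R).

(** The energy estimate at one frequency consumes the supremum over time of the forcing at that
    frequency. A supremum over time and a sum over frequencies do not commute, so a bound in
    C([0,T]; X^0) does not provide summable suprema, and no contraction is sought in that norm. Two
    suprema do commute: differences are measured in the supremum over frequencies, a convolution
    being bounded by that supremum of one factor times the l^1 norm of the other. Membership in X^0
    is recovered separately, from majorants in n that do not depend on time. The estimates of
    differences and of weighted norms are linear in the quantity estimated, with coefficients that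
    involve l^1 bounds only. Enlarging [lam] makes them contract without shortening the interval, so
    smoothness holds on the whole interval of existence; only the nonlinear majorants restrict [T].
    Derivatives are two-sided even at the ends of [0,T], so the ODE solutions live on the real line
    and are compared with the fields on [0,T] alone. *)

Definition der f x l := is_derive x (1 : R) f l.

Lemma der_eq f x l m : der f x l -> l = m -> der f x m.
Proof. by move=> h <-. Qed.
Lemma der_ext f g x l : f =1 g -> der f x l -> der g x l.
Proof. by move=> /funext ->. Qed.
Lemma derD f g x l m : der f x l -> der g x m -> der (fun t => f t + g t) x (l + m).
Proof. exact: is_deriveD. Qed.
Lemma derN f x l : der f x l -> der (fun t => - f t) x (- l).
Proof. exact: is_deriveN. Qed.
Lemma derB f g x l m : der f x l -> der g x m -> der (fun t => f t - g t) x (l - m).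
Proof. exact: is_deriveB. Qed.
Lemma derM f g x l m : der f x l -> der g x m ->
  der (fun t => f t * g t) x (l * g x + f x * m).
Proof.
move=> hf hg; have := @is_deriveM _ _ f g x 1 l m hf hg.
by move/der_eq; apply; rewrite /GRing.scale /= addrC [g x * l]mulrC.
Qed.

Lemma der_cst c x : der (fun=> c) x 0.
Proof. exact: is_derive_cst. Qed.
Lemma der_id x : der id x 1.
Proof. exact: is_derive_id. Qed.
Lemma derZ c f x l : der f x l -> der (fun t => c * f t) x (c * l).
Proof. by move=> h; apply: der_eq (derM (der_cst c x) h) _; rewrite mul0r add0r. Qed.
Lemma der_comp f g x l m : der f (g x) l -> der g x m -> der (fun t => f (g t)) x (l * m).
Proof. by move=> hf hg; have := @is_derive1_comp R f g x l m hf hg. Qed.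
Lemma der_expM c x : der (fun t => expR (c * t)) x (c * expR (c * x)).
Proof.
apply: der_eq (@der_comp expR (fun t => c * t) _ _ _ (is_derive_expR _) (derZ c (der_id x))) _.
by rewrite mulr1 mulrC.
Qed.

Lemma der_cosM c x : der (fun t => cos (c * t)) x (- (c * sin (c * x))).
Proof.
apply: der_eq (@der_comp cos (fun t => c * t) _ _ _ (is_derive_cos _) (derZ c (der_id x))) _.
by rewrite mulr1 mulNr mulrC.
Qed.

Lemma der_sinM c x : der (fun t => sin (c * t)) x (c * cos (c * x)).
Proof.
apply: der_eq (@der_comp sin (fun t => c * t) _ _ _ (is_derive_sin _) (derZ c (der_id x))) _.
by rewrite mulr1 mulrC.
Qed.

Lemma der_sum (I : finType) (h : I -> R -> R) (l : I -> R) x :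
  (forall i, der (h i) x (l i)) -> der (fun t => \sum_i h i t) x (\sum_i l i).
Proof.
move=> H; suff : forall s : seq I, der (fun t => \sum_(i <- s) h i t) x (\sum_(i <- s) l i) by apply.
elim=> [|i s IH].
  by rewrite big_nil; apply: der_ext (der_cst 0 x) => t; rewrite big_nil.
by rewrite big_cons; apply: der_ext (derD (H i) IH) => t; rewrite big_cons.
Qed.

Lemma der_cont f x l : der f x l -> {for x, continuous f}.
Proof. by move=> [d _]; apply: differentiable_continuous; apply/derivable1_diffP. Qed.

Lemma der_derive1 f x l : der f x l -> derive1 f x = l.
Proof. by move=> h; rewrite derive1E; exact: derive_val. Qed.

Lemma der_shift f t x l : der f (t - x) l -> der (fun s => f (t - s)) x (- l).
Proof.
move=> h; apply: der_eq (@der_comp f (fun s => t - s) _ _ _ h (derB (der_cst t x) (der_id x))) _.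
by rewrite sub0r mulrN1.
Qed.

Lemma MVT_le f (df : R -> R) (a b c : R) : a <= b ->
  (forall x, a <= x <= b -> der f x (df x)) ->
  (forall x, a <= x <= b -> df x <= c) -> f b - f a <= c * (b - a).
Proof.
move=> ab hd hc.
have [||x xab ->] := @MVT_segment R f df a b ab.
- by move=> x; rewrite in_itv /= => /andP[h1 h2]; apply: hd; rewrite !ltW.
- by apply: derivable_within_continuous => x; rewrite in_itv /= => /hd [].
- by apply: ler_wpM2r; rewrite ?subr_ge0 //; apply: hc; rewrite in_itv /= in xab.
Qed.

Lemma MVT_abs f (df : R -> R) (a b c t s : R) :
  (forall x, a <= x <= b -> der f x (df x)) ->
  (forall x, a <= x <= b -> `|df x| <= c) ->
  a <= t <= b -> a <= s <= b -> `|f t - f s| <= c * `|t - s|.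
Proof.
move=> hd hc; wlog st : t s / s <= t.
  move=> W ht hs; case: (leP s t) => h; first exact: W.
  by rewrite distrC [`|t - s|]distrC; apply: W => //; exact: ltW.
move=> /andP[h1 h2] /andP[h3 h4]; rewrite [`|t - s|]ger0_norm ?subr_ge0 //.
have hx x : s <= x <= t -> a <= x <= b.
  by move=> /andP[h5 h6]; rewrite (le_trans h3 h5) (le_trans h6 h2).
rewrite ler_norml; apply/andP; split.
  rewrite lerNl; have := @MVT_le (fun x => - f x) (fun x => - df x) s t c st.
  rewrite opprB opprK [- f t + _]addrC; apply.
    by move=> x /hx/hd /derN.
  by move=> x /hx/hc; rewrite ler_norml lerNl => /andP[].
apply: MVT_le st _ _ => x /hx; first exact: hd.
by move=> /hc; rewrite ler_norml => /andP[].
Qed.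

(** The margin [lam >= 1] absorbs the term [e t]: the product [q] of [expR (lam * s)] with
    [e s * expR (- (2 * lam) * s) - K / lam] is nonincreasing. Letting forcing and bound grow at the
    same rate [2 * lam] is what leaves the small factor [K / lam]. *)
Lemma gronwall_energy (e de : R -> R) (T lam K : R) : 1 <= lam -> 0 <= K ->
  (forall t, 0 <= t <= T -> der e t (de t)) ->
  (forall t, 0 <= t <= T -> 0 <= e t) ->
  (forall t, 0 <= t <= T -> de t <= e t + K * expR (2 * lam * t)) ->
  forall t, 0 <= t <= T -> e t <= expR (2 * lam * t) * (e 0 + K / lam).
Proof.
move=> l1 K0 he e0 hde t /andP[t0 tT].
have lam0 : 0 < lam by apply: lt_le_trans l1.
pose q (s : R) := (e s * expR (- (2 * lam) * s) - K / lam) * expR (lam * s).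
have T0 : 0 <= T by apply: le_trans tT.
have hq s : 0 <= s <= t -> der q s
   ((de s * expR (- (2 * lam) * s) + e s * (- (2 * lam) * expR (- (2 * lam) * s)) - 0) * expR (lam * s)
     + (e s * expR (- (2 * lam) * s) - K / lam) * (lam * expR (lam * s))).
  move=> /andP[s0 st]; have hs : 0 <= s <= T by rewrite s0 (le_trans st).
  by apply: derM (der_expM _ _); apply: derB (der_cst _ _); apply: derM (he _ hs) (der_expM _ _).
have : q t - q 0 <= 0 * (t - 0).
  apply: (MVT_le t0 hq) => s /andP[s0 st].
  have hs : 0 <= s <= T by rewrite s0 (le_trans st).
  rewrite (_ : _ + _ = expR (lam * s) * (de s * expR (- (2 * lam) * s) - lam * e s * expR (- (2 * lam) * s) - K)); last first.
    by field; rewrite gt_eqF.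
  rewrite pmulr_rle0 ?expR_gt0 // subr_le0.
  rewrite -mulrBl mulNr expRN ler_pdivrMr ?expR_gt0 //.
  have h1 := hde _ hs; have h2 := e0 _ hs.
  have h3 : e s <= lam * e s by rewrite ler_peMl.
  lra.
rewrite mul0r /q mulr0 mulr0 !expR0 !mulr1 subr_le0 => h.
have h0 : 0 <= e 0 by apply: e0; rewrite lexx.
have hK : 0 <= K / lam by rewrite divr_ge0 // ltW.
have h2 : e t * expR (- (2 * lam) * t) <= e 0 + K / lam.
  have hl : 1 <= expR (lam * t) by rewrite -expR0 ler_expR mulr_ge0 // ltW.
  (* A nonpositive bracket gives the bound at once; a positive one is at most its product with
     [expR (lam * t)], which [h] controls. *)
  case: (leP (e t * expR (- (2 * lam) * t) - K / lam) 0) => hh; first lra.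
  have : e t * expR (- (2 * lam) * t) - K / lam <= (e t * expR (- (2 * lam) * t) - K / lam) * expR (lam * t).
    by rewrite ler_peMr // ltW.
  lra.
rewrite mulrC -ler_pdivrMr ?expR_gt0 //.
by move: h2; rewrite mulNr expRN.
Qed.

Lemma FTC2_der (f F : R -> R) (t : R) : 0 <= t ->
  (forall s, 0 <= s <= t -> {for s, continuous f}) ->
  (forall s, 0 <= s <= t -> der F s (f s)) ->
  (\int[lebesgue_measure]_(s in `[0%R, t]) f s) = F t - F 0.
Proof.
rewrite le_eqVlt => /predU1P[<-|t0] cf hF.
  by rewrite set_itv1 Rintegral_set1 subrr.
rewrite /Rintegral (@continuous_FTC2 _ f F) //.
- apply: continuous_in_subspaceT => //.
  by move=> s; rewrite inE /= in_itv /= => /cf.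
- split.
  + by move=> s; rewrite in_itv /= => /andP[h1 h2]; have [] := hF s; rewrite ?ltW // ltW.
  + by apply: cvg_at_right_filter; apply: (der_cont (hF _ _)); rewrite lexx ltW.
  + by apply: cvg_at_left_filter; apply: (der_cont (hF _ _)); rewrite lexx ltW.
- move=> s; rewrite in_itv /= => /andP[h1 h2].
  by apply: der_derive1; apply: hF; rewrite !ltW.
Qed.

(** The integral starts at -1 so that 0 is an interior point and the derivative there is two-sided;
    subtracting [G 0] restores the value 0. *)
Lemma antiderivative f : continuous f ->
  exists F : R -> R, F 0 = 0 /\ forall t, 0 <= t -> der F t (f t).
Proof.
move=> cf; pose G t := \int[lebesgue_measure]_(s in `[(-1)%R, t]) f s.
exists (fun t => G t - G 0); split; first by rewrite subrr.
move=> t t0.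
have [|||d1 d2] := @continuous_FTC1_closed R f (-1) t (t + 1) _ _ _ (cf t).
- by rewrite ltrDl.
- apply: continuous_compact_integrable; first exact: segment_compact.
  by apply: continuous_subspaceT.
- by apply: lt_le_trans t0; rewrite ltrN10.
rewrite -[f t]subr0; apply: derB (der_cst _ _).
by apply: DeriveDef d1 _; rewrite -derive1E; exact: d2.
Qed.

(** Continuity on [0,T], recorded as the restriction of a function continuous on the whole line: the
    form from which primitives with two-sided derivatives are built. *)
Definition cont_ext (T : R) f := exists2 g : R -> R, continuous g &
  forall t, 0 <= t <= T -> g t = f t.

Lemma cont_extE (T : R) f : (forall t0, 0 <= t0 <= T -> forall e : R, 0 < e ->
    exists d : R, 0 < d /\ forall t, 0 <= t <= T -> `|t - t0| < d -> `|f t - f t0| < e) ->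
  0 <= T -> cont_ext T f.
Proof.
(* The extension is [f] composed with [cl], the 1-Lipschitz projection of the line onto [0,T]. *)
move=> hf T0; pose cl t := Num.max 0 (Num.min t T).
have clI t : 0 <= cl t <= T.
  by rewrite /cl le_max lexx /= ge_max T0 ge_min lexx orbT.
have clE t : 0 <= t <= T -> cl t = t.
  by move=> /andP[t0 tT]; rewrite /cl min_l // max_r.
have clL t s : `|cl t - cl s| <= `|t - s|.
  wlog st : t s / s <= t.
    move=> W; case: (leP s t) => h; first exact: W.
    by rewrite distrC [`|t - s|]distrC; apply: W; exact: ltW.
  have h : cl s <= cl t.
    rewrite /cl ge_max le_max lexx /=.
    by rewrite le_max; apply/orP; right; rewrite le_min !ge_min lexx st orbT.
  rewrite !ger0_norm ?subr_ge0 // /cl.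
  clear -st T0; case: (leP t T) => h1; case: (leP s T) => h2; case: (leP 0 T) => h5; case: (leP 0 t) => h3; case: (leP 0 s) => h4; lra.
exists (f \o cl) => [t|t /clE /= -> //].
apply/(@cvgrPdist_lt R R^o) => e e0.
have [d [d0 hd]] := hf (cl t) (clI t) e e0.
near=> s; rewrite distrC /=; apply: hd => //; apply: le_lt_trans (clL _ _) _.
by rewrite distrC; near: s; exact: (@nbhsx_ballx R R^o t d d0).
Unshelve. all: by end_near.
Qed.

Lemma heat_exists c (T : R) f : cont_ext T f ->
  exists K : R -> R, K 0 = 0 /\ forall t, 0 <= t <= T -> der K t (f t - c * K t).
Proof.
move=> [g cg gf].
have cexp : continuous (fun t => expR (c * t)).
  by move=> t; apply: der_cont (der_expM c t).
have [|P [P0 hP]] := @antiderivative (fun t => expR (c * t) * g t).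
  by move=> t; apply: cvgM; [exact: cexp|exact: cg].
exists (fun t => expR (- c * t) * P t); split; first by rewrite P0 mulr0.
move=> t /andP[t0 tT]; rewrite -gf ?t0 //.
apply: der_eq (derM (der_expM _ _) (hP _ t0)) _.
have E1 : expR (- c * t) * expR (c * t) = 1 by rewrite -expRD mulNr addNr expR0.
by rewrite (mulrA (expR (- c * t)) (expR (c * t))) E1; ring.
Qed.

(* the Duhamel integrals are evaluated by exhibiting primitives of the integrands *)
Lemma heat_eval c (T : R) f (K : R -> R) t : cont_ext T f -> K 0 = 0 ->
  (forall t, 0 <= t <= T -> der K t (f t - c * K t)) -> 0 <= t <= T ->
  (\int[lebesgue_measure]_(s in `[0%R, t]) (expR (- (c * (t - s))) * f s)) = K t.
Proof.
move=> [g cg gf] K0 hK /andP[t0 tT].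
pose E s := expR (- c * (t - s)).
have hE s : der E s (c * E s).
  apply: der_eq (der_shift (der_expM (- c) _)) _.
  by rewrite /E; ring.
have -> : \int[lebesgue_measure]_(s in `[0%R, t]) (expR (- (c * (t - s))) * f s) =
   \int[lebesgue_measure]_(s in `[0%R, t]) (E s * g s).
  apply: eq_Rintegral => s; rewrite inE /= in_itv /= => /andP[s0 st].
  by rewrite /E mulNr gf // s0 (le_trans st).
rewrite (@FTC2_der (fun s => E s * g s) (fun s => E s * K s) _ t0).
- by rewrite /E subrr mulr0 expR0 mul1r K0 mulr0 subr0.
- move=> s _; apply: cvgM; last exact: cg.
  exact: der_cont (hE s).
- move=> s /andP[s0 st]; have hs : 0 <= s <= T by rewrite s0 (le_trans st).
  by apply: der_eq (derM (hE s) (hK _ hs)) _; rewrite gf //; ring.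
Qed.

(** Variation of constants with the homogeneous solutions [p] and [dp]. Since [p (t - s)] equals
    [expR s] times [p t * dp s - dp t * p s], the Duhamel integral splits into the two primitives
    [P] and [S], and no integral depending on a parameter has to be differentiated. *)
Lemma wave_exists c (p dp : R -> R) (T : R) f :
  p 0 = 0 -> dp 0 = 1 -> (forall t, der p t (dp t)) ->
  (forall t, der dp t (- dp t - c * p t)) -> cont_ext T f ->
  exists I J : R -> R, [/\ I 0 = 0, J 0 = 0 &
   forall t, 0 <= t <= T -> der I t (J t) /\ der J t (f t - J t - c * I t)].
Proof.
move=> p0 dp0 hp hdp [g cg gf].
have cexp : continuous (fun t : R => expR (1 * t)).
  by move=> t; apply: der_cont (der_expM 1 t).
have cp : continuous p by move=> t; apply: der_cont (hp t).
have cdp : continuous dp by move=> t; apply: der_cont (hdp t).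
(* the Wronskian-type identity  e^t (p'^2 + p p' + c p^2) = 1 *)
pose Q t := expR (1 * t) * (dp t * dp t + p t * dp t + c * (p t * p t)).
have hQ t : der Q t 0.
  apply: der_eq (derM (der_expM _ _) (derD (derD (derM (hdp t) (hdp t)) (derM (hp t) (hdp t))) (derZ c (derM (hp t) (hp t))))) _.
  ring.
have Q1 t : Q t = 1.
  have -> : Q t = Q 0 by apply: (@is_derive_0_is_cst _ Q).
  by rewrite /Q mulr0 expR0 p0 dp0; ring.
have [|P [P0 hP]] := @antiderivative (fun t => expR (1 * t) * dp t * g t).
  by move=> t; apply: cvgM; [apply: cvgM; [exact: cexp|exact: cdp]|exact: cg].
have [|S [S0 hS]] := @antiderivative (fun t => expR (1 * t) * p t * g t).
  by move=> t; apply: cvgM; [apply: cvgM; [exact: cexp|exact: cp]|exact: cg].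
pose I t := p t * P t - dp t * S t.
pose J t := dp t * P t - (- dp t - c * p t) * S t.
exists I, J; split.
- by rewrite /I P0 S0 !mulr0 subr0.
- by rewrite /J P0 S0 !mulr0 subr0.
move=> t /andP[t0 tT]; rewrite -gf ?t0 //; split.
  apply: der_eq (derB (derM (hp t) (hP t t0)) (derM (hdp t) (hS t t0))) _.
  rewrite /J; ring.
apply: der_eq (derB (derM (hdp t) (hP t t0)) (derM (derB (derN (hdp t)) (derZ c (hp t))) (hS t t0))) _.
transitivity (Q t * g t - J t - c * I t); last by rewrite Q1 mul1r.
rewrite /J /I /Q; ring.
Qed.

Lemma wave_eval c (p dp : R -> R) (T : R) f (I J : R -> R) t :
  p 0 = 0 -> dp 0 = 1 -> (forall t, der p t (dp t)) ->
  (forall t, der dp t (- dp t - c * p t)) -> cont_ext T f -> I 0 = 0 -> J 0 = 0 ->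
  (forall t, 0 <= t <= T -> der I t (J t)) ->
  (forall t, 0 <= t <= T -> der J t (f t - J t - c * I t)) -> 0 <= t <= T ->
  (\int[lebesgue_measure]_(s in `[0%R, t]) (p (t - s) * f s)) = I t /\
  (\int[lebesgue_measure]_(s in `[0%R, t]) (dp (t - s) * f s)) = J t.
Proof.
move=> p0 dp0 hp hdp [g cg gf] I0 J0 hI hJ /andP[t0 tT].
have fg (q : R -> R) : \int[lebesgue_measure]_(s in `[0%R, t]) (q (t - s) * f s) =
   \int[lebesgue_measure]_(s in `[0%R, t]) (q (t - s) * g s).
  apply: eq_Rintegral => s; rewrite inE /= in_itv /= => /andP[s0 st].
  by rewrite gf // s0 (le_trans st).
rewrite !fg; split.
(* The primitive is the boundary form in Lagrange's identity between [I] and [p (t - s)], which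
   solves the adjoint equation in [s]. *)
- rewrite (@FTC2_der (fun s => p (t - s) * g s) (fun s => p (t - s) * J s + (dp (t - s) + p (t - s)) * I s) _ t0).
  + by rewrite subrr p0 dp0 I0 J0; ring.
  + move=> s _; apply: cvgM; last exact: cg.
    exact: der_cont (der_shift (hp _)).
  + move=> s /andP[s0 st]; have hs : 0 <= s <= T by rewrite s0 (le_trans st).
    apply: der_eq (derD (derM (der_shift (hp _)) (hJ _ hs)) (derM (derD (der_shift (hdp _)) (der_shift (hp _))) (hI _ hs))) _.
    by rewrite gf //; ring.
- rewrite (@FTC2_der (fun s => dp (t - s) * g s) (fun s => dp (t - s) * J s - c * (p (t - s) * I s)) _ t0).
  + by rewrite subrr p0 dp0 I0 J0; ring.
  + move=> s _; apply: cvgM; last exact: cg.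
    exact: der_cont (der_shift (hdp _)).
  + move=> s /andP[s0 st]; have hs : 0 <= s <= T by rewrite s0 (le_trans st).
    apply: der_eq (derB (derM (der_shift (hdp _)) (hJ _ hs)) (derZ c (derM (der_shift (hp _)) (hI _ hs)))) _.
    by rewrite gf //; ring.
Qed.

Lemma Phi2_facts (n : Z3) : [/\ Phi2 (0 : R) n = 0, dPhi2 (0 : R) n = 1,
   forall t : R, der (fun t => Phi2 t n) t (dPhi2 t n),
   forall t : R, der (fun t => dPhi2 t n) t (- dPhi2 t n - nsq R n * Phi2 t n) &
   forall t : R, Phi1 t n = dPhi2 t n + Phi2 t n / 2].
Proof.
have e2 t : expR (- t / 2) = expR (- 2^-1 * t) :> R by congr expR; lra.
(* [dPhi2] is given by [derive1]. Each regime of [Phi2] supplies an explicit candidate [D],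
   identified with [dPhi2] by uniqueness of the derivative. *)
have [D [p0 D0 hp hD hP]] : exists D : R -> R, [/\ Phi2 (0 : R) n = 0, D 0 = 1,
   forall t : R, der (fun t => Phi2 t n) t (D t),
   forall t : R, der D t (- D t - nsq R n * Phi2 t n) &
   forall t : R, Phi1 t n = D t + Phi2 t n / 2]; last first.
  have E : (fun t => dPhi2 t n) = D by apply/funext => t; exact: der_derive1 (hp t).
  have Et t : dPhi2 t n = D t by exact: der_derive1 (hp t).
  split => //; [by rewrite Et|by move=> t; rewrite Et| |by move=> t; rewrite Et].
  by move=> t; rewrite E Et.
set c := nsq R n; rewrite /Phi1 /Phi2 -/c.
case: ifPn => [l0|/negbTE l0].
  set l := Num.sqrt _.
  have l2 : l * l = c - 4^-1 by rewrite -expr2 sqr_sqrtr // ltW.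
  have ln0 : l != 0 by rewrite gt_eqF // sqrtr_gt0.
  exists (fun t => expR (- 2^-1 * t) * (cos (l * t) - sin (l * t) / l / 2)); split.
  - by rewrite !mulr0 sin0 mulr0 mul0r.
  - by rewrite !mulr0 sin0 cos0 expR0; lra.
  - move=> t; under [X in der X]funext do rewrite e2 mulrAC -mulrA.
    apply: der_eq (derM (der_expM _ _) (derM (der_cst _ _) (der_sinM _ _))) _ => /=.
    by field.
  - move=> t; under [X in der X]funext do rewrite -[_ / l / 2]mulrA.
    apply: der_eq (derM (der_expM _ _) (derB (der_cosM _ _) (derM (der_sinM _ _) (der_cst _ _)))) _ => /=.
    rewrite e2 (_ : c = l * l + 4^-1); last by rewrite l2; ring.
    by field.
  - by move=> t; rewrite e2; field.
case: ifPn => [l1|/negbTE l1].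
  set l := Num.sqrt _.
  have l2 : l * l = 4^-1 - c by rewrite -expr2 sqr_sqrtr ?opprB // subr_ge0 -subr_le0 ltW.
  have ln0 : l != 0 by rewrite gt_eqF // sqrtr_gt0 oppr_gt0.
  exists (fun t => expR (- 2^-1 * t) * ((expR (l * t) + expR (- l * t)) / 2 - (expR (l * t) - expR (- l * t)) / 2 / l / 2)); split.
  - by rewrite !mulr0 oppr0 subrr mul0r mulr0 mul0r.
  - by rewrite !mulr0 expR0 subrr; lra.
  - move=> t; under [X in der X]funext do rewrite e2 -mulNr -mulrA -[_ / 2 / l]mulrA.
    apply: der_eq (derM (der_expM _ _) (derM (derB (der_expM _ _) (der_expM _ _)) (der_cst _ _))) _ => /=.
    by field.
  - move=> t; under [X in der X]funext do rewrite -[_ / l / 2]mulrA -[_ / 2 * (_ / _)]mulrA.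
    apply: der_eq (derM (der_expM _ _) (derB (derM (derD (der_expM _ _) (der_expM _ _)) (der_cst _ _)) (derM (derB (der_expM _ _) (der_expM _ _)) (der_cst _ _)))) _ => /=.
    rewrite e2 (_ : c = 4^-1 - l * l); last by rewrite l2; ring.
    by rewrite !mulNr; field.
  - by move=> t; rewrite e2 !mulNr; field.
have c4 : c = 4^-1.
  by apply/eqP; rewrite -subr_eq0 eq_le !leNgt l0 l1.
exists (fun t => expR (- 2^-1 * t) * (1 - t / 2)); split.
- by rewrite mulr0.
- by rewrite mulr0 expR0; lra.
- move=> t; under [X in der X]funext do rewrite e2.
  apply: der_eq (derM (der_expM _ _) (der_id _)) _ => /=; by field.
- move=> t; apply: der_eq (derM (der_expM _ _) (derB (der_cst _ _) (derM (der_id _) (der_cst _ _)))) _ => /=.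
  by rewrite c4 e2; field.
- by move=> t; rewrite e2; field.
Qed.

End Calculus.

(** * Summable families of Fourier coefficients *)

Section Modulus.
Variable R : realType.
Implicit Types z w : R[i].

(** Real-valued, whereas the norm of [R[i]] takes its values in [R[i]]; estimates can thus be stated
    in [R]. *)
Definition cmod z : R := Num.sqrt (cabs2 z).

Lemma cmodE z : cmod z = Normc.normc z. Proof. by case: z. Qed.
Lemma cmod_ge0 z : 0 <= cmod z. Proof. exact: sqrtr_ge0. Qed.
Hint Resolve cmod_ge0 : core.
Lemma cmod0 : cmod 0 = 0. Proof. by rewrite cmodE Normc.normc0. Qed.
Lemma cmodD z w : cmod (z + w) <= cmod z + cmod w.
Proof. rewrite !cmodE; exact: le_normcD. Qed.
Lemma cmodN z : cmod (- z) = cmod z.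
Proof. rewrite !cmodE; exact: normcN. Qed.
Lemma cmodB z w : cmod (z - w) <= cmod z + cmod w.
Proof. by rewrite -(cmodN w) cmodD. Qed.
Lemma cmodBC z w : cmod (z - w) = cmod (w - z).
Proof. by rewrite -cmodN opprB. Qed.
Lemma cmodM z w : cmod (z * w) = cmod z * cmod w.
Proof. by rewrite !cmodE Normc.normcM. Qed.
Lemma cmod_eq0 z : cmod z = 0 -> z = 0.
Proof. by rewrite cmodE; exact: Normc.eq0_normc. Qed.
Lemma cabs2_ge0 z : 0 <= cabs2 z.
Proof. by rewrite addr_ge0 ?sqr_ge0. Qed.
Lemma cmod2 z : cmod z ^+ 2 = cabs2 z.
Proof. by rewrite sqr_sqrtr // cabs2_ge0. Qed.
Lemma abs_le_sqrt (x y : R) : x ^+ 2 <= y -> `|x| <= Num.sqrt y.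
Proof. by move=> h; rewrite -sqrtr_sqr ler_sqrt // (le_trans _ h) // sqr_ge0. Qed.
Lemma Re_le z : `|complex.Re z| <= cmod z.
Proof. by apply: abs_le_sqrt; rewrite lerDl sqr_ge0. Qed.
Lemma Im_le z : `|complex.Im z| <= cmod z.
Proof. by apply: abs_le_sqrt; rewrite lerDr sqr_ge0. Qed.
Lemma cmod_le z : cmod z <= `|complex.Re z| + `|complex.Im z|.
Proof.
rewrite -[leRHS]ger0_norm ?addr_ge0 // -sqrtr_sqr ler_wsqrtr //.
rewrite sqrrD /cabs2 !real_normK ?num_real // -addrA lerD2l lerDr.
by rewrite mulrn_wge0 // mulr_ge0.
Qed.

Lemma cmod_rC (x : R) : cmod (rC x) = `|x|.
Proof. by rewrite /cmod /cabs2 /= expr0n addr0 sqrtr_sqr. Qed.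
Lemma cmod_iC : cmod (iC R) = 1.
Proof. by rewrite /cmod /cabs2 /= expr0n add0r expr1n sqrtr1. Qed.
Lemma cmod_conj z : cmod (conjc z) = cmod z.
Proof. by case: z => a b; rewrite /cmod /cabs2 /= sqrrN. Qed.
Lemma cmod_expi (t : R) : cmod (expi t) = 1.
Proof. by rewrite /cmod /cabs2 /= cos2Dsin2 sqrtr1. Qed.
Lemma cmod_sum (I : Type) (s : seq I) (P : pred I) (F : I -> R[i]) :
  cmod (\sum_(i <- s | P i) F i) <= \sum_(i <- s | P i) cmod (F i).
Proof.
elim/big_rec2: _ => [|i x z _ h]; first by rewrite cmod0.
by apply: le_trans (cmodD _ _) _; rewrite lerD2l.
Qed.

Lemma complex_eq z w : complex.Re z = complex.Re w -> complex.Im z = complex.Im w -> z = w.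
Proof. by case: z; case: w => a b c d /= -> ->. Qed.
Lemma cReD z w : complex.Re (z + w) = complex.Re z + complex.Re w.
Proof. by case: z; case: w. Qed.
Lemma cImD z w : complex.Im (z + w) = complex.Im z + complex.Im w.
Proof. by case: z; case: w. Qed.
Lemma cReN z : complex.Re (- z) = - complex.Re z. Proof. by case: z. Qed.
Lemma cImN z : complex.Im (- z) = - complex.Im z. Proof. by case: z. Qed.
Lemma cReM z w : complex.Re (z * w) = complex.Re z * complex.Re w - complex.Im z * complex.Im w.
Proof. by case: z; case: w. Qed.
Lemma cImM z w : complex.Im (z * w) = complex.Re z * complex.Im w + complex.Im z * complex.Re w.
Proof. by case: z; case: w. Qed.
Lemma rCD (x y : R) : rC (x + y) = rC x + rC y.
Proof. by apply: complex_eq; rewrite /= ?addr0. Qed.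
Lemma rCM (x y : R) : rC (x * y) = rC x * rC y.
Proof. by apply: complex_eq; rewrite /= ?mulr0 ?mul0r ?subr0 ?addr0. Qed.
Lemma rCN (x : R) : rC (- x) = - rC x.
Proof. by apply: complex_eq; rewrite /= ?oppr0. Qed.
Lemma rC0 : rC 0 = 0 :> R[i]. Proof. by []. Qed.
Lemma rC1 : rC 1 = 1 :> R[i]. Proof. by []. Qed.
Lemma conjcD z w : conjc (z + w) = conjc z + conjc w. Proof. exact: rmorphD. Qed.
Lemma conjcM z w : conjc (z * w) = conjc z * conjc w. Proof. exact: rmorphM. Qed.
Lemma conjcB z w : conjc (z - w) = conjc z - conjc w. Proof. exact: rmorphB. Qed.
Lemma conj_rC (x : R) : conjc (rC x) = rC x.
Proof. by rewrite /= oppr0. Qed.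

Lemma cmod_vnorm (w : cvec R) k : cmod (w 0 k) <= vnorm w.
Proof.
apply: ler_wsqrtr; rewrite (bigD1 k) //= lerDl.
by apply: sumr_ge0 => i _; exact: cabs2_ge0.
Qed.

Lemma vnorm_le (w : cvec R) : vnorm w <= \sum_k cmod (w 0 k).
Proof.
have h : 0 <= \sum_k cmod (w 0 k) by apply: sumr_ge0.
rewrite -[leRHS]ger0_norm // -sqrtr_sqr ler_wsqrtr //.
rewrite expr2 big_distrl /=; apply: ler_sum => k _.
rewrite -cmod2 expr2 ler_wpM2l // (bigD1 k) //= lerDl.
exact: sumr_ge0.
Qed.

Lemma vnorm_ge0 (w : cvec R) : 0 <= vnorm w.
Proof. exact: sqrtr_ge0. Qed.
End Modulus.
#[global] Hint Resolve cmod_ge0 : core.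

(** * Unordered sums of nonnegative families *)

Section Sums.
Variables (R : realType).

(** Summability with an explicit bound, tested on finite sets of distinct indices. For nonnegative
    families it amounts to a bound on the extended-real sum ([esum_sums]), without leaving [R]. *)
Definition sums (T : eqType) (d : T -> R) (D : R) :=
  forall s : seq T, uniq s -> \sum_(i <- s) d i <= D.

Lemma sums_ge0 (T : eqType) (d : T -> R) D : sums d D -> 0 <= D.
Proof. by move=> /(_ [::] isT); rewrite big_nil. Qed.
Lemma sums_le (T : eqType) (d e : T -> R) D E : (forall i, d i <= e i) -> D <= E ->
  sums e D -> sums d E.
Proof.
move=> h hD he s us; apply: le_trans hD; apply: le_trans (he s us).
by apply: ler_sum.
Qed.

Lemma sums_term (T : eqType) (d : T -> R) D i : sums d D -> d i <= D.
Proof. by move=> /(_ [:: i] isT); rewrite big_seq1. Qed.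
Lemma sumsD (T : eqType) (d e : T -> R) D E : sums d D -> sums e E ->
  sums (fun i => d i + e i) (D + E).
Proof. by move=> hd he s us; rewrite big_split lerD // ?hd ?he. Qed.
Lemma sumsZ (T : eqType) (d : T -> R) D c : 0 <= c -> sums d D ->
  sums (fun i => c * d i) (c * D).
Proof. by move=> c0 hd s us; rewrite -big_distrr ler_wpM2l //= hd. Qed.
Lemma sums_inj (T U : eqType) (d : T -> R) D (h : U -> T) : injective h ->
  sums d D -> sums (d \o h) D.
Proof.
move=> ih hd s us; rewrite -(big_map h predT d); apply: hd.
by rewrite map_inj_uniq.
Qed.

Lemma esum_sums (T : choiceType) (d : T -> R) D : (forall i, 0 <= d i) ->
  sums d D <-> (\esum_(i in [set: T]) (d i)%:E <= D%:E)%E.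
Proof.
move=> d0; split => [hd|hd s us].
  apply: ge_ereal_sup => _ [X [fX _] <-].
  by rewrite fsbig_finite //= sumEFin lee_fin; apply: hd; exact: finmap.fset_uniq.
rewrite -lee_fin; apply: le_trans hd; apply: esum_ge.
exists [set` s]; first by split => //; exact: finite_seq.
by rewrite -fsbig_seq // sumEFin.
Qed.

Lemma esum_fin (T : choiceType) (d : T -> R) : (forall i, 0 <= d i) ->
  (\esum_(i in [set: T]) (d i)%:E < +oo)%E <-> exists D, sums d D.
Proof.
move=> d0; have h0 : (0 <= \esum_(i in [set: T]) (d i)%:E)%E.
  by apply: esum_ge0 => i _; rewrite lee_fin.
split => [h|[D /(esum_sums _ d0)] h]; last by apply: le_lt_trans h _; rewrite ltry.
exists (fine (\esum_(i in [set: T]) (d i)%:E)); apply/(esum_sums _ d0).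
by rewrite fineK // ge0_fin_numE.
Qed.

(** For each [m] the inner sum over [s] is at most [a m * M], because translation is injective. With
    [s] finite, only a finite sum ever has to be exchanged with an infinite one. *)
Lemma sums_conv (T : zmodType) (a b : T -> R) L M : (forall i, 0 <= a i) -> (forall i, 0 <= b i) ->
  sums a L -> sums b M -> forall s, uniq s -> sums (fun m => \sum_(n <- s) a m * b (n - m)) (L * M).
Proof.
move=> a0 b0 ha hb s us; rewrite mulrC; apply: sums_le (lexx _) (sumsZ (sums_ge0 hb) ha) => m.
rewrite -big_distrr /= mulrC ler_wpM2r //.
apply: (sums_inj (h := fun n => n - m) _ hb us).
by move=> x y; exact: addIr.
Qed.

End Sums.

(** * Complex sums, l^1 families and convolution *)

Section Csum.
Variables (R : realType).
Implicit Types (f g : Z3 -> R) (a b c : Z3 -> R[i]).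

Lemma maxN_ge0 f n : 0 <= Num.max (f n) 0. Proof. by rewrite le_max lexx orbT. Qed.

Lemma sums_max f D : sums (fun n => `|f n|) D -> sums (fun n => Num.max (f n) 0) D.
Proof. by apply: sums_le => // n; rewrite ge_max ler_norm normr_ge0. Qed.
Lemma sums_maxN f D : sums (fun n => `|f n|) D -> sums (fun n => Num.max (- f n) 0) D.
Proof. by move=> h; apply: (@sums_max (fun n => - f n)); under [X in sums X]funext do rewrite normrN. Qed.

Lemma esum_max_fin f D : sums (fun n => `|f n|) D ->
  (\esum_(n in [set: Z3]) (Num.max (f n) 0)%:E)%E \is a fin_num.
Proof.
move=> h; rewrite ge0_fin_numE; last by apply: esum_ge0 => n _; rewrite lee_fin maxN_ge0.
by apply/(esum_fin (maxN_ge0 _)); exists D; exact: sums_max.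
Qed.

Lemma rsum_bd f D : sums (fun n => `|f n|) D -> `|rsum f| <= D.
Proof.
move=> h; rewrite /rsum; set x := \esum_(_ in _) _; set y := \esum_(_ in _) _.
have hx : (0 <= x)%E by apply: esum_ge0 => n _; rewrite lee_fin le_max lexx orbT.
have hy : (0 <= y)%E by apply: esum_ge0 => n _; rewrite lee_fin le_max lexx orbT.
have fx : fine x <= D.
  have := sums_max h => /esum_sums; rewrite -/x => /(_ (maxN_ge0 _)) xD.
  by rewrite -lee_fin fineK // ge0_fin_numE // (le_lt_trans xD) // ltry.
have fy : fine y <= D.
  have := sums_maxN h => /esum_sums; rewrite -/y => /(_ (maxN_ge0 (fun n => - f n))) xD.
  by rewrite -lee_fin fineK // ge0_fin_numE // (le_lt_trans xD) // ltry.
have := fine_ge0 hx; have := fine_ge0 hy; rewrite ler_norml; lra.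
Qed.

Lemma rsumN f : rsum (fun n => - f n) = - rsum f.
Proof. by rewrite /rsum opprB; under [in X in _ - X]eq_esum do rewrite opprK. Qed.

(** Extended-real sums are additive on nonnegative families. Hence the identity (f+g)^+ + f^- + g^-
    = (f+g)^- + f^+ + g^+ is summed first, and rearranged once all six sums are known to be
    finite. *)
Lemma rsumD f g D E : sums (fun n => `|f n|) D -> sums (fun n => `|g n|) E ->
  rsum (fun n => f n + g n) = rsum f + rsum g.
Proof.
move=> hf hg.
have hfg : sums (fun n => `|f n + g n|) (D + E).
  by apply: sums_le (lexx _) (sumsD hf hg) => n; exact: ler_normD.
have hN (h : Z3 -> R) C : sums (fun n => `|h n|) C -> sums (fun n => `|- h n|) C.
  by under [X in _ -> sums X _]funext do rewrite normrN.
have e0 (x : R) : (0 <= (Num.max x 0)%:E :> \bar R)%E by rewrite lee_fin le_max lexx orbT.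
have mx (x : R) : Num.max x 0 = x + Num.max (- x) 0.
  by case: (leP x 0); case: (leP (- x) 0); lra.
have key : (\esum_(n in [set: Z3]) (Num.max (f n + g n) 0)%:E
   + (\esum_(n in [set: Z3]) (Num.max (- f n) 0)%:E + \esum_(n in [set: Z3]) (Num.max (- g n) 0)%:E)
   = \esum_(n in [set: Z3]) (Num.max (- (f n + g n)) 0)%:E
   + (\esum_(n in [set: Z3]) (Num.max (f n) 0)%:E + \esum_(n in [set: Z3]) (Num.max (g n) 0)%:E))%E.
  rewrite -!esumD //; try by move=> n _; rewrite ?adde_ge0 ?e0.
  apply: eq_esum => n _; rewrite -!EFinD; congr EFin.
  by rewrite (mx (f n + g n)) (mx (f n)) (mx (g n)); ring.
move: key; rewrite /rsum.
have := esum_max_fin hf; have := esum_max_fin hg; have := esum_max_fin hfg.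
have := esum_max_fin (hN _ _ hf); have := esum_max_fin (hN _ _ hg); have := esum_max_fin (hN _ _ hfg).
do 6! (set x := \esum_(_ in _) _; case: x => // ? _).
by move=> []; rewrite /=; lra.
Qed.

Lemma esum_fine (d : Z3 -> R) D : (forall n, 0 <= d n) -> sums d D ->
  sums d (fine (\esum_(n in [set: Z3]) (d n)%:E)) /\ fine (\esum_(n in [set: Z3]) (d n)%:E) <= D.
Proof.
move=> d0 hd; have h0 : (0 <= \esum_(i in [set: Z3]) (d i)%:E)%E.
  by apply: esum_ge0 => i _; rewrite lee_fin.
have hD : (\esum_(i in [set: Z3]) (d i)%:E <= D%:E)%E by apply/esum_sums.
have hf : (\esum_(i in [set: Z3]) (d i)%:E)%E \is a fin_num.
  by rewrite ge0_fin_numE // (le_lt_trans hD) // ltry.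
by split; [apply/esum_sums => //; rewrite fineK|rewrite -lee_fin fineK].
Qed.

Lemma esum_fineZ (d : Z3 -> R) D x : 0 <= x -> (forall n, 0 <= d n) -> sums d D ->
  fine (\esum_(n in [set: Z3]) (x * d n)%:E) = x * fine (\esum_(n in [set: Z3]) (d n)%:E).
Proof.
move=> x0 d0 hd.
have xd0 n : 0 <= x * d n by rewrite mulr_ge0 ?cmod_ge0.
have [h1 h2] := esum_fine d0 hd.
have [h3 h4] := esum_fine xd0 (sumsZ x0 hd).
have [_ h5] := esum_fine xd0 (sumsZ x0 h1).
apply/eqP; rewrite eq_le h5 /=.
have /orP[/eqP z0|z0] : (0 == x) || (0 < x) by rewrite -le_eqVlt.
  by rewrite -z0 mul0r fine_ge0 //; apply: esum_ge0 => n _; rewrite lee_fin mul0r.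
rewrite -ler_pdivlMl //; apply: (esum_fine d0 _).2.
have xV : 0 <= x^-1 by rewrite invr_ge0 ltW.
by apply: sums_le (lexx _) (sumsZ xV h3) => n; rewrite mulKf // gt_eqF.
Qed.

Lemma rsumZ x f D : sums (fun n => `|f n|) D -> rsum (fun n => x * f n) = x * rsum f.
Proof.
wlog x0 : x f / 0 <= x.
  move=> W h; case: (leP 0 x) => hx; first exact: W.
  have -> : (fun n => x * f n) = (fun n => - ((- x) * f n)) by apply/funext => n; ring.
  by rewrite rsumN W //; [ring|lra].
move=> h; rewrite /rsum mulrBr.
rewrite -(esum_fineZ x0 (maxN_ge0 f) (sums_max h)) -(esum_fineZ x0 (maxN_ge0 (fun n => - f n)) (sums_maxN h)).
by congr (fine _ - fine _); apply: eq_esum => n _; rewrite maxr_pMr // mulr0 ?mulrN.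
Qed.

Lemma csum_eq a b : a =1 b -> csum a = csum b.
Proof. by move=> /funext ->. Qed.

(** The factor 2 comes from bounding real and imaginary parts separately; it reappears in the
    constants of all convolution estimates. *)
Lemma csum_bd a (d : Z3 -> R) D : (forall n, cmod (a n) <= d n) -> sums d D ->
  cmod (csum a) <= 2 * D.
Proof.
move=> h hd; apply: le_trans (cmod_le _) _; rewrite /= mulr2n mulrDl mul1r.
apply: lerD; apply: rsum_bd; apply: sums_le (lexx _) hd => n; apply: le_trans (h n).
  exact: Re_le. exact: Im_le.
Qed.

Definition l1 a (L : R) := sums (fun n => cmod (a n)) L.

Lemma l1_ge0 a L : l1 a L -> 0 <= L. Proof. exact: sums_ge0. Qed.
Lemma l1_le a L M : L <= M -> l1 a L -> l1 a M.
Proof. exact: sums_le. Qed.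
Lemma l1_Re a L : l1 a L -> sums (fun n => `|complex.Re (a n)|) L.
Proof. by apply: sums_le => // n; exact: Re_le. Qed.
Lemma l1_Im a L : l1 a L -> sums (fun n => `|complex.Im (a n)|) L.
Proof. by apply: sums_le => // n; exact: Im_le. Qed.
Lemma l1D a b L M : l1 a L -> l1 b M -> l1 (fun n => a n + b n) (L + M).
Proof. by move=> ha hb; apply: sums_le (lexx _) (sumsD ha hb) => n; exact: cmodD. Qed.
Lemma l1N a L : l1 a L -> l1 (fun n => - a n) L.
Proof. by apply: sums_le => // n; rewrite cmodN. Qed.
Lemma l1B a b L M : l1 a L -> l1 b M -> l1 (fun n => a n - b n) (L + M).
Proof. by move=> ha /l1N; exact: l1D. Qed.
Lemma l1Z z a L : l1 a L -> l1 (fun n => z * a n) (cmod z * L).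
Proof. by move=> ha; apply: sums_le (lexx _) (sumsZ (cmod_ge0 z) ha) => n; rewrite cmodM. Qed.
Lemma l1_mul_sup a b L S : 0 <= S -> l1 a L -> (forall n, cmod (b n) <= S) ->
  l1 (fun n => a n * b n) (S * L).
Proof.
move=> S0 ha hb; apply: sums_le (lexx _) (sumsZ S0 ha) => n.
by rewrite cmodM mulrC ler_wpM2r ?cmod_ge0 //; exact: hb.
Qed.

Lemma l1_shift a L n : l1 a L -> l1 (fun m => a (n - m)) L.
Proof.
move=> h; apply: (@sums_inj _ _ _ (fun m => cmod (a m)) L (fun m => n - m)) h.
by move=> x y /= /addrI /oppr_inj.
Qed.

Lemma csumD a b L M : l1 a L -> l1 b M ->
  csum (fun n => a n + b n) = csum a + csum b.
Proof.
move=> ha hb; apply: complex_eq => /=.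
  under [X in rsum X]funext do rewrite cReD.
  exact: rsumD (l1_Re ha) (l1_Re hb).
under [X in rsum X]funext do rewrite cImD.
exact: rsumD (l1_Im ha) (l1_Im hb).
Qed.

Lemma csumN a : csum (fun n => - a n) = - csum a.
Proof.
apply: complex_eq => /=; rewrite -rsumN; congr rsum; apply/funext => n.
  by rewrite cReN.
by rewrite cImN.
Qed.

Lemma csumB a b L M : l1 a L -> l1 b M ->
  csum (fun n => a n - b n) = csum a - csum b.
Proof. by move=> ha /l1N hb; rewrite -csumN; exact: csumD ha hb. Qed.

Lemma csumZ z a L : l1 a L -> csum (fun n => z * a n) = z * csum a.
Proof.
move=> ha; have hR := l1_Re ha; have hI := l1_Im ha.
have hZ x f : sums (fun n => `|f n|) L -> sums (fun n => `|x * f n|) (`|x| * L).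
  by move=> h; apply: sums_le (lexx _) (sumsZ (normr_ge0 x) h) => n; rewrite normrM.
apply: complex_eq; rewrite ?cReM ?cImM /=.
  under [X in rsum X = _]funext do rewrite cReM -mulNr.
  by rewrite (rsumD (hZ _ _ hR) (hZ _ _ hI)) (rsumZ _ hR) (rsumZ _ hI) mulNr.
under [X in rsum X = _]funext do rewrite cImM.
by rewrite (rsumD (hZ _ _ hI) (hZ _ _ hR)) (rsumZ _ hR) (rsumZ _ hI).
Qed.

Lemma rsum_reindex f (h : Z3 -> Z3) : bijective h -> rsum (f \o h) = rsum f.
Proof.
move=> bh; have sb : set_bij [set: Z3] [set: Z3] h by rewrite setTT_bijective.
by rewrite /rsum; congr (fine _ - fine _); rewrite [RHS](reindex_esum _ _ _ _ sb).
Qed.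

Lemma csum_reindex a (h : Z3 -> Z3) : bijective h -> csum (a \o h) = csum a.
Proof.
move=> bh; apply: complex_eq => /=.
  exact: (rsum_reindex (fun n => complex.Re (a n)) bh).
exact: (rsum_reindex (fun n => complex.Im (a n)) bh).
Qed.

Lemma csum_conj a : csum (fun n => conjc (a n)) = conjc (csum a).
Proof.
apply: complex_eq => /=; last rewrite -rsumN; congr rsum; apply/funext => n; by case: (a n).
Qed.

Lemma conv_conj a b n : (forall m, a (- m) = conjc (a m)) -> (forall m, b (- m) = conjc (b m)) ->
  conv a b (- n) = conjc (conv a b n).
Proof.
move=> ha hb; rewrite /conv -csum_conj.
rewrite -(@csum_reindex _ (fun m => - m)); last by exists (fun m => - m) => m; rewrite opprK.
by apply: csum_eq => m /=; rewrite ha -opprD hb conjcM.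
Qed.

Lemma conv_sup_l a b n S M : (forall m, cmod (a m) <= S) -> l1 b M -> cmod (conv a b n) <= 2 * (S * M).
Proof.
move=> ha hb; have S0 : 0 <= S by exact: le_trans (cmod_ge0 _) (ha 0).
apply: (csum_bd _ (sumsZ S0 (l1_shift n hb))) => m.
by rewrite /= cmodM ler_wpM2r ?cmod_ge0 //; exact: ha.
Qed.

Lemma conv_sup_r a b n L S : l1 a L -> (forall m, cmod (b m) <= S) -> cmod (conv a b n) <= 2 * (L * S).
Proof.
move=> ha hb; have S0 : 0 <= S by exact: le_trans (cmod_ge0 _) (hb 0).
rewrite [L * S]mulrC.
apply: (csum_bd _ (sumsZ S0 ha)) => m.
by rewrite /= cmodM mulrC ler_wpM2r ?cmod_ge0 //; exact: hb.
Qed.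

Lemma l1_sup a L n : l1 a L -> cmod (a n) <= L.
Proof. by move=> /sums_term; exact. Qed.

Lemma l1_convand a b L M n : l1 a L -> l1 b M -> l1 (fun m => a m * b (n - m)) (M * L).
Proof.
move=> ha hb; apply: l1_mul_sup (l1_ge0 hb) ha _ => m; exact: l1_sup hb.
Qed.

Lemma l1_conv a b L M : l1 a L -> l1 b M -> l1 (conv a b) (2 * (L * M)).
Proof.
move=> ha hb s us.
have h := @sums_conv _ _ (fun m => cmod (a m)) (fun m => cmod (b m)) L M (fun=> cmod_ge0 _) (fun=> cmod_ge0 _) ha hb s us.
pose e n := (\esum_(m in [set: Z3]) (cmod (a m) * cmod (b (n - m)))%:E)%E.
have pos n m : 0 <= cmod (a m) * cmod (b (n - m)) by rewrite mulr_ge0 ?cmod_ge0.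
have e0 n : (0 <= e n)%E by apply: esum_ge0 => m _; rewrite lee_fin.
have efin n : e n \is a fin_num.
  rewrite ge0_fin_numE //; apply/(esum_fin (pos n)); exists (M * L).
  by apply: (sums_le _ (lexx _) (l1_convand n ha hb)) => m; rewrite cmodM.
have le1 n : cmod (conv a b n) <= 2 * fine (e n).
  apply: (@csum_bd _ (fun m => cmod (a m) * cmod (b (n - m)))) => [m|]; first by rewrite cmodM.
  by apply/(esum_sums _ (pos n)); rewrite fineK.
apply: le_trans (ler_sum _ (fun n _ => le1 n)) _.
rewrite -big_distrr /= ler_wpM2l //.
rewrite -lee_fin -sumEFin; under eq_bigr do rewrite fineK //.
rewrite /e -esum_sum; last by move=> *; rewrite lee_fin.
under eq_esum do rewrite sumEFin.
by apply/esum_sums => // m; apply: sumr_ge0.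
Qed.

Lemma convBl a b c L M N n : l1 a L -> l1 b M -> l1 c N ->
  conv (fun m => a m - b m) c n = conv a c n - conv b c n.
Proof.
move=> ha hb hc; rewrite /conv -(csumB (l1_convand n ha hc) (l1_convand n hb hc)).
by apply: csum_eq => m; rewrite mulrBl.
Qed.

Lemma convBr a b c L M N n : l1 a L -> l1 b M -> l1 c N ->
  conv a (fun m => b m - c m) n = conv a b n - conv a c n.
Proof.
move=> ha hb hc; rewrite /conv -(csumB (l1_convand n ha hb) (l1_convand n ha hc)).
by apply: csum_eq => m; rewrite mulrBr.
Qed.

Lemma convB a a' b b' L L' M M' n : l1 a L -> l1 a' L' -> l1 b M -> l1 b' M' ->
  conv a b n - conv a' b' n = conv (fun m => a m - a' m) b n + conv a' (fun m => b m - b' m) n.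
Proof.
move=> ha ha' hb hb'; rewrite (convBl n ha ha' hb) (convBr n ha' hb hb'); ring.
Qed.

(** The weight is shifted onto one factor at a time: the weighted factor is measured by a supremum,
    the other in l^1. The result is linear in the weighted quantities, which is what lets weighted
    bounds propagate on an interval fixed by l^1 bounds. *)
Lemma conv_weight (w : Z3 -> R) (C : R) a b n L M S S' : (forall n, 0 <= w n) -> 0 <= C ->
  (forall n m, w n <= C * (w m + w (n - m))) ->
  l1 a L -> l1 b M -> (forall m, w m * cmod (a m) <= S) -> (forall m, w m * cmod (b m) <= S') ->
  w n * cmod (conv a b n) <= 2 * (C * (S * M + L * S')).
Proof.
move=> w0 C0 hw ha hb hS hS'.
have S0 : 0 <= S by apply: le_trans (hS 0); rewrite mulr_ge0 ?cmod_ge0.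
have S'0 : 0 <= S' by apply: le_trans (hS' 0); rewrite mulr_ge0 ?cmod_ge0.
have -> : w n * cmod (conv a b n) = cmod (csum (fun m => rC (w n) * (a m * b (n - m)))).
  rewrite -{1}[w n]ger0_norm // -cmod_rC -cmodM; congr cmod.
  by rewrite (csumZ _ (l1_convand n ha hb)).
apply: (@csum_bd _ (fun m => C * (S * cmod (b (n - m)) + S' * cmod (a m)))) => [m|].
  rewrite cmodM cmod_rC ger0_norm // cmodM.
  apply: le_trans (ler_wpM2r _ (hw n m)) _; first by rewrite mulr_ge0 ?cmod_ge0.
  rewrite -mulrA ler_wpM2l // mulrDl lerD //.
    by rewrite mulrA ler_wpM2r ?cmod_ge0.
  by rewrite mulrCA [S' * _]mulrC ler_wpM2l ?cmod_ge0.
apply: sumsZ => //; rewrite [L * _]mulrC; apply: sumsD; apply: sumsZ => //; exact: l1_shift.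
Qed.

End Csum.

(** * The equations at a single frequency *)

Section Mode.
Variable R : realType.
Implicit Types (z : R[i]) (t : R) (n : Z3) (w : cvec R).

Lemma I3_ind (P : 'I_3 -> Prop) : P 0 -> P 1 -> P 2 -> forall k, P k.
Proof.
move=> h0 h1 h2 [[|[|[|//]]] i].
- by rewrite (_ : Ordinal i = 0) //; exact: val_inj.
- by rewrite (_ : Ordinal i = 1) //; exact: val_inj.
- by rewrite (_ : Ordinal i = 2) //; exact: val_inj.
Qed.

Lemma I3_sum (V : nmodType) (F : 'I_3 -> V) : \sum_k F k = F 0 + F 1 + F 2.
Proof.
rewrite !big_ord_recl big_ord0 addr0 addrA.
by congr (F _ + F _ + F _); exact: val_inj.
Qed.

Lemma I3_11 : 1 + 1 = 2 :> 'I_3. Proof. exact: val_inj. Qed.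
Lemma I3_12 : 1 + 2 = 0 :> 'I_3. Proof. exact: val_inj. Qed.
Lemma I3_21 : 2 + 1 = 0 :> 'I_3. Proof. exact: val_inj. Qed.
Lemma I3_22 : 2 + 2 = 1 :> 'I_3. Proof. exact: val_inj. Qed.
Definition I3E := (I3_11, I3_12, I3_21, I3_22, add0r).

Lemma cvec_eq w w' : (forall k, w 0 k = w' 0 k) -> w = w'.
Proof. by move=> h; apply/rowP => k. Qed.

Lemma cvecD w w' k : (w + w') 0 k = w 0 k + w' 0 k. Proof. by rewrite mxE. Qed.
Lemma cvecN w k : (- w) 0 k = - w 0 k. Proof. by rewrite mxE. Qed.
Lemma cvecB w w' k : (w - w') 0 k = w 0 k - w' 0 k. Proof. by rewrite cvecD cvecN. Qed.
Lemma cvecZ z w k : (z *: w) 0 k = z * w 0 k. Proof. by rewrite mxE. Qed.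
Lemma cvec0 k : (0 : cvec R) 0 k = 0. Proof. by rewrite mxE. Qed.
Definition cvecE := (cvecD, cvecN, cvecZ, cvec0).

(** These operators are Fourier multipliers: the value at [n] depends on the coefficient at [n]
    only, so a constant family exposes the symbol as a map on vectors. *)
Definition curln n w : cvec R := curl (fun=> w) n.
Definition gradn n w : cvec R := gradpart (fun=> w) n.
Definition lern n w : cvec R := leray (fun=> w) n.

Lemma iC2 : iC R * iC R = -1.
Proof. by apply: complex_eq; rewrite /=; ring. Qed.
Lemma nsqE n : nsq R n = zr R n 0 ^+ 2 + zr R n 1 ^+ 2 + zr R n 2 ^+ 2.
Proof. by rewrite /nsq I3_sum. Qed.
Lemma nsq_ge0 n : 0 <= nsq R n.
Proof. by apply: sumr_ge0 => k _; rewrite sqr_ge0. Qed.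
Lemma zr2_le n k : zr R n k ^+ 2 <= nsq R n.
Proof. by rewrite /nsq (bigD1 k) //= lerDl sumr_ge0 // => i _; rewrite sqr_ge0. Qed.
Lemma nsq_eq0 n : (nsq R n == 0) = (n == 0).
Proof.
apply/idP/eqP => [/eqP h|->]; last first.
  by rewrite /nsq big1 // => k _; rewrite /zr mxE expr0n.
apply/rowP => k; rewrite mxE.
have : zr R n k ^+ 2 <= 0 by rewrite -h zr2_le.
by rewrite real_exprn_even_le0 ?num_real //= /zr intr_eq0 => /eqP.
Qed.

Lemma zr_le n k : `|zr R n k| <= Num.sqrt (nsq R n).
Proof. by apply: abs_le_sqrt; exact: zr2_le. Qed.

Lemma curlnE n w k : curln n w 0 k =
  iC R * (rC (zr R n (k + 1)) * w 0 (k + 2) - rC (zr R n (k + 2)) * w 0 (k + 1)).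
Proof. by rewrite mxE. Qed.
Lemma ndotE n w : ndot n w = rC (zr R n 0) * w 0 0 + rC (zr R n 1) * w 0 1 + rC (zr R n 2) * w 0 2.
Proof. by rewrite /ndot I3_sum. Qed.
(** At [n = 0] both sides vanish because [zr R n k] does, whatever the inverse of 0 is; later
    computations then need no case distinction for the mean. *)
Lemma gradnE n w k : gradn n w 0 k = rC (nsq R n)^-1 * ndot n w * rC (zr R n k).
Proof.
rewrite /gradn /gradpart; case: eqP => [->|_].
  by rewrite !mxE /zr mxE mulr0.
rewrite !mxE; congr (_ * _ * _).
have [->|h] := eqVneq (nsq R n) 0; first by rewrite (invr0 R) rC0 invr0.
have hC : rC (nsq R n) != 0 by apply/eqP => -[] /eqP; apply/negP.
by apply: (mulfI hC); rewrite mulfV // -rCM mulfV.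
Qed.

Lemma lernE n w : lern n w = w - gradn n w. Proof. by []. Qed.

Lemma nsqC n : rC (nsq R n) = rC (zr R n 0) * rC (zr R n 0) + rC (zr R n 1) * rC (zr R n 1) + rC (zr R n 2) * rC (zr R n 2).
Proof. by rewrite nsqE !rCD -!rCM -!expr2. Qed.

Lemma ndot_curln n w : ndot n (curln n w) = 0.
Proof. rewrite ndotE !curlnE !I3E; ring. Qed.
Lemma curln_gradn n w : curln n (gradn n w) = 0.
Proof. by apply: cvec_eq => k; rewrite curlnE !gradnE cvecE; ring. Qed.
Lemma curlnD n w w' : curln n (w + w') = curln n w + curln n w'.
Proof. by apply: cvec_eq => k; rewrite !(curlnE, cvecE); ring. Qed.
Lemma curlnN n w : curln n (- w) = - curln n w.
Proof. by apply: cvec_eq => k; rewrite !(curlnE, cvecE); ring. Qed.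
Lemma curlnB n w w' : curln n (w - w') = curln n w - curln n w'.
Proof. by rewrite curlnD curlnN. Qed.
Lemma curlnZ n z w : curln n (z *: w) = z *: curln n w.
Proof. by apply: cvec_eq => k; rewrite !(curlnE, cvecE); ring. Qed.
Lemma curln_lern n w : curln n (lern n w) = curln n w.
Proof. by rewrite lernE curlnB curln_gradn subr0. Qed.
Lemma gradnD n w w' : gradn n (w + w') = gradn n w + gradn n w'.
Proof. by apply: cvec_eq => k; rewrite !(gradnE, cvecE) !ndotE !cvecE; ring. Qed.
Lemma gradnN n w : gradn n (- w) = - gradn n w.
Proof. by apply: cvec_eq => k; rewrite !(gradnE, cvecE) !ndotE !cvecE; ring. Qed.
Lemma gradnZ n z w : gradn n (z *: w) = z *: gradn n w.
Proof. by apply: cvec_eq => k; rewrite !(gradnE, cvecE) !ndotE !cvecE; ring. Qed.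
Lemma lernD n w w' : lern n (w + w') = lern n w + lern n w'.
Proof. by rewrite !lernE gradnD opprD addrACA. Qed.
Lemma lernN n w : lern n (- w) = - lern n w.
Proof. by rewrite !lernE gradnN opprB opprK addrC. Qed.
Lemma lernB n w w' : lern n (w - w') = lern n w - lern n w'.
Proof. by rewrite lernD lernN. Qed.
Lemma lernZ n z w : lern n (z *: w) = z *: lern n w.
Proof. by rewrite !lernE gradnZ scalerBr. Qed.
Lemma gradn_curln n w : gradn n (curln n w) = 0.
Proof. by apply: cvec_eq => k; rewrite gradnE ndot_curln cvecE; ring. Qed.
Lemma lern_curln n w : lern n (curln n w) = curln n w.
Proof. by rewrite lernE gradn_curln subr0. Qed.
Lemma curln_curln n w : curln n (curln n w) = rC (nsq R n) *: lern n w.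
Proof.
have [n0|n0] := eqVneq n 0.
  apply: cvec_eq => k; rewrite curlnE !cvecE.
  have z0 j : zr R n j = 0 by rewrite n0 /zr mxE.
  have -> : nsq R n = 0 by apply/eqP; rewrite nsq_eq0 n0.
  by rewrite !z0 rC0; ring.
have hc : rC (nsq R n) * rC (nsq R n)^-1 = 1.
  by rewrite -rCM mulfV ?nsq_eq0.
apply: cvec_eq => k; rewrite lernE cvecE cvecB gradnE.
transitivity (rC (nsq R n) * w 0 k - (rC (nsq R n) * rC (nsq R n)^-1) * ndot n w * rC (zr R n k)); last by ring.
rewrite hc mul1r ndotE nsqC.
(* Two factors [iC R] are introduced on the right so that the identity becomes polynomial in [iC R],
   with no use of its square inside [ring]. *)
have e (x : R[i]) : x = - (iC R * iC R * x) by rewrite iC2 mulN1r opprK.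
by rewrite [RHS]e; move: k; apply: I3_ind; rewrite !curlnE !I3E; ring.
Qed.

Lemma divfree_gradn n w : ndot n w = 0 -> gradn n w = 0.
Proof. by move=> h; apply: cvec_eq => k; rewrite gradnE h cvecE; ring. Qed.
Lemma divfree_lern n w : ndot n w = 0 -> lern n w = w.
Proof. by move=> h; rewrite lernE divfree_gradn // subr0. Qed.

(** Each |n_j| is at most |n|, so the three terms of n . w times n_k, divided by |n|^2, contribute
    at most [3 * M]; the identity contributes [M]. *)
Lemma lern_bd n w (M : R) k : (forall k, cmod (w 0 k) <= M) -> cmod (lern n w 0 k) <= 4 * M.
Proof.
move=> h; have M0 : 0 <= M by apply: le_trans (h 0); exact: cmod_ge0.
rewrite lernE cvecB; apply: le_trans (cmodB _ _) _.
rewrite gradnE.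
have -> : 4 * M = M + 3 * M by ring.
apply: lerD => //; rewrite !cmodM !cmod_rC ger0_norm ?invr_ge0 ?nsq_ge0 //.
have [n0|n0] := eqVneq (nsq R n) 0.
  by rewrite n0 invr0 !mul0r mulr_ge0.
have c0 : 0 < nsq R n by rewrite lt_def n0 nsq_ge0.
rewrite -mulrA ler_pdivrMl // /ndot.
apply: (@le_trans _ _ ((\sum_(j < 3) Num.sqrt (nsq R n) * M) * Num.sqrt (nsq R n))).
  apply: ler_pM; rewrite ?cmod_ge0 ?zr_le //.
  apply: le_trans (cmod_sum _ _ _) _; apply: ler_sum => j _.
  by rewrite cmodM cmod_rC; apply: ler_pM => //; rewrite ?cmod_ge0 ?zr_le.
rewrite big_const_ord /= addr0.
have e : Num.sqrt (nsq R n) * Num.sqrt (nsq R n) = nsq R n by rewrite -expr2 sqr_sqrtr ?nsq_ge0.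
rewrite -[X in _ <= X * _]e; lra.
Qed.

End Mode.

(** * Energy estimate for the linear system at one frequency *)

Section ModeODE.
Variable R : realType.
Implicit Types (z : R[i]) (t : R) (n : Z3) (w : cvec R).

Definition cder (y : R -> R[i]) t z :=
  der (fun s => complex.Re (y s)) t (complex.Re z) /\ der (fun s => complex.Im (y s)) t (complex.Im z).
Definition vder (y : R -> cvec R) t w := forall k, cder (fun s => y s 0 k) t (w 0 k).

Lemma cder_eq y t z z' : cder y t z -> z = z' -> cder y t z'.
Proof. by move=> h <-. Qed.
Lemma cderD y y' t z z' : cder y t z -> cder y' t z' -> cder (fun s => y s + y' s) t (z + z').
Proof.
move=> [h1 h2] [h3 h4]; split; rewrite ?cReD ?cImD.
  by apply: der_ext (derD h1 h3) => s; rewrite cReD.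
by apply: der_ext (derD h2 h4) => s; rewrite cImD.
Qed.

Lemma cderN y t z : cder y t z -> cder (fun s => - y s) t (- z).
Proof.
move=> [h1 h2]; split; rewrite ?cReN ?cImN.
  by apply: der_ext (derN h1) => s; rewrite cReN.
by apply: der_ext (derN h2) => s; rewrite cImN.
Qed.

Lemma cderB y y' t z z' : cder y t z -> cder y' t z' -> cder (fun s => y s - y' s) t (z - z').
Proof. by move=> h /cderN; exact: cderD. Qed.
Lemma cderM y y' t z z' : cder y t z -> cder y' t z' ->
  cder (fun s => y s * y' s) t (z * y' t + y t * z').
Proof.
move=> [h1 h2] [h3 h4]; split.
  apply: der_ext (der_eq (derB (derM h1 h3) (derM h2 h4)) _) => [s|]; rewrite ?cReD !cReM //; ring.
apply: der_ext (der_eq (derD (derM h1 h4) (derM h2 h3)) _) => [s|]; rewrite ?cImD !cImM //; ring.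
Qed.

Lemma cder_cst z t : cder (fun=> z) t 0.
Proof. by split; exact: der_cst. Qed.
Lemma cderZ z y t z' : cder y t z' -> cder (fun s => z * y s) t (z * z').
Proof. by move=> h; apply: cder_eq (cderM (cder_cst z t) h) _; rewrite mul0r add0r. Qed.
Lemma cder_rC (f : R -> R) t l : der f t l -> cder (fun s => rC (f s)) t (rC l).
Proof. by move=> h; split => //=; exact: der_cst. Qed.
Lemma vder_eq y t w w' : vder y t w -> w = w' -> vder y t w'.
Proof. by move=> h <-. Qed.
Lemma vderD y y' t w w' : vder y t w -> vder y' t w' -> vder (fun s => y s + y' s) t (w + w').
Proof. by move=> h h' k; rewrite cvecE; under [X in cder X]funext do rewrite cvecE; exact: cderD. Qed.
Lemma vderN y t w : vder y t w -> vder (fun s => - y s) t (- w).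
Proof. by move=> h k; rewrite cvecE; under [X in cder X]funext do rewrite cvecE; exact: cderN. Qed.
Lemma vderB y y' t w w' : vder y t w -> vder y' t w' -> vder (fun s => y s - y' s) t (w - w').
Proof. by move=> h /vderN; exact: vderD. Qed.
Lemma vderZ f t l w : der f t l -> vder (fun s => rC (f s) *: w) t (rC l *: w).
Proof.
move=> h k; rewrite cvecE; under [X in cder X]funext do rewrite cvecE.
by apply: cder_eq (cderM (cder_rC h) (cder_cst _ _)) _; rewrite mulr0 addr0.
Qed.

Lemma vder_curln n y t w : vder y t w -> vder (fun s => curln n (y s)) t (curln n w).
Proof.
move=> h k; rewrite curlnE; under [X in cder X]funext do rewrite curlnE.
by apply: cderZ; apply: cderB; apply: cderZ; apply: h.
Qed.

Lemma vder_gradn n y t w : vder y t w -> vder (fun s => gradn n (y s)) t (gradn n w).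
Proof.
move=> h k; rewrite gradnE ndotE; under [X in cder X]funext do rewrite gradnE ndotE -mulrA mulrCA.
by rewrite -mulrA mulrCA mulrC; apply: cder_eq (cderM (cderD (cderD (cderZ _ (h 0)) (cderZ _ (h 1))) (cderZ _ (h 2))) (cder_cst _ _)) _; rewrite mulr0 addr0.
Qed.

Lemma vder_lern n y t w : vder y t w -> vder (fun s => lern n (y s)) t (lern n w).
Proof. by move=> h; apply: vderB => //; exact: vder_gradn. Qed.

Definition cdot (z z' : R[i]) : R :=
  complex.Re z * complex.Re z' + complex.Im z * complex.Im z'.
Lemma cdot_bd z z' : `|cdot z z'| <= cmod z * cmod z'.
Proof.
have -> : cdot z z' = complex.Re (conjc z * z').
  by rewrite cReM; case: z => a b /=; rewrite /cdot /=; ring.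
by apply: le_trans (Re_le _) _; rewrite cmodM cmod_conj.
Qed.

Lemma cdotzz z : cdot z z = cmod z ^+ 2.
Proof. by rewrite cmod2 /cdot /cabs2 !expr2. Qed.
Lemma der_cabs2 y t z : cder y t z -> der (fun s => cabs2 (y s)) t (2 * cdot (y t) z).
Proof.
move=> [h1 h2]; rewrite /cabs2; under [X in der X]funext do rewrite !expr2.
by apply: der_eq (derD (derM h1 h1) (derM h2 h2)) _; rewrite /cdot; ring.
Qed.

(* [V], [B], [E] are the coefficients at frequency [n], [F] stands for the momentum
   forcing div(v (x) v) - E x B - (v x B) x B and [f] for v x B. *)
Definition mode_sol (nu : R) n (T : R) (V B E F f : R -> cvec R) :=
  forall t, 0 <= t <= T -> [/\ vder V t (- (rC (nu * nsq R n) *: V t) - lern n (F t)),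
    vder B t (- curln n (E t)) & vder E t (curln n (B t) - E t - f t)].

Lemma mode_solB nu n T V B E F f V' B' E' F' f' :
  mode_sol nu n T V B E F f -> mode_sol nu n T V' B' E' F' f' ->
  mode_sol nu n T (fun s => V s - V' s) (fun s => B s - B' s) (fun s => E s - E' s)
    (fun s => F s - F' s) (fun s => f s - f' s).
Proof.
move=> h h' t tT; have [h1 h2 h3] := h t tT; have [h4 h5 h6] := h' t tT; split.
- apply: vder_eq (vderB h1 h4) _; rewrite lernB; apply: cvec_eq => k; rewrite !cvecE; ring.
- apply: vder_eq (vderB h2 h5) _; rewrite curlnB; apply: cvec_eq => k; rewrite !cvecE; ring.
- apply: vder_eq (vderB h3 h6) _; rewrite curlnB; apply: cvec_eq => k; rewrite !cvecE; ring.
Qed.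

Lemma cabs2_3_ge0 (a b c : R[i]) : 0 <= cabs2 a + cabs2 b + cabs2 c.
Proof. by apply: addr_ge0; [apply: addr_ge0|]; exact: cabs2_ge0. Qed.

(** In [energy_ineq], [72 / nu] and 64 are left by the two completed squares for the velocity and 1
    by the damped electric field; 3 counts the components. *)
Definition energy_cst (nu : R) : R := 3 * (72 / nu + 65).
Definition energy_gain (nu lam : R) : R := Num.sqrt (energy_cst nu / lam).

Lemma energy_cst_ge0 nu : 0 < nu -> 0 <= energy_cst nu.
Proof. by move=> h; rewrite mulr_ge0 // addr_ge0 // divr_ge0 // ltW. Qed.
Lemma energy_gain_ge0 nu lam : 0 <= energy_gain nu lam. Proof. exact: sqrtr_ge0. Qed.

(** The factor [3 * Num.sqrt (nsq R n) + 2] is the shape of the momentum forcing: a divergence of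
    three products, plus two products without derivative ([flux_bd]). *)
Lemma energy_ineq nu n (V B E F f : cvec R) (g : R) : 0 < nu ->
  (forall k, cmod (F 0 k) <= (3 * Num.sqrt (nsq R n) + 2) * g) ->
  (forall k, cmod (f 0 k) <= g) ->
  2 * \sum_k (cdot (V 0 k) ((- (rC (nu * nsq R n) *: V) - lern n F) 0 k)
    + cdot (B 0 k) ((- curln n E) 0 k) + cdot (E 0 k) ((curln n B - E - f) 0 k))
  <= \sum_k (cabs2 (V 0 k) + cabs2 (B 0 k) + cabs2 (E 0 k)) + energy_cst nu * g ^+ 2.
Proof.
move=> nu0 hF hf; set c := nsq R n; set r := Num.sqrt c.
have r2 : r * r = c by rewrite -expr2 sqr_sqrtr ?nsq_ge0.
have r0 : 0 <= r by exact: sqrtr_ge0.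
have g0 : 0 <= g by apply: le_trans (hf 0); exact: cmod_ge0.
have curl0 : \sum_k (cdot (B 0 k) ((- curln n E) 0 k) + cdot (E 0 k) (curln n B 0 k)) = 0.
  rewrite I3_sum !cvecE !curlnE !I3E.
  move: (B 0 0) (B 0 1) (B 0 2) (E 0 0) (E 0 1) (E 0 2) (zr R n 0) (zr R n 1) (zr R n 2).
  move=> [a0 b0] [a1 b1] [a2 b2] [c0 d0] [c1 d1] [c2 d2] x y z; rewrite /cdot /=; ring.
have hV k : 2 * cdot (V 0 k) ((- (rC (nu * c) *: V) - lern n F) 0 k)
   <= cabs2 (V 0 k) + (72 / nu + 64) * g ^+ 2.
  set v := V 0 k; set P := lern n F 0 k.
  have hP : cmod P <= 4 * ((3 * r + 2) * g) by exact: lern_bd.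
  have -> : cdot v ((- (rC (nu * c) *: V) - lern n F) 0 k) = - (nu * c * cmod v ^+ 2) - cdot v P.
    rewrite cvecB cvecN cvecZ -/v -/P -cdotzz /cdot !(cReD, cImD, cReN, cImN, cReM, cImM) /=; ring.
  have h1 : - cdot v P <= cmod v * (4 * ((3 * r + 2) * g)).
    apply: le_trans (ler_norm _) _; rewrite normrN; apply: le_trans (cdot_bd _ _) _.
    by apply: ler_wpM2l; rewrite ?cmod_ge0.
  rewrite -cmod2 -r2; set x := cmod v in h1 *.
  (* Young's inequality as completed squares: the first puts [24 * r * x * g] under the viscous term
     [2 * nu * r * r * x ^+ 2], the second puts [16 * x * g] under [x ^+ 2], which is left to
     Gronwall. *)
  have q1 : 0 <= 2 * nu * (r * x - 6 * g / nu) ^+ 2 by rewrite mulr_ge0 ?sqr_ge0 // mulr_ge0 // ltW.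
  have q2 : 0 <= (x - 8 * g) ^+ 2 by exact: sqr_ge0.
  have e1 : 2 * nu * (r * x - 6 * g / nu) ^+ 2 = 2 * nu * r * r * x ^+ 2 - 24 * r * x * g + 72 / nu * g ^+ 2.
    by field; rewrite gt_eqF.
  have e2 : (x - 8 * g) ^+ 2 = x ^+ 2 - 16 * x * g + 64 * g ^+ 2 by ring.
  rewrite e1 in q1; rewrite e2 in q2.
  have h2 : 2 * (x * (4 * ((3 * r + 2) * g))) = 24 * r * x * g + 16 * x * g by ring.
  have h3 : 2 * (- (nu * (r * r) * x ^+ 2) - cdot v P) <= - (2 * nu * r * r * x ^+ 2) + 2 * (x * (4 * ((3 * r + 2) * g))).
    have -> : 2 * (- (nu * (r * r) * x ^+ 2) - cdot v P) = - (2 * nu * r * r * x ^+ 2) + 2 * (- cdot v P) by ring.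
    by rewrite lerD2l ler_wpM2l.
  apply: le_trans h3 _; rewrite h2 mulrDl; lra.
have hE k : 2 * (cdot (E 0 k) ((curln n B - E - f) 0 k) - cdot (E 0 k) (curln n B 0 k)) <= g ^+ 2.
  have -> : cdot (E 0 k) ((curln n B - E - f) 0 k) - cdot (E 0 k) (curln n B 0 k) = - cmod (E 0 k) ^+ 2 - cdot (E 0 k) (f 0 k).
    rewrite !cvecB -cdotzz /cdot !(cReD, cImD, cReN, cImN) /=; ring.
  have h1 : - cdot (E 0 k) (f 0 k) <= cmod (E 0 k) * g.
    apply: le_trans (ler_norm _) _; rewrite normrN; apply: le_trans (cdot_bd _ _) _.
    by apply: ler_wpM2l; rewrite ?cmod_ge0.
  have q2 : 0 <= (cmod (E 0 k) - g) ^+ 2 by exact: sqr_ge0.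
  have q3 : 0 <= cmod (E 0 k) ^+ 2 by exact: sqr_ge0.
  have e2 : (cmod (E 0 k) - g) ^+ 2 = cmod (E 0 k) ^+ 2 - 2 * (cmod (E 0 k) * g) + g ^+ 2 by ring.
  rewrite e2 in q2; lra.
have -> : \sum_k (cdot (V 0 k) ((- (rC (nu * c) *: V) - lern n F) 0 k)
    + cdot (B 0 k) ((- curln n E) 0 k) + cdot (E 0 k) ((curln n B - E - f) 0 k))
  = \sum_k (cdot (V 0 k) ((- (rC (nu * c) *: V) - lern n F) 0 k)
    + (cdot (E 0 k) ((curln n B - E - f) 0 k) - cdot (E 0 k) (curln n B 0 k))).
  rewrite -[LHS]subr0 -[X in _ - X = _]curl0 -sumrB; apply: eq_bigr => k _ /=; ring.
apply: (@le_trans _ _ (\sum_k (cabs2 (V 0 k) + (72 / nu + 65) * g ^+ 2))).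
  rewrite big_distrr /=; apply: ler_sum => k _; rewrite mulrDr.
  have := hV k; have := hE k; lra.
rewrite [X in X <= _]big_split /= [X in _ <= X + _]big_split /= [X in _ <= X + _ + _]big_split /= -!addrA lerD2l sumr_const card_ord /energy_cst.
have -> : ((72 / nu + 65) * g ^+ 2) *+ 3 = 3 * (72 / nu + 65) * g ^+ 2 by rewrite -mulr_natl; ring.
rewrite addrA lerDr addr_ge0 //; apply: sumr_ge0 => k _; exact: cabs2_ge0.
Qed.

Lemma mode_est nu lam n T V B E F f (g x0 : R) : 0 < nu -> 1 <= lam ->
  mode_sol nu n T V B E F f ->
  (forall t k, 0 <= t <= T -> cmod (F t 0 k) <= (3 * Num.sqrt (nsq R n) + 2) * (g * expR (lam * t))) ->
  (forall t k, 0 <= t <= T -> cmod (f t 0 k) <= g * expR (lam * t)) ->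
  (forall k, [/\ cmod (V 0 0 k) <= x0, cmod (B 0 0 k) <= x0 & cmod (E 0 0 k) <= x0]) ->
  forall t k, 0 <= t <= T -> [/\ cmod (V t 0 k) <= expR (lam * t) * (3 * x0 + energy_gain nu lam * g),
     cmod (B t 0 k) <= expR (lam * t) * (3 * x0 + energy_gain nu lam * g) &
     cmod (E t 0 k) <= expR (lam * t) * (3 * x0 + energy_gain nu lam * g)].
Proof.
move=> nu0 lam1 hs hF hf h0 t k tT.
have lam0 : 0 < lam by apply: lt_le_trans lam1.
have T00 : 0 <= (0 : R) <= T by rewrite lexx /=; case/andP: tT; exact: le_trans.
have g0 : 0 <= g.
  have := le_trans (cmod_ge0 _) (hf 0 0 T00); by rewrite mulr0 expR0 mulr1.
have x00 : 0 <= x0 by have [h _ _] := h0 0; apply: le_trans h; exact: cmod_ge0.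
pose e s := \sum_k (cabs2 (V s 0 k) + cabs2 (B s 0 k) + cabs2 (E s 0 k)).
have e0 s : 0 <= e s by apply: sumr_ge0 => j _; exact: cabs2_3_ge0.
have ex2 s : expR (2 * lam * s) = expR (lam * s) ^+ 2 by rewrite -mulrA expRM_natl.
have K0 : 0 <= energy_cst nu * g ^+ 2 by rewrite mulr_ge0 ?energy_cst_ge0 ?sqr_ge0.
have he : e t <= expR (2 * lam * t) * (e 0 + energy_cst nu * g ^+ 2 / lam).
  apply: (@gronwall_energy _ e (fun t => 2 * \sum_k (cdot (V t 0 k) ((- (rC (nu * nsq R n) *: V t) - lern n (F t)) 0 k)
    + cdot (B t 0 k) ((- curln n (E t)) 0 k) + cdot (E t 0 k) ((curln n (B t) - E t - f t) 0 k))) T lam _ lam1 K0 _ _ _ t tT) => //.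
  - move=> s sT; have [h1 h2 h3] := hs s sT; rewrite big_distrr /=.
    apply: der_sum => j.
    apply: der_eq (derD (derD (der_cabs2 (h1 j)) (der_cabs2 (h2 j))) (der_cabs2 (h3 j))) _.
    by rewrite -!mulrDr.
  - move=> s sT.
    have := @energy_ineq nu n (V s) (B s) (E s) (F s) (f s) _ nu0 (fun k => hF s k sT) (fun k => hf s k sT).
    move=> /= /le_trans; apply.
    by rewrite exprMn ex2 /e mulrA.
(* Nine components of modulus at most [x0] have energy at most [(3 * x0) ^+ 2]. The bound on [e t]
   is then a sum of two squares, at most the square of [3 * x0 + energy_gain nu lam * g] up to the
   exponential. *)
have he0 : e 0 <= (3 * x0) ^+ 2.
  have -> : (3 * x0) ^+ 2 = \sum_(j < 3) (x0 ^+ 2 + x0 ^+ 2 + x0 ^+ 2).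
    by rewrite sumr_const card_ord -mulr_natl; ring.
  apply: ler_sum => j _; have [h1 h2 h3] := h0 j; rewrite -!cmod2.
  by apply: lerD; [apply: lerD|]; rewrite ler_sqr ?nnegrE ?cmod_ge0.
have hk : energy_cst nu * g ^+ 2 / lam = (energy_gain nu lam * g) ^+ 2.
  rewrite exprMn sqr_sqrtr; first by ring.
  by rewrite divr_ge0 ?energy_cst_ge0 // ltW.
have kg : 0 <= energy_gain nu lam * g by rewrite mulr_ge0 ?energy_gain_ge0.
have fin : e t <= (expR (lam * t) * (3 * x0 + energy_gain nu lam * g)) ^+ 2.
  apply: le_trans he _; rewrite exprMn ex2 ler_wpM2l ?expR_ge0 // hk.
  rewrite sqrrD -addrA lerD // lerDr mulrn_wge0 // mulr_ge0 // mulr_ge0 //.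
have fin0 : 0 <= expR (lam * t) * (3 * x0 + energy_gain nu lam * g).
  by rewrite mulr_ge0 ?expR_ge0 // addr_ge0 // mulr_ge0.
have part z : cabs2 z <= e t -> cmod z <= expR (lam * t) * (3 * x0 + energy_gain nu lam * g).
  move=> h; rewrite -(ler_sqr (x := cmod z)) ?nnegrE ?cmod_ge0 // cmod2.
  exact: le_trans fin.
have sub : cabs2 (V t 0 k) + cabs2 (B t 0 k) + cabs2 (E t 0 k) <= e t.
  rewrite /e (bigD1 k) //= lerDl; apply: sumr_ge0 => j _; exact: cabs2_3_ge0.
have := cabs2_ge0 (V t 0 k); have := cabs2_ge0 (B t 0 k); have := cabs2_ge0 (E t 0 k) => p1 p2 p3.
by split; apply: part; apply: le_trans sub; lra.
Qed.

End ModeODE.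

(** * The Duhamel formulas as solutions of the first-order system *)

Section MildMode.
Variable R : realType.
Implicit Types (z : R[i]) (t T : R) (n : Z3) (w : cvec R).

Lemma curln0 n : curln n 0 = 0 :> cvec R.
Proof. by rewrite -(scale0r (0 : cvec R)) curlnZ !scale0r. Qed.
Lemma gradn0 n : gradn n 0 = 0 :> cvec R.
Proof. by rewrite -(scale0r (0 : cvec R)) gradnZ !scale0r. Qed.
Lemma lern0 n : lern n 0 = 0 :> cvec R.
Proof. by rewrite lernE gradn0 subr0. Qed.

Lemma cont_extD T (f g : R -> R) : cont_ext T f -> cont_ext T g -> cont_ext T (fun t => f t + g t).
Proof.
move=> [f' cf hf] [g' cg hg]; exists (fun t => f' t + g' t).
  by move=> t; apply: cvgD; [exact: cf|exact: cg].
by move=> t tT; rewrite hf // hg.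
Qed.

Lemma cont_extZ T c (f : R -> R) : cont_ext T f -> cont_ext T (fun t => c * f t).
Proof.
move=> [f' cf hf]; exists (fun t => c * f' t).
  by move=> t; apply: cvgM; [exact: cvg_cst|exact: cf].
by move=> t tT; rewrite hf.
Qed.

Definition ccont T (y : R -> R[i]) :=
  cont_ext T (fun t => complex.Re (y t)) /\ cont_ext T (fun t => complex.Im (y t)).
Definition vcont T (y : R -> cvec R) := forall k, ccont T (fun t => y t 0 k).

Lemma ccontD T y y' : ccont T y -> ccont T y' -> ccont T (fun t => y t + y' t).
Proof.
move=> [h1 h2] [h3 h4]; split.
  by under [X in cont_ext _ X]funext do rewrite cReD; exact: cont_extD.
by under [X in cont_ext _ X]funext do rewrite cImD; exact: cont_extD.
Qed.

Lemma ccontZ T z y : ccont T y -> ccont T (fun t => z * y t).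
Proof.
move=> [h1 h2]; split.
  under [X in cont_ext _ X]funext do rewrite cReM -mulNr.
  by apply: cont_extD; exact: cont_extZ.
under [X in cont_ext _ X]funext do rewrite cImM.
by apply: cont_extD; exact: cont_extZ.
Qed.

Lemma ccontN T y : ccont T y -> ccont T (fun t => - y t).
Proof. by move=> h; under [X in ccont _ X]funext do rewrite -mulN1r; exact: ccontZ. Qed.
Lemma ccontB T y y' : ccont T y -> ccont T y' -> ccont T (fun t => y t - y' t).
Proof. by move=> h /ccontN; exact: ccontD. Qed.
Lemma vcontB T y y' : vcont T y -> vcont T y' -> vcont T (fun t => y t - y' t).
Proof. by move=> h h' k; under [X in ccont _ X]funext do rewrite cvecB; exact: ccontB. Qed.
Lemma vcont_curln T n y : vcont T y -> vcont T (fun t => curln n (y t)).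
Proof.
move=> h k; under [X in ccont _ X]funext do rewrite curlnE.
by apply: ccontZ; apply: ccontB; apply: ccontZ; exact: h.
Qed.

Lemma vcont_gradn T n y : vcont T y -> vcont T (fun t => gradn n (y t)).
Proof.
move=> h k; under [X in ccont _ X]funext do rewrite gradnE ndotE mulrAC.
by apply: ccontZ; apply: ccontD; [apply: ccontD|]; apply: ccontZ; exact: h.
Qed.

Lemma vcont_lern T n y : vcont T y -> vcont T (fun t => lern n (y t)).
Proof. by move=> h; apply: vcontB => //; exact: vcont_gradn. Qed.

Definition vint t (G : R -> cvec R) : cvec R :=
  \row_k Complex (\int[lebesgue_measure]_(s in `[0%R, t]) complex.Re (G s 0 k))
                 (\int[lebesgue_measure]_(s in `[0%R, t]) complex.Im (G s 0 k)).

Lemma vint_rC t (q : R -> R) (f : R -> cvec R) w :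
  (forall k, \int[lebesgue_measure]_(s in `[0%R, t]) (q s * complex.Re (f s 0 k)) = complex.Re (w 0 k)) ->
  (forall k, \int[lebesgue_measure]_(s in `[0%R, t]) (q s * complex.Im (f s 0 k)) = complex.Im (w 0 k)) ->
  vint t (fun s => rC (q s) *: f s) = w.
Proof.
move=> hR hI; apply: cvec_eq => k; rewrite mxE; apply: complex_eq => /=.
  by rewrite -hR; congr Rintegral; apply/funext => s; rewrite cvecZ cReM /= mul0r subr0.
by rewrite -hI; congr Rintegral; apply/funext => s; rewrite cvecZ cImM /= mul0r addr0.
Qed.

Lemma vheat_exists c T f : vcont T f -> exists K : R -> cvec R, K 0 = 0 /\
  forall t, 0 <= t <= T -> vder K t (f t - rC c *: K t).
Proof.
move=> hf; have : forall k, exists y : R -> R[i], y 0 = 0 /\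
    forall t, 0 <= t <= T -> cder y t (f t 0 k - rC c * y t).
  move=> k; have [h1 h2] := hf k.
  have [K1 [K10 hK1]] := heat_exists c h1; have [K2 [K20 hK2]] := heat_exists c h2.
  exists (fun t => Complex (K1 t) (K2 t)); split; first by rewrite K10 K20.
  move=> t tT; split; rewrite ?cReD ?cImD ?cReN ?cImN ?cReM ?cImM /= ?mul0r ?subr0 ?addr0.
    exact: hK1. exact: hK2.
move=> /choice [K hK]; exists (fun t => \row_k K k t); split.
  by apply: cvec_eq => k; rewrite !mxE; have [] := hK k.
move=> t tT k; have [_ /(_ t tT) h] := hK k.
under [X in cder X]funext do rewrite mxE.
by apply: cder_eq h _; rewrite cvecB cvecZ mxE.
Qed.

Lemma vheat_eval c T f K t : vcont T f -> K 0 = 0 ->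
  (forall t, 0 <= t <= T -> vder K t (f t - rC c *: K t)) -> 0 <= t <= T ->
  vint t (fun s => rC (expR (- (c * (t - s)))) *: f s) = K t.
Proof.
move=> hf K0 hK tT; apply: vint_rC => k; have [h1 h2] := hf k.
  apply: (heat_eval (K := fun t => complex.Re (K t 0 k)) h1 _ _ tT); first by rewrite K0 mxE.
  move=> s sT; have [h _] := hK s sT k; apply: der_eq h _.
  by rewrite cvecB cvecZ cReD cReN cReM /= mul0r subr0.
apply: (heat_eval (K := fun t => complex.Im (K t 0 k)) h2 _ _ tT); first by rewrite K0 mxE.
move=> s sT; have [_ h] := hK s sT k; apply: der_eq h _.
by rewrite cvecB cvecZ cImD cImN cImM /= mul0r addr0.
Qed.

Lemma vwave_exists n T f : vcont T f -> exists I J : R -> cvec R, [/\ I 0 = 0, J 0 = 0 &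
  forall t, 0 <= t <= T -> vder I t (J t) /\ vder J t (f t - J t - rC (nsq R n) *: I t)].
Proof.
have [p0 d0 hp hd _] := Phi2_facts R n.
move=> hf; have : forall k, exists y : (R -> R[i]) * (R -> R[i]), [/\ y.1 0 = 0, y.2 0 = 0 &
    forall t, 0 <= t <= T -> cder y.1 t (y.2 t) /\ cder y.2 t (f t 0 k - y.2 t - rC (nsq R n) * y.1 t)].
  move=> k; have [h1 h2] := hf k.
  have [I1 [J1 [I10 J10 hJ1]]] := wave_exists p0 d0 hp hd h1.
  have [I2 [J2 [I20 J20 hJ2]]] := wave_exists p0 d0 hp hd h2.
  exists (fun t => Complex (I1 t) (I2 t), fun t => Complex (J1 t) (J2 t)).
  split => /=; rewrite ?I10 ?I20 ?J10 ?J20 //.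
  move=> t tT; have [a1 a2] := hJ1 t tT; have [b1 b2] := hJ2 t tT; split; split => //;
  by rewrite ?cReD ?cImD ?cReN ?cImN ?cReM ?cImM /= ?mul0r ?subr0 ?addr0.
move=> /choice [K hK]; exists (fun t => \row_k (K k).1 t), (fun t => \row_k (K k).2 t); split.
- by apply: cvec_eq => k; rewrite !mxE; have [] := hK k.
- by apply: cvec_eq => k; rewrite !mxE; have [] := hK k.
move=> t tT; split => k; have [_ _ /(_ t tT) [h1 h2]] := hK k.
  by under [X in cder X]funext do rewrite mxE; rewrite mxE.
under [X in cder X]funext do rewrite mxE.
by apply: cder_eq h2 _; rewrite !cvecB cvecZ !mxE.
Qed.

Lemma vwave_eval n T f I J t : vcont T f -> I 0 = 0 -> J 0 = 0 ->
  (forall t, 0 <= t <= T -> vder I t (J t) /\ vder J t (f t - J t - rC (nsq R n) *: I t)) ->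
  0 <= t <= T ->
  vint t (fun s => rC (Phi2 (t - s) n) *: f s) = I t /\
  vint t (fun s => rC (dPhi2 (t - s) n) *: f s) = J t.
Proof.
have [p0 d0 hp hd _] := Phi2_facts R n.
move=> hf I0 J0 hIJ tT.
have hR k : (\int[lebesgue_measure]_(s in `[0%R, t]) (Phi2 (t - s) n * complex.Re (f s 0 k))) = complex.Re (I t 0 k) /\
   (\int[lebesgue_measure]_(s in `[0%R, t]) (dPhi2 (t - s) n * complex.Re (f s 0 k))) = complex.Re (J t 0 k).
  have [h1 _] := hf k.
  apply: (wave_eval (I := fun t => complex.Re (I t 0 k)) (J := fun t => complex.Re (J t 0 k)) p0 d0 hp hd h1 _ _ _ _ tT).
  - by rewrite I0 mxE.
  - by rewrite J0 mxE.
  - by move=> s sT; have [/(_ k) [a _] _] := hIJ s sT.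
  - move=> s sT; have [_ /(_ k) [a _]] := hIJ s sT; apply: der_eq a _.
    by rewrite !cvecB cvecZ !cReD !cReN cReM /= mul0r subr0.
have hI k : (\int[lebesgue_measure]_(s in `[0%R, t]) (Phi2 (t - s) n * complex.Im (f s 0 k))) = complex.Im (I t 0 k) /\
   (\int[lebesgue_measure]_(s in `[0%R, t]) (dPhi2 (t - s) n * complex.Im (f s 0 k))) = complex.Im (J t 0 k).
  have [_ h1] := hf k.
  apply: (wave_eval (I := fun t => complex.Im (I t 0 k)) (J := fun t => complex.Im (J t 0 k)) p0 d0 hp hd h1 _ _ _ _ tT).
  - by rewrite I0 mxE.
  - by rewrite J0 mxE.
  - by move=> s sT; have [/(_ k) [_ a] _] := hIJ s sT.
  - move=> s sT; have [_ /(_ k) [_ a]] := hIJ s sT; apply: der_eq a _.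
    by rewrite !cvecB cvecZ !cImD !cImN cImM /= mul0r addr0.
by split; apply: vint_rC => k; have [? ?] := hR k; have [? ?] := hI k.
Qed.

Definition heatk (nu s : R) (n : Z3) : R := expR (- (nu * nsq R n * s)).
Definition mildV nu (v0 : field R) (F : R -> field R) t : field R :=
  fsub (mult (heatk nu t) v0) (duhamel (heatk nu) t (fun s => leray (F s))).
Definition mildB (B0 E0 : field R) (f : R -> field R) t : field R :=
  fadd (fadd (mult (Phi1 t) B0) (mult (Phi2 t) (fadd (fscale (rC 2^-1) B0) (fscale (-1) (curl E0)))))
       (duhamel (@Phi2 R) t (fun s => curl (f s))).
(** [f0] stands for v0 x B0 in the initial time derivative and is kept apart from [f 0]: that a mild
    solution takes its initial values is a consequence of the formulas, not part of them. *)
Definition mildE (B0 E0 f0 : field R) (f : R -> field R) t : field R :=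
  fadd
    (fsub (fadd (fadd (mult (Phi1 t) (leray E0))
        (mult (Phi2 t) (fadd (fscale (rC 2^-1) (leray E0)) (leray (fsub (fsub (curl B0) E0) f0)))))
        (mult (Phi2 t) (leray (f 0))))
      (duhamel (@dPhi2 R) t (fun s => leray (f s))))
    (fsub (mult (fun _ => expR (- t)) (gradpart E0))
      (duhamel (fun tau _ => expR (- tau)) t (fun s => gradpart (f s)))).

(** The forcing is treated as given, so the statement serves solutions and Picard iterates alike.
    Symbols commute with time integration: the wave potential [I], [J] of the unprojected [f] yields
    the integrals with [curl] and [leray], and the potential [L] of rate 1 the gradient part.
    Solenoidality of [B0] enters because curl curl is [nsq R n] times the Leray projection. *)
Lemma mild_mode nu n T (v0 B0 E0 f0 : field R) (F f : R -> field R) : 0 <= T ->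
  vcont T (fun t => F t n) -> vcont T (fun t => f t n) -> divfree B0 -> f 0 n = f0 n ->
  exists V B E : R -> cvec R,
    [/\ mode_sol nu n T V B E (fun t => F t n) (fun t => f t n),
      V 0 = v0 n, B 0 = B0 n, E 0 = E0 n &
      forall t, 0 <= t <= T -> [/\ mildV nu v0 F t n = V t, mildB B0 E0 f t n = B t &
         mildE B0 E0 f0 f t n = E t]].
Proof.
move=> T0 hF hf dB hf0.
have [p0 d0 hp hd hP] := Phi2_facts R n.
set c := nsq R n in hp hd *.
have [K [K0 hK]] := vheat_exists (nu * c) (vcont_lern n hF).
have [I [J [I0 J0 hIJ]]] := vwave_exists n hf.
have [L [L0 hL]] := vheat_exists 1 hf.
have hh : rC 2^-1 + rC 2^-1 = 1 :> R[i].
  by rewrite -rCD -rC1; congr rC; lra.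
have dBn : lern n (B0 n) = B0 n by apply: divfree_lern; exact: dB.
have [p Ep] : exists p : R -> R, p = (fun t => Phi2 t n) by exists (fun t => Phi2 t n).
have [dp Edp] : exists dp : R -> R, dp = (fun t => dPhi2 t n) by exists (fun t => dPhi2 t n).
have Ept t : Phi2 t n = p t by rewrite Ep.
have Edpt t : dPhi2 t n = dp t by rewrite Edp.
have hp' t : der p t (dp t) by rewrite Ep Edp; exact: hp.
have hd' t : der dp t (- dp t - c * p t) by rewrite Ep Edp; exact: hd.
have p00 : p 0 = 0 by rewrite Ep.
have dp00 : dp 0 = 1 by rewrite Edp.
have hdpp t : der (fun s => dp s + p s) t (- (c * p t)).
  by apply: der_eq (derD (hd' t) (hp' t)) _; ring.
exists (fun t => rC (expR (- (nu * c) * t)) *: v0 n - K t).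
(* Since [Phi1] is [dPhi2 + Phi2 / 2], the value [B0] is multiplied by [dp + p]. In the electric
   field, [Phi2] times P f(0), left by the integration by parts, cancels - P f0 in the initial time
   derivative (this is [hf0]), and the term - P E0 there reduces the factor of P E0 to [dp]. *)
exists (fun t => rC (dp t + p t) *: B0 n - rC (p t) *: curln n (E0 n) + curln n (I t)).
exists (fun t => rC (dp t) *: lern n (E0 n) + rC (p t) *: curln n (B0 n) - lern n (J t)
   + (rC (expR (- 1 * t)) *: gradn n (E0 n) - gradn n (L t))).
split.
- move=> t tT; have [hI hJ] := hIJ t tT; split.
  + apply: vder_eq (vderB (vderZ _ (der_expM _ _)) (hK t tT)) _.
    apply: cvec_eq => k; rewrite !cvecE !rCM rCN rCM; ring.
  + apply: vder_eq (vderD (vderB (vderZ _ (hdpp t)) (vderZ _ (hp' t))) (vder_curln n hI)) _.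
    rewrite !(curlnD, curlnN, curlnZ, curln_lern, curln_gradn) curln_curln dBn -/c.
    by apply: cvec_eq => k; rewrite !cvecE !rCN !rCM; ring.
  + apply: vder_eq (vderD (vderB (vderD (vderZ _ (hd' t)) (vderZ _ (hp' t))) (vder_lern n hJ)) (vderB (vderZ _ (der_expM _ _)) (vder_gradn n (hL t tT)))) _.
    rewrite !(curlnD, curlnN, curlnZ) !curln_curln -/c !lernE !(gradnD, gradnN, gradnZ).
    have -> : rC (- dp t - c * p t) = - rC (dp t) - rC c * rC (p t) by rewrite rCD !rCN rCM.
    have -> : rC (dp t + p t) = rC (dp t) + rC (p t) by rewrite rCD.
    have -> : rC (- 1 * expR (- 1 * t)) = - rC (expR (- 1 * t)) by rewrite mulN1r rCN.
    rewrite rC1; move: (rC (expR _)) (rC (dp t)) (rC (p t)) (rC c) => x1 x2 x3 x4.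
    move: (curln n (B0 n)) (gradn n (E0 n)) (gradn n (f t n)) (gradn n (J t)) (gradn n (I t)) (gradn n (L t)).
    move: (E0 n) (f t n) (J t) (I t) => a1 a2 a3 a4 a5 a6 a7 a8 a9 a10.
    by apply: cvec_eq => k; rewrite !cvecE; ring.
- by rewrite mulr0 expR0 K0 subr0 scale1r.
- by rewrite dp00 p00 I0 addr0 !scale1r scale0r subr0 curln0 addr0.
- rewrite dp00 p00 J0 L0 mulr0 expR0 !scale1r scale0r addr0.
  by rewrite lern0 gradn0 !subr0 lernE subrK.
- move=> t tT.
  have hcIJ s : 0 <= s <= T -> vder (fun s => curln n (I s)) s (curln n (J s)) /\
     vder (fun s => curln n (J s)) s (curln n (f s n) - curln n (J s) - rC (nsq R n) *: curln n (I s)).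
    move=> sT; have [hI hJ] := hIJ s sT; split; first exact: vder_curln.
    by apply: vder_eq (vder_curln n hJ) _; rewrite !curlnB curlnZ.
  have hlIJ s : 0 <= s <= T -> vder (fun s => lern n (I s)) s (lern n (J s)) /\
     vder (fun s => lern n (J s)) s (lern n (f s n) - lern n (J s) - rC (nsq R n) *: lern n (I s)).
    move=> sT; have [hI hJ] := hIJ s sT; split; first exact: vder_lern.
    by apply: vder_eq (vder_lern n hJ) _; rewrite !lernB lernZ.
  have hgL s : 0 <= s <= T -> vder (fun s => gradn n (L s)) s (gradn n (f s n) - rC 1 *: gradn n (L s)).
    move=> sT; apply: vder_eq (vder_gradn n (hL s sT)) _.
    by rewrite gradnD gradnN gradnZ.
  have eV := vheat_eval (vcont_lern n hF) K0 hK tT.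
  have z1 : curln n (I 0) = 0 by rewrite I0 curln0.
  have z2 : curln n (J 0) = 0 by rewrite J0 curln0.
  have z3 : lern n (I 0) = 0 by rewrite I0 lern0.
  have z4 : lern n (J 0) = 0 by rewrite J0 lern0.
  have z5 : gradn n (L 0) = 0 by rewrite L0 gradn0.
  have [eB _] := vwave_eval (vcont_curln n hf) z1 z2 hcIJ tT.
  have [_ eE] := vwave_eval (vcont_lern n hf) z3 z4 hlIJ tT.
  have eG := vheat_eval (vcont_gradn n hf) z5 hgL tT.
  split.
  + rewrite -eV mulNr; congr (_ - _).
  + rewrite -eB /mildB /fadd; congr (_ + _).
    rewrite /mult /fscale hP Ept Edpt; change (curl E0 n) with (curln n (E0 n)).
    rewrite !rCD rCM; move: (rC (dp t)) (rC (p t)) (curln n (E0 n)) (B0 n) => x1 x2 a1 a2.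
    apply: cvec_eq => k; rewrite !cvecE.
    transitivity ((x1 + x2 * (rC 2^-1 + rC 2^-1)) * a2 0 k - x2 * a1 0 k); first by ring.
    by rewrite hh; ring.
  + rewrite -eE /mildE /fadd /fsub /mult hP Ept Edpt -eG.
    have -> : duhamel (fun tau _ => expR (- tau)) t (fun s => gradpart (f s)) n
      = vint t (fun s => rC (expR (- (1 * (t - s)))) *: gradn n (f s n)).
      by under [X in _ = vint _ X]funext do rewrite mul1r.
    change (duhamel (@dPhi2 R) t (fun s => leray (f s)) n) with (vint t (fun s => rC (dPhi2 (t - s) n) *: lern n (f s n))).
    change (leray E0 n) with (lern n (E0 n)); change (gradpart E0 n) with (gradn n (E0 n)).
    change (leray (fun n0 => curl B0 n0 - E0 n0 - f0 n0) n) with (lern n (curln n (B0 n) - E0 n - f0 n)).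
    change (leray (f 0) n) with (lern n (f 0 n)).
    rewrite hf0 !lernB lern_curln mulN1r !rCD rCM /fscale.
    change (leray E0 n) with (lern n (E0 n)).
    move: (rC (dp t)) (rC (p t)) (vint _ _) (vint _ _) (rC (expR _)) => x1 x2 x3 x4 x5.
    move: (lern n (E0 n)) (curln n (B0 n)) (lern n (f0 n)) (gradn n (E0 n)) => a1 a2 a3 a4.
    apply: cvec_eq => k; rewrite !cvecE.
    transitivity ((x1 + x2 * (rC 2^-1 + rC 2^-1)) * a1 0 k + x2 * (a2 0 k - a1 0 k) - x3 0 k + x5 * a4 0 k - x4 0 k); first by ring.
    by rewrite hh; ring.
Qed.

End MildMode.

(** * Nonlinear estimates *)

Section Nonlinear.
Variable R : realType.
Implicit Types (a b : Z3 -> R[i]) (u w : field R) (A : Z3 -> R).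

Lemma four_half : 4 = 2 + 2 :> R. Proof. by ring. Qed.

(** Convolution of nonnegative majorants. Taking the value of the sum, rather than some bound for
    it, makes the operation monotone, as the increasing Picard majorants require. *)
Definition rc A (B : Z3 -> R) n : R := fine (\esum_(m in [set: Z3]) (A m * B (n - m))%:E).

Section rc.
Variables (A B : Z3 -> R) (L M : R).
Hypotheses (A0 : forall n, 0 <= A n) (B0 : forall n, 0 <= B n) (hA : sums A L) (hB : sums B M).
Let pos n m : 0 <= A m * B (n - m). Proof. exact: mulr_ge0. Qed.
Lemma rc_summand n : sums (fun m => A m * B (n - m)) (M * L).
Proof.
apply: sums_le (lexx _) (sumsZ (sums_ge0 hB) hA) => m.
by rewrite mulrC ler_wpM2r // (sums_term _ hB).
Qed.

Lemma rc_sums n : sums (fun m => A m * B (n - m)) (rc A B n).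
Proof. exact: (esum_fine (pos n) (rc_summand n)).1. Qed.
Lemma rc_min n D : sums (fun m => A m * B (n - m)) D -> rc A B n <= D.
Proof. exact: (fun h => (esum_fine (pos n) h).2). Qed.
Lemma rc_ge0 n : 0 <= rc A B n.
Proof. exact: sums_ge0 (rc_sums n). Qed.
Lemma sums_rc : sums (rc A B) (L * M).
Proof.
move=> s us; have h := sums_conv A0 B0 hA hB us.
have fin n : \esum_(m in [set: Z3]) (A m * B (n - m))%:E \is a fin_num.
  rewrite ge0_fin_numE; last by apply: esum_ge0 => m _; rewrite lee_fin.
  by apply/(esum_fin (pos n)); exists (M * L); exact: rc_summand.
rewrite -lee_fin -sumEFin; under eq_bigr do rewrite fineK //.
rewrite -esum_sum; last by move=> *; rewrite lee_fin.
under eq_esum do rewrite sumEFin.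
by apply/esum_sums => // m; apply: sumr_ge0 => n _; exact: pos.
Qed.

Lemma conv_rc a b n : (forall n, cmod (a n) <= A n) -> (forall n, cmod (b n) <= B n) ->
  cmod (conv a b n) <= 2 * rc A B n.
Proof.
move=> ha hb; apply: (csum_bd _ (rc_sums n)) => m.
by rewrite cmodM; apply: ler_pM; rewrite ?cmod_ge0.
Qed.

End rc.

Lemma rc_mono A (B : Z3 -> R) A' (B' : Z3 -> R) L M n : (forall n, 0 <= A n) -> (forall n, 0 <= B n) ->
  (forall n, A n <= A' n) -> (forall n, B n <= B' n) -> sums A' L -> sums B' M ->
  rc A B n <= rc A' B' n.
Proof.
move=> A0 B0 hA hB sA sB.
have A'0 m : 0 <= A' m by apply: le_trans (hA m).
have B'0 m : 0 <= B' m by apply: le_trans (hB m).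
apply: rc_min => //; apply: sums_le (lexx _) (rc_sums A'0 B'0 sA sB n) => m.
by apply: ler_pM.
Qed.

Definition fl1 u M := forall k, l1 (comp u k) M.

Lemma fl1_le u L M : L <= M -> fl1 u L -> fl1 u M.
Proof. by move=> h hu k; apply: l1_le (hu k). Qed.
Lemma fl1_ge0 u M : fl1 u M -> 0 <= M.
Proof. by move=> h; exact: l1_ge0 (h 0). Qed.

Lemma crossE u w n k : cross u w n 0 k =
  conv (comp u (k + 1)) (comp w (k + 2)) n - conv (comp u (k + 2)) (comp w (k + 1)) n.
Proof. by rewrite mxE. Qed.

Lemma fl1_cross u w L M : fl1 u L -> fl1 w M -> fl1 (cross u w) (4 * (L * M)).
Proof.
move=> hu hw k; rewrite /comp; under [X in l1 X]funext do rewrite crossE.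
apply: l1_le (l1B (l1_conv (hu _) (hw _)) (l1_conv (hu _) (hw _))); lra.
Qed.

Lemma conv_diff_sup a a' b b' n L M S S' : l1 a L -> l1 a' L -> l1 b M -> l1 b' M ->
  (forall n, cmod (a n - a' n) <= S) -> (forall n, cmod (b n - b' n) <= S') ->
  cmod (conv a b n - conv a' b' n) <= 2 * (S * M + L * S').
Proof.
move=> ha ha' hb hb' hS hS'; rewrite (convB n ha ha' hb hb').
apply: le_trans (cmodD _ _) _; rewrite mulrDr; apply: lerD.
  exact: conv_sup_l.
exact: conv_sup_r.
Qed.

Lemma cross_diff_sup u u' w w' n k L M S S' : fl1 u L -> fl1 u' L -> fl1 w M -> fl1 w' M ->
  (forall n k, cmod (u n 0 k - u' n 0 k) <= S) -> (forall n k, cmod (w n 0 k - w' n 0 k) <= S') ->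
  cmod (cross u w n 0 k - cross u' w' n 0 k) <= 4 * (S * M + L * S').
Proof.
move=> hu hu' hw hw' hS hS'; rewrite !crossE.
have -> : forall x1 x2 y1 y2 : R[i], x1 - x2 - (y1 - y2) = (x1 - y1) - (x2 - y2) by move=> *; ring.
apply: le_trans (cmodB _ _) _; rewrite four_half mulrDl.
by apply: lerD; apply: conv_diff_sup => // m; [exact: hS|exact: hS'|exact: hS|exact: hS'].
Qed.

Definition FF (v B E : field R) : field R :=
  fsub (fsub (divtens v v) (cross E B)) (cross (cross v B) B).

Lemma FFE (v B E : field R) n k : FF v B E n 0 k =
  iC R * (\sum_j rC (zr R n j) * conv (comp v j) (comp v k) n) - cross E B n 0 k
  - cross (cross v B) B n 0 k.
Proof. by rewrite /FF /fsub !cvecB; congr (_ - _ - _); rewrite mxE. Qed.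

Lemma flux_bd n (h : 'I_3 -> R[i]) (x y : R[i]) g : (forall j, cmod (h j) <= g) ->
  cmod x <= g -> cmod y <= g ->
  cmod (iC R * (\sum_j rC (zr R n j) * h j) - x - y) <= (3 * Num.sqrt (nsq R n) + 2) * g.
Proof.
move=> hh hx hy; apply: le_trans (cmodB _ _) _.
have -> : (3 * Num.sqrt (nsq R n) + 2) * g = 3 * (Num.sqrt (nsq R n) * g) + g + g by ring.
apply: lerD => //; apply: le_trans (cmodB _ _) _; apply: lerD => //.
rewrite cmodM cmod_iC mul1r; apply: le_trans (cmod_sum _ _ _) _.
have -> : 3 * (Num.sqrt (nsq R n) * g) = \sum_(j < 3) (Num.sqrt (nsq R n) * g).
  by rewrite sumr_const card_ord mulr_natl.
apply: ler_sum => j _; rewrite cmodM cmod_rC.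
by apply: ler_pM; rewrite ?cmod_ge0 ?zr_le.
Qed.

(** Convolution with an l^1 family preserves boundedness, so each product is telescoped with the
    difference in the supremum and the other factor in l^1. A cross product gives [8 * M * S];
    inserting this and the l^1 bound [4 * M ^+ 2] of v x B into a second one gives
    [48 * M ^+ 2 * S]. *)
Lemma NL_diff (v B E v' B' E' : field R) M S : fl1 v M -> fl1 B M -> fl1 E M ->
  fl1 v' M -> fl1 B' M -> fl1 E' M -> 
  (forall n k, cmod (v n 0 k - v' n 0 k) <= S) -> (forall n k, cmod (B n 0 k - B' n 0 k) <= S) ->
  (forall n k, cmod (E n 0 k - E' n 0 k) <= S) -> forall n k,
  cmod ((FF v B E n - FF v' B' E' n) 0 k) <= (3 * Num.sqrt (nsq R n) + 2) * ((8 * M + 48 * M ^+ 2) * S) /\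
  cmod ((cross v B n - cross v' B' n) 0 k) <= (8 * M + 48 * M ^+ 2) * S.
Proof.
move=> hv hB hE hv' hB' hE' Sv SB SE n k.
have M0 := fl1_ge0 hv.
have S0 : 0 <= S by apply: le_trans (Sv 0 0); exact: cmod_ge0.
have MS : 0 <= M * S by exact: mulr_ge0.
have MMS : 0 <= M ^+ 2 * S by rewrite mulr_ge0 // sqr_ge0.
have e : (8 * M + 48 * M ^+ 2) * S = 8 * (M * S) + 48 * (M ^+ 2 * S) by ring.
have h1 m j : cmod (cross v B m 0 j - cross v' B' m 0 j) <= 8 * (M * S).
  by apply: le_trans (cross_diff_sup m j hv hv' hB hB' Sv SB) _; lra.
have h2 : cmod (cross E B n 0 k - cross E' B' n 0 k) <= 8 * (M * S).
  by apply: le_trans (cross_diff_sup n k hE hE' hB hB' SE SB) _; lra.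
have h3 : cmod (cross (cross v B) B n 0 k - cross (cross v' B') B' n 0 k) <= 48 * (M ^+ 2 * S).
  apply: le_trans (cross_diff_sup n k (fl1_cross hv hB) (fl1_cross hv' hB') hB hB' h1 SB) _.
  by rewrite le_eqVlt; apply/orP; left; apply/eqP; ring.
have h4 j : cmod (conv (comp v j) (comp v k) n - conv (comp v' j) (comp v' k) n) <= 4 * (M * S).
  apply: le_trans (conv_diff_sup n (hv j) (hv' j) (hv k) (hv' k) (fun m => Sv m j) (fun m => Sv m k)) _; lra.
split; last by rewrite cvecB e; apply: le_trans (h1 n k) _; lra.
rewrite cvecB !FFE.
have -> : forall x1 x2 x3 y1 y2 y3 : R[i], x1 - x2 - x3 - (y1 - y2 - y3) = (x1 - y1) - (x2 - y2) - (x3 - y3) by move=> *; ring.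
rewrite -mulrBr -sumrB; under eq_bigr do rewrite -mulrBr.
by apply: flux_bd => [j||]; rewrite e; [apply: le_trans (h4 j) _|apply: le_trans h2 _|apply: le_trans h3 _]; lra.
Qed.

Lemma NL_weight (w : Z3 -> R) C (v B E : field R) M S : (forall n, 0 <= w n) -> 1 <= C ->
  (forall n m, w n <= C * (w m + w (n - m))) -> fl1 v M -> fl1 B M -> fl1 E M ->
  (forall n k, w n * cmod (v n 0 k) <= S) -> (forall n k, w n * cmod (B n 0 k) <= S) ->
  (forall n k, w n * cmod (E n 0 k) <= S) -> forall n k,
  w n * cmod (FF v B E n 0 k) <= (3 * Num.sqrt (nsq R n) + 2) * ((8 * C * M + 48 * C ^+ 2 * M ^+ 2) * S) /\
  w n * cmod (cross v B n 0 k) <= (8 * C * M + 48 * C ^+ 2 * M ^+ 2) * S.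
Proof.
move=> w0 C1 hw hv hB hE Sv SB SE n k.
have M0 := fl1_ge0 hv.
have S0 : 0 <= S by apply: le_trans (Sv 0 0); rewrite mulr_ge0 ?cmod_ge0.
have C0 : 0 <= C by apply: le_trans C1.
have MS : 0 <= C * M * S by rewrite !mulr_ge0.
have MMS : 0 <= C ^+ 2 * M ^+ 2 * S by rewrite !mulr_ge0 // sqr_ge0.
(* The double cross product yields [32 * C ^+ 2 + 16 * C]; with [C >= 1] this merges into
   [48 * C ^+ 2]. *)
have CC : C * M ^+ 2 * S <= C ^+ 2 * M ^+ 2 * S.
  have c1 : 0 <= C - 1 by rewrite subr_ge0.
  have := mulr_ge0 (mulr_ge0 c1 C0) (mulr_ge0 (sqr_ge0 M) S0).
  have -> : (C - 1) * C * (M ^+ 2 * S) = C ^+ 2 * M ^+ 2 * S - C * M ^+ 2 * S by ring.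
  by rewrite subr_ge0.
have e : (8 * C * M + 48 * C ^+ 2 * M ^+ 2) * S = 8 * (C * M * S) + 48 * (C ^+ 2 * M ^+ 2 * S) by ring.
have wB x y m : w m * cmod (x - y) <= w m * cmod x + w m * cmod y.
  by rewrite -mulrDr ler_wpM2l // cmodB.
have h1 (u u' : field R) m j L S' : fl1 u L -> fl1 u' M -> (forall n k, w n * cmod (u n 0 k) <= S') ->
    (forall n k, w n * cmod (u' n 0 k) <= S) ->
    w m * cmod (cross u u' m 0 j) <= 4 * (C * (S' * M + L * S)).
  move=> hu hu' su su'; rewrite crossE; apply: le_trans (wB _ _ _) _.
  rewrite four_half mulrDl.
  by apply: lerD; apply: (conv_weight (w := w)) => // p; [exact: su|exact: su'|exact: su|exact: su'].
have hvB m j : w m * cmod (cross v B m 0 j) <= 8 * (C * M * S).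
  by apply: le_trans (h1 v B m j _ _ hv hB Sv SB) _; lra.
have hEB : w n * cmod (cross E B n 0 k) <= 8 * (C * M * S).
  by apply: le_trans (h1 E B n k _ _ hE hB SE SB) _; lra.
have hvBB : w n * cmod (cross (cross v B) B n 0 k) <= 48 * (C ^+ 2 * M ^+ 2 * S).
  apply: le_trans (h1 _ B n k _ _ (fl1_cross hv hB) hB hvB SB) _; lra.
have hvv j : w n * cmod (conv (comp v j) (comp v k) n) <= 4 * (C * M * S).
  apply: le_trans (conv_weight n w0 C0 hw (hv j) (hv k) (fun m => Sv m j) (fun m => Sv m k)) _; lra.
split; last by rewrite e; apply: le_trans (hvB n k) _; lra.
have wE x : w n * cmod x = cmod (rC (w n) * x) by rewrite cmodM cmod_rC ger0_norm.
rewrite wE FFE.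
have -> : forall z (x : 'I_3 -> R[i]) (x1 x2 x3 : R[i]), x1 * (iC R * (\sum_j rC (zr R z j) * x j) - x2 - x3) =
    iC R * (\sum_j rC (zr R z j) * (x1 * x j)) - x1 * x2 - x1 * x3.
  move=> z x x1 x2 x3; rewrite !mulrBr mulrCA big_distrr /=; congr (_ * _ - _ - _).
  by apply: eq_bigr => j _; rewrite mulrCA.
by apply: flux_bd => [j||]; rewrite e -wE; [apply: le_trans (hvv j) _|apply: le_trans hEB _|apply: le_trans hvBB _]; lra.
Qed.

(** The first term dominates the quadratic products, the second (v x B) x B. Each 4 is the 2 of
    [csum_bd] times the two convolutions in a component of a cross product. *)
Definition NL_majorant A n : R := 4 * rc A A n + 4 * rc (fun m => 4 * rc A A m) A n.

Section Majorant.
Variables (A : Z3 -> R) (L : R).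
Hypotheses (A0 : forall n, 0 <= A n) (sA : sums A L).
Let L0 : 0 <= L. Proof. exact: sums_ge0 sA. Qed.
Let Q0 n : 0 <= 4 * rc A A n. Proof. by rewrite mulr_ge0 //; apply: rc_ge0 A0 A0 sA sA _. Qed.
Let sQ : sums (fun m => 4 * rc A A m) (4 * (L * L)).
Proof. by apply: sumsZ => //; exact: sums_rc. Qed.
Lemma sums_NL_majorant : sums (NL_majorant A) (4 * L ^+ 2 + 16 * L ^+ 3).
Proof.
have h4 : (0 : R) <= 4 by [].
apply: (sums_le _ _ (sumsD sQ (sumsZ h4 (sums_rc Q0 A0 sQ sA)))) => //.
by rewrite le_eqVlt; apply/orP; left; apply/eqP; ring.
Qed.

Lemma NL_majorant_ge0 n : 0 <= NL_majorant A n.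
Proof. by rewrite addr_ge0 // mulr_ge0 //; exact: (rc_ge0 Q0 A0 sQ sA n). Qed.

Lemma NL_major (v B E : field R) : (forall n k, cmod (v n 0 k) <= A n) -> (forall n k, cmod (B n 0 k) <= A n) ->
  (forall n k, cmod (E n 0 k) <= A n) -> forall n k,
  cmod (FF v B E n 0 k) <= (3 * Num.sqrt (nsq R n) + 2) * NL_majorant A n /\
  cmod (cross v B n 0 k) <= NL_majorant A n.
Proof.
move=> hv hB hE n k.
have q1 := Q0 n; have q2 := rc_ge0 Q0 A0 sQ sA n.
have hc (u w : field R) m j : (forall n k, cmod (u n 0 k) <= A n) -> (forall n k, cmod (w n 0 k) <= A n) ->
  cmod (cross u w m 0 j) <= 4 * rc A A m.
  move=> hu hw; rewrite crossE; apply: le_trans (cmodB _ _) _; rewrite four_half mulrDl.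
  by apply: lerD; apply: (conv_rc A0 A0 sA sA) => p; (exact: hu || exact: hw).
have hd : cmod (cross (cross v B) B n 0 k) <= 4 * rc (fun m => 4 * rc A A m) A n.
  rewrite crossE; apply: le_trans (cmodB _ _) _; rewrite {1}four_half mulrDl.
  by apply: lerD; apply: (conv_rc Q0 A0 sQ sA) => p; (exact: hc || exact: hB).
have hvv j : cmod (conv (comp v j) (comp v k) n) <= 2 * rc A A n.
  by apply: (conv_rc A0 A0 sA sA) => p; exact: hv.
split; last by apply: le_trans (hc v B n k hv hB) _; rewrite lerDl mulr_ge0.
rewrite FFE; apply: flux_bd => [j||]; rewrite /NL_majorant.
- apply: le_trans (hvv j) _; lra.
- apply: le_trans (hc _ _ _ _ hE hB) _; lra.
- apply: le_trans hd _; lra.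
Qed.

End Majorant.

Lemma NL_majorant_mono A A' L n : (forall n, 0 <= A n) -> (forall n, A n <= A' n) -> sums A' L ->
  NL_majorant A n <= NL_majorant A' n.
Proof.
move=> A0 hA sA'; have A'0 m : 0 <= A' m by apply: le_trans (hA m).
have sA : sums A L by apply: sums_le sA'.
have h m : rc A A m <= rc A' A' m by exact: (rc_mono m A0 A0 hA hA sA' sA').
have s4 : sums (fun m => 4 * rc A' A' m) (4 * (L * L)) by apply: sumsZ => //; exact: sums_rc.
have p4 m : 0 <= 4 * rc A A m by rewrite mulr_ge0 //; exact: (rc_ge0 A0 A0 sA sA).
have h' m : 4 * rc A A m <= 4 * rc A' A' m by rewrite ler_wpM2l.
apply: lerD; first exact: h'.
by rewrite ler_wpM2l //; exact: (rc_mono n p4 A0 h' hA s4 sA').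
Qed.

End Nonlinear.

(** * Continuity in time with values in l^1 *)

Section Continuity.
Variable R : realType.
Implicit Types (a b : Z3 -> R[i]) (u w : R -> field R) (T t : R).

Definition cont1 T (a : R -> Z3 -> R[i]) :=
  (forall t, 0 <= t <= T -> exists M, l1 (a t) M) /\
  forall t0, 0 <= t0 <= T -> forall e : R, 0 < e -> exists d : R, 0 < d /\
    forall t, 0 <= t <= T -> `|t - t0| < d -> l1 (fun n => a t n - a t0 n) e.

Lemma cont1_mode T (a : R -> Z3 -> R[i]) n : 0 <= T -> cont1 T a -> ccont T (fun t => a t n).
Proof.
move=> T0 [_ ha].
have key (f : R[i] -> R) : (forall x y, `|f x - f y| <= cmod (x - y)) -> cont_ext T (fun t => f (a t n)).
  move=> hf; apply: cont_extE => // t0 t0T e e0.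
  have e2 : 0 < e / 2 by lra.
  have [d [d0 hd]] := ha _ t0T _ e2; exists d; split => // t tT td.
  apply: le_lt_trans (hf _ _) _; apply: le_lt_trans (l1_sup n (hd t tT td)) _; lra.
by split; apply: key => x y; rewrite -?cReN -?cImN -?cReD -?cImD; [exact: Re_le|exact: Im_le].
Qed.

(** Membership of each [a t] in l^1 gives no uniform bound by itself. The norm [N] is continuous in
    time by the triangle inequality, hence bounded on the compact interval. *)
Lemma cont1_bd T (a : R -> Z3 -> R[i]) : 0 <= T -> cont1 T a ->
  exists M, forall t, 0 <= t <= T -> l1 (a t) M.
Proof.
move=> T0 [h1 h2].
pose N t := fine (\esum_(n in [set: Z3]) (cmod (a t n))%:E).
have hN t : 0 <= t <= T -> l1 (a t) (N t).
  by move=> tT; have [M hM] := h1 t tT; apply: (esum_fine _ hM).1 => n; exact: cmod_ge0.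
have N_le t M : l1 (a t) M -> N t <= M.
  by move=> hM; apply: (esum_fine _ hM).2 => n; exact: cmod_ge0.
have tri t t0 e : 0 <= t0 <= T -> l1 (fun n => a t n - a t0 n) e -> N t <= N t0 + e.
  move=> t0T he; apply: N_le; rewrite addrC.
  by apply: sums_le (lexx _) (l1D he (hN t0 t0T)) => n; rewrite subrK.
have [g cg gN] : cont_ext T N.
  apply: cont_extE => // t0 t0T e e0; have e2 : 0 < e / 2 by lra.
  have [d [d0 hd]] := h2 _ t0T _ e2; exists d; split => // t tT td.
  have h := hd t tT td.
  have p1 := tri _ _ _ t0T h.
  have p2 : N t0 <= N t + e / 2.
    apply: tri => //; apply: sums_le (lexx _) h => n; by rewrite cmodBC.
  rewrite ltr_norml; lra.
have [c _ hc] := @EVT_max R g 0 T T0 (continuous_subspaceT cg).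
exists (g c) => t tT; apply: l1_le (hN t tT); rewrite -gN //.
by apply: hc; rewrite in_itv.
Qed.

Lemma cont1B T (a b : R -> Z3 -> R[i]) : cont1 T a -> cont1 T b -> cont1 T (fun t n => a t n - b t n).
Proof.
move=> [a1 a2] [b1 b2]; split => [t tT|t0 t0T e e0].
  by have [M hM] := a1 t tT; have [M' hM'] := b1 t tT; exists (M + M'); exact: l1B.
have e2 : 0 < e / 2 by lra.
have [d [d0 hd]] := a2 _ t0T _ e2; have [d' [d'0 hd']] := b2 _ t0T _ e2.
exists (Num.min d d'); split; first by rewrite lt_min d0.
move=> t tT; rewrite lt_min => /andP[td td'].
have := l1B (hd t tT td) (hd' t tT td'); apply: sums_le => [n|]; last by lra.
rewrite (_ : _ - _ - _ = a t n - a t0 n - (b t n - b t0 n)) //; ring.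
Qed.

Lemma cont1_conv T (a b : R -> Z3 -> R[i]) : 0 <= T -> cont1 T a -> cont1 T b ->
  cont1 T (fun t => conv (a t) (b t)).
Proof.
move=> T0 ha hb; have [M hM] := cont1_bd T0 ha; have [N hN] := cont1_bd T0 hb.
have T00 : 0 <= (0 : R) <= T by rewrite lexx.
have M0 := l1_ge0 (hM _ T00); have N0 := l1_ge0 (hN _ T00).
split => [t tT|t0 t0T e e0]; first by exists (2 * (M * N)); apply: l1_conv; [exact: hM|exact: hN].
pose e1 := e / (2 * (M + N + 1)).
have MN : 0 < M + N + 1 by lra.
have e10 : 0 < e1 by rewrite divr_gt0 // mulr_gt0.
have [_ a2] := ha; have [_ b2] := hb.
have [d [d0 hd]] := a2 _ t0T _ e10; have [d' [d'0 hd']] := b2 _ t0T _ e10.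
exists (Num.min d d'); split; first by rewrite lt_min d0.
move=> t tT; rewrite lt_min => /andP[td td'].
have := l1D (l1_conv (hd t tT td) (hN t tT)) (l1_conv (hM t0 t0T) (hd' t tT td')).
apply: sums_le => [n|]; first by rewrite (convB n (hM t tT) (hM t0 t0T) (hN t tT) (hN t0 t0T)).
have -> : 2 * (e1 * N) + 2 * (M * e1) = 2 * e1 * (M + N) by ring.
have -> : e = 2 * e1 * (M + N + 1) by rewrite /e1; field; lra.
by apply: ler_wpM2l; [rewrite mulr_ge0 // ltW|lra].
Qed.

(** If no finite set came within [e] of the total, the total minus [e] would again bound all partial
    sums. *)
Lemma sums_tail (A : Z3 -> R) D (e : R) : (forall n, 0 <= A n) -> sums A D -> 0 < e ->
  exists s : seq Z3, uniq s /\ forall r : seq Z3, uniq r -> (forall n, n \in r -> n \notin s) ->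
    \sum_(n <- r) A n <= e.
Proof.
move=> A0 hA e0.
have [s [us hs]] : exists s, uniq s /\ fine (\esum_(n in [set: Z3]) (A n)%:E) - e < \sum_(n <- s) A n.
  apply: contrapT => H.
  have : sums A (fine (\esum_(n in [set: Z3]) (A n)%:E) - e).
    by move=> s us; rewrite leNgt; apply/negP => h; apply: H; exists s.
  by move=> /(esum_fine A0) [_]; lra.
exists s; split => // r ur hr.
have : \sum_(n <- r ++ s) A n <= fine (\esum_(n in [set: Z3]) (A n)%:E).
  apply: (esum_fine A0 hA).1; rewrite cat_uniq ur us andbT /=.
  by apply/hasPn => n ns; apply/negP => nr; move: (hr n nr); rewrite ns.
rewrite big_cat /=; lra.
Qed.

(** Dominated convergence: outside a finite set [s] the majorant has mass at most [e / 4] and a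
    difference of two values is at most [2 * A n]; on [s] the finitely many coordinates are
    continuous. This is the only way in which l^1 continuity of iterates and limits is obtained. *)
Lemma cont1_maj T (a : R -> Z3 -> R[i]) A D : 0 <= T -> (forall n, 0 <= A n) -> sums A D ->
  (forall t n, 0 <= t <= T -> cmod (a t n) <= A n) -> (forall n, ccont T (fun t => a t n)) ->
  cont1 T a.
Proof.
move=> T0 A0 hA hd hc; split => [t tT|t0 t0T e e0].
  by exists D; apply: sums_le (lexx _) hA => n; exact: hd.
have e4 : 0 < e / 4 by lra.
have [s [us hs]] := sums_tail A0 hA e4.
have mode n (e1 : R) : 0 < e1 -> exists d : R, 0 < d /\ forall t, 0 <= t <= T -> `|t - t0| < d -> cmod (a t n - a t0 n) < e1.
  move=> e10; have [[g1 c1 h1] [g2 c2 h2]] := hc n.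
  have e12 : 0 < e1 / 2 by lra.
  have /(@cvgrPdist_lt R R^o) /(_ _ e12) /nbhs_ballP[d1 /= d10 hd1] := c1 t0.
  have /(@cvgrPdist_lt R R^o) /(_ _ e12) /nbhs_ballP[d2 /= d20 hd2] := c2 t0.
  exists (Num.min d1 d2); split; first by rewrite lt_min d10.
  move=> t tT; rewrite lt_min => /andP[td1 td2].
  have := hd1 t; rewrite /ball /= distrC => /(_ td1); rewrite h1 // h1 // => q1.
  have := hd2 t; rewrite /ball /= distrC => /(_ td2); rewrite h2 // h2 // => q2.
  apply: le_lt_trans (cmod_le _) _; rewrite cReD cImD cReN cImN distrC [X in _ + X < _]distrC.
  lra.
have [d [d0 hd']] : exists d : R, 0 < d /\ forall t, 0 <= t <= T -> `|t - t0| < d ->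
    \sum_(n <- s) cmod (a t n - a t0 n) <= e / 2.
  have : forall e1 : R, 0 < e1 -> exists d : R, 0 < d /\ forall t, 0 <= t <= T -> `|t - t0| < d ->
      forall n, n \in s -> cmod (a t n - a t0 n) <= e1.
    move=> e1 e10; elim: (s) => [|n r [d [d0 IH]]]; first by exists 1.
    have [d' [d'0 h']] := mode n e1 e10.
    exists (Num.min d d'); split; first by rewrite lt_min d0.
    move=> t tT; rewrite lt_min => /andP[td td'] m; rewrite inE => /orP[/eqP->|mr].
      by apply: ltW; exact: h'.
    exact: IH.
  move=> /(_ (e / (2 * ((size s)%:R + 1)))) [|d [d0 h]].
    by rewrite divr_gt0 // mulr_gt0 // ltr_wpDl.
  exists d; split => // t tT td.
  apply: (@le_trans _ _ (\sum_(n <- s) (e / (2 * ((size s)%:R + 1))))).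
    rewrite big_seq [leRHS]big_seq; apply: ler_sum => n ns; exact: h.
  rewrite big_const_seq count_predT iter_addr addr0 -[X in X <= _]mulr_natr mulrAC.
  rewrite ler_pdivrMr; last by rewrite mulr_gt0 // ltr_wpDl.
  have p : 0 <= (size s)%:R :> R by [].
  have := mulr_ge0 p (ltW e0); lra.
exists d; split => // t tT td r ur.
rewrite (bigID (mem s)) /= (_ : e = e / 2 + e / 2); last by lra.
apply: lerD.
  apply: le_trans (hd' t tT td).
  rewrite [leRHS](bigID (mem r)) /= -[leLHS]addr0; apply: lerD.
    rewrite -big_filter -[leRHS]big_filter (perm_big [seq n <- s | n \in r]) //.
    by apply: uniq_perm; rewrite ?filter_uniq // => n; rewrite !mem_filter andbC.
  by apply: sumr_ge0 => n _; exact: cmod_ge0.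
rewrite -big_filter.
apply: (@le_trans _ _ (\sum_(n <- [seq n <- r | n \notin s]) (2 * A n))).
  apply: ler_sum => n _; apply: le_trans (cmodB _ _) _.
  by rewrite mulr2n mulrDl mul1r lerD // hd.
rewrite -big_distrr /=.
have H : \sum_(n <- [seq n <- r | n \notin s]) A n <= e / 4.
  by apply: hs; [rewrite filter_uniq|move=> n; rewrite mem_filter => /andP[]].
lra.
Qed.

Lemma contX0_cont1 T u : contX0 T u <-> forall k, cont1 T (fun t => comp (u t) k).
Proof.
split => [[h1 h2] k|h].
  have sub (v : field R) D : (X0norm v <= D%:E)%E -> l1 (comp v k) D.
    move=> hv; have : sums (fun n => vnorm (v n)) D by apply/esum_sums => // n; exact: vnorm_ge0.
    by apply: sums_le => // n; exact: cmod_vnorm.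
  split => [t tT|t0 t0T e e0].
    have := h1 t tT; rewrite /inX0 => /(esum_fin (fun n => vnorm_ge0 _)) [D hD].
    by exists D; apply: sums_le (lexx _) hD => n; exact: cmod_vnorm.
  have [d [d0 hd]] := h2 t0 t0T e e0; exists d; split => // t tT td.
  have := sub _ _ (ltW (hd t tT td)); apply: sums_le => // n; by rewrite /comp /fsub cvecB.
have sub (v : field R) D : (forall k, l1 (comp v k) D) -> sums (fun n => vnorm (v n)) (D + D + D).
  move=> hv; apply: sums_le (lexx _) (sumsD (sumsD (hv 0) (hv 1)) (hv 2)) => n.
  by apply: le_trans (vnorm_le _) _; rewrite I3_sum.
split => [t tT|t0 t0T e e0].
  have [M0 H0] := (h 0).1 t tT; have [M1 H1] := (h 1).1 t tT; have [M2 H2] := (h 2).1 t tT.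
  apply/(esum_fin (fun n => vnorm_ge0 _)); exists (M0 + M1 + M2).
  apply: sums_le (lexx _) (sumsD (sumsD H0 H1) H2) => n.
  by apply: le_trans (vnorm_le _) _; rewrite I3_sum.
(* Three components at [e / 6] leave the total at [e / 2], so the required inequality is strict. *)
have e6 : 0 < e / 6 by lra.
have [d0 [d00 H0]] := (h 0).2 t0 t0T _ e6; have [d1 [d10 H1]] := (h 1).2 t0 t0T _ e6.
have [d2 [d20 H2]] := (h 2).2 t0 t0T _ e6.
exists (Num.min d0 (Num.min d1 d2)); split; first by rewrite !lt_min d00 d10.
move=> t tT; rewrite !lt_min => /and3P[td0 td1 td2].
have hD : sums (fun n => vnorm (fsub (u t) (u t0) n)) (e / 6 + e / 6 + e / 6).
  apply: sub; apply: I3_ind; rewrite /comp /fsub; under [X in l1 X]funext do rewrite cvecB.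
  - exact: H0. - exact: H1. - exact: H2.
have /(esum_sums _ (fun n => vnorm_ge0 _)) := hD.
by move=> /le_lt_trans; apply; rewrite lte_fin; lra.
Qed.

End Continuity.

(** * Uniqueness *)

Section Steps.
Variable R : realType.
Implicit Types (T t lam nu : R).

Lemma contX0_fl1 T (v : R -> field R) : 0 <= T -> contX0 T v -> exists M, forall t, 0 <= t <= T -> fl1 (v t) M.
Proof.
move=> T0 /contX0_cont1 h.
have [M0 H0] := cont1_bd T0 (h 0); have [M1 H1] := cont1_bd T0 (h 1); have [M2 H2] := cont1_bd T0 (h 2).
exists (Num.max M0 (Num.max M1 M2)) => t tT; apply: I3_ind.
- by apply: l1_le (H0 t tT); rewrite !le_max lexx.
- by apply: l1_le (H1 t tT); rewrite !le_max lexx orbT.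
- by apply: l1_le (H2 t tT); rewrite !le_max lexx !orbT.
Qed.

Lemma contX0_cross T (v B : R -> field R) : 0 <= T -> contX0 T v -> contX0 T B -> contX0 T (fun t => cross (v t) (B t)).
Proof.
move=> T0 /contX0_cont1 hv /contX0_cont1 hB; apply/contX0_cont1 => k.
rewrite /comp; under [X in cont1 _ X]funext do under eq_fun do rewrite crossE.
exact: (cont1B (cont1_conv T0 (hv (k + 1)) (hB (k + 2))) (cont1_conv T0 (hv (k + 2)) (hB (k + 1)))).
Qed.

Lemma contX0_vcont T (v : R -> field R) n : 0 <= T -> contX0 T v -> vcont T (fun t => v t n).
Proof. by move=> T0 /contX0_cont1 hv k; exact: cont1_mode T0 (hv k). Qed.
Lemma contX0_FF T (v B E : R -> field R) n : 0 <= T -> contX0 T v -> contX0 T B -> contX0 T E ->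
  vcont T (fun t => FF (v t) (B t) (E t) n).
Proof.
move=> T0 hv hB hE k; under [X in ccont _ X]funext do rewrite FFE.
have hEB := contX0_vcont n T0 (contX0_cross T0 hE hB) k.
have hvBB := contX0_vcont n T0 (contX0_cross T0 (contX0_cross T0 hv hB) hB) k.
move/contX0_cont1 in hv.
apply: (ccontB (ccontB _ hEB) hvBB); apply: ccontZ.
under [X in ccont _ X]funext do rewrite I3_sum.
have hj j : ccont T (fun t => conv (comp (v t) j) (comp (v t) k) n).
  exact: (@cont1_mode R T (fun t => conv (comp (v t) j) (comp (v t) k)) n T0 (cont1_conv T0 (hv j) (hv k))).
by apply: ccontD; [apply: ccontD|]; apply: ccontZ.
Qed.

(* (v', B', E') is the image of (v, B, E) under the Duhamel map, in differential form *)
Definition img nu T (v0 B0 E0 : field R) (v B E v' B' E' : R -> field R) := forall n, exists V Bm Em : R -> cvec R,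
  [/\ mode_sol nu n T V Bm Em (fun t => FF (v t) (B t) (E t) n) (fun t => cross (v t) (B t) n),
    V 0 = v0 n, Bm 0 = B0 n, Em 0 = E0 n &
    forall t, 0 <= t <= T -> [/\ v' t n = V t, B' t n = Bm t & E' t n = Em t]].

Lemma mild_img nu T v0 B0 E0 v B E : 0 <= T -> divfree B0 -> contX0 T v -> contX0 T B -> contX0 T E ->
  v 0 = v0 -> B 0 = B0 ->
  img nu T v0 B0 E0 v B E (mildV nu v0 (fun s => FF (v s) (B s) (E s)))
    (mildB B0 E0 (fun s => cross (v s) (B s))) (mildE B0 E0 (cross v0 B0) (fun s => cross (v s) (B s))).
Proof.
move=> T0 dB hv hB hE v00 B00 n.
have hf : vcont T (fun t => cross (v t) (B t) n).
  by have := contX0_vcont n T0 (contX0_cross T0 hv hB).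
have hf0 : (fun t => cross (v t) (B t)) 0 n = cross v0 B0 n by rewrite v00 B00.
have [V [Bm [Em [h1 h2 h3 h4 h5]]]] := @mild_mode R nu n T v0 B0 E0 (cross v0 B0) (fun s => FF (v s) (B s) (E s)) (fun s => cross (v s) (B s)) T0 (contX0_FF n T0 hv hB hE) hf dB hf0.
by exists V, Bm, Em.
Qed.

Lemma mild_solution_img nu T v0 B0 E0 v B E : 0 <= T -> divfree B0 ->
  mild_solution nu v0 B0 E0 T v B E -> img nu T v0 B0 E0 v B E v B E.
Proof.
move=> T0 dB [hv hB hE _ hm].
have T00 : 0 <= (0 : R) <= T by rewrite lexx.
have mV t : 0 <= t <= T -> v t = mildV nu v0 (fun s => FF (v s) (B s) (E s)) t.
  by move=> tT; have [-> _ _] := hm t tT.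
have mB t : 0 <= t <= T -> B t = mildB B0 E0 (fun s => cross (v s) (B s)) t.
  by move=> tT; have [_ -> _] := hm t tT.
have mE t : 0 <= t <= T -> E t = mildE B0 E0 (cross v0 B0) (fun s => cross (v s) (B s)) t.
  by move=> tT; have [_ _ ->] := hm t tT.
(* The formulas for v and B do not contain [f0]. Applying [mild_mode] with [f0] set to the actual
   value at time 0 therefore reads off [v 0] and [B 0], after which the prescribed v0 x B0 can be
   used. *)
have [v00 B00] : v 0 = v0 /\ B 0 = B0.
  have hf n : vcont T (fun t => cross (v t) (B t) n).
    by have := contX0_vcont n T0 (contX0_cross T0 hv hB).
  have H n : v 0 n = v0 n /\ B 0 n = B0 n.
    have [V [Bm [Em [_ h2 h3 _ h5]]]] := @mild_mode R nu n T v0 B0 E0 (cross (v 0) (B 0)) (fun s => FF (v s) (B s) (E s)) (fun s => cross (v s) (B s)) T0 (contX0_FF n T0 hv hB hE) (hf n) dB erefl.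
    have [a1 a2 _] := h5 0 T00.
    by rewrite mV // mB // a1 a2.
  by split; apply/funext => n; have [] := H n.
move=> n; have [V [Bm [Em [h1 h2 h3 h4 h5]]]] := mild_img nu E0 T0 dB hv hB hE v00 B00 n.
exists V, Bm, Em; split => // t tT; have [a1 a2 a3] := h5 t tT.
by rewrite mV // mB // mE.
Qed.

Definition Lip (M : R) := 8 * M + 48 * M ^+ 2.

(** Both images start from the same data, so their difference solves the linear system with zero
    initial value and only the gain survives. *)
Lemma diff_step nu lam T v0 B0 E0 v B E v1 B1 E1 v' B' E' v1' B1' E1' M S : 0 < nu -> 1 <= lam ->
  img nu T v0 B0 E0 v B E v1 B1 E1 -> img nu T v0 B0 E0 v' B' E' v1' B1' E1' ->
  (forall t, 0 <= t <= T -> [/\ fl1 (v t) M, fl1 (B t) M & fl1 (E t) M]) ->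
  (forall t, 0 <= t <= T -> [/\ fl1 (v' t) M, fl1 (B' t) M & fl1 (E' t) M]) ->
  (forall t n k, 0 <= t <= T -> [/\ cmod (v t n 0 k - v' t n 0 k) <= expR (lam * t) * S,
     cmod (B t n 0 k - B' t n 0 k) <= expR (lam * t) * S &
     cmod (E t n 0 k - E' t n 0 k) <= expR (lam * t) * S]) ->
  forall t n k, 0 <= t <= T -> 
    [/\ cmod (v1 t n 0 k - v1' t n 0 k) <= expR (lam * t) * (energy_gain nu lam * (Lip M * S)),
     cmod (B1 t n 0 k - B1' t n 0 k) <= expR (lam * t) * (energy_gain nu lam * (Lip M * S)) &
     cmod (E1 t n 0 k - E1' t n 0 k) <= expR (lam * t) * (energy_gain nu lam * (Lip M * S))].
Proof.
move=> nu0 lam1 i1 i2 hM hM' hS t n k tT.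
have [V [Bm [Em [h1 h2 h3 h4 h5]]]] := i1 n.
have [V' [Bm' [Em' [h1' h2' h3' h4' h5']]]] := i2 n.
have [a1 a2 a3] := h5 t tT; have [b1 b2 b3] := h5' t tT.
rewrite a1 a2 a3 b1 b2 b3 -!cvecB.
have NL s j (sT : 0 <= s <= T) : _ :=
  let: And3 x1 x2 x3 := hM s sT in let: And3 y1 y2 y3 := hM' s sT in
  @NL_diff R (v s) (B s) (E s) (v' s) (B' s) (E' s) M (expR (lam * s) * S) x1 x2 x3 y1 y2 y3
   (fun n k => let: And3 z _ _ := hS s n k sT in z) (fun n k => let: And3 _ z _ := hS s n k sT in z)
   (fun n k => let: And3 _ _ z := hS s n k sT in z) n j.
have e s : Lip M * (expR (lam * s) * S) = Lip M * S * expR (lam * s) by ring.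
have := mode_est nu0 lam1 (mode_solB h1 h1') (g := Lip M * S) (x0 := 0).
rewrite mulr0 add0r; apply => //.
- by move=> s j sT; have [h _] := NL s j sT; rewrite -e.
- by move=> s j sT; have [_ h] := NL s j sT; rewrite -e.
- by move=> j; rewrite h2 h2' h3 h3' h4 h4' !subrr !cvecE cmod0.
Qed.

(** At a fixed frequency the weight is a constant: dividing every bound by [w n] reduces the claim
    to [mode_est]. *)
Lemma weight_step nu lam T v0 B0 E0 v B E v1 B1 E1 M S D C (w : Z3 -> R) : 0 < nu -> 1 <= lam ->
  (forall n, 0 < w n) -> 1 <= C -> (forall n m, w n <= C * (w m + w (n - m))) ->
  img nu T v0 B0 E0 v B E v1 B1 E1 ->
  (forall t, 0 <= t <= T -> [/\ fl1 (v t) M, fl1 (B t) M & fl1 (E t) M]) ->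
  (forall n k, [/\ w n * cmod (v0 n 0 k) <= D, w n * cmod (B0 n 0 k) <= D & w n * cmod (E0 n 0 k) <= D]) ->
  (forall t n k, 0 <= t <= T -> [/\ w n * cmod (v t n 0 k) <= expR (lam * t) * S,
     w n * cmod (B t n 0 k) <= expR (lam * t) * S & w n * cmod (E t n 0 k) <= expR (lam * t) * S]) ->
  forall t n k, 0 <= t <= T -> 
    [/\ w n * cmod (v1 t n 0 k) <= expR (lam * t) * (3 * D + energy_gain nu lam * ((8 * C * M + 48 * C ^+ 2 * M ^+ 2) * S)),
     w n * cmod (B1 t n 0 k) <= expR (lam * t) * (3 * D + energy_gain nu lam * ((8 * C * M + 48 * C ^+ 2 * M ^+ 2) * S)) &
     w n * cmod (E1 t n 0 k) <= expR (lam * t) * (3 * D + energy_gain nu lam * ((8 * C * M + 48 * C ^+ 2 * M ^+ 2) * S))].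
Proof.
move=> nu0 lam1 w0 C1 hw i1 hM hD hS t n k tT.
have [V [Bm [Em [h1 h2 h3 h4 h5]]]] := i1 n.
have [a1 a2 a3] := h5 t tT; rewrite a1 a2 a3.
set L := 8 * C * M + _.
have NL s j (sT : 0 <= s <= T) : _ :=
  let: And3 x1 x2 x3 := hM s sT in
  @NL_weight R w C (v s) (B s) (E s) M (expR (lam * s) * S) (fun n => ltW (w0 n)) C1 hw x1 x2 x3
   (fun n k => let: And3 z _ _ := hS s n k sT in z) (fun n k => let: And3 _ z _ := hS s n k sT in z)
   (fun n k => let: And3 _ _ z := hS s n k sT in z) n j.
have d x y : (w n * x <= y) = (x <= y / w n) by rewrite ler_pdivlMr // mulrC.
have e : expR (lam * t) * (3 * D + energy_gain nu lam * (L * S)) / w n =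
  expR (lam * t) * (3 * (D / w n) + energy_gain nu lam * (L * S / w n)) by field; rewrite gt_eqF.
rewrite !d e; apply: (mode_est nu0 lam1 h1) => //.
- move=> s j sT; have [h _] := NL s j sT; move: h; rewrite d -/L => /le_trans; apply.
  by rewrite le_eqVlt; apply/orP; left; apply/eqP; ring.
- move=> s j sT; have [_ h] := NL s j sT; move: h; rewrite d -/L => /le_trans; apply.
  by rewrite le_eqVlt; apply/orP; left; apply/eqP; ring.
- by move=> j; rewrite h2 h3 h4 -!d.
Qed.

(** A time-independent majorant also bounds the forcing in the exponential form of [mode_est], since
    [expR (lam * s) >= 1]. The price is the factor [expR (lam * t)] in front of the new majorant,
    which makes existence local. *)
Lemma major_step nu lam T v0 B0 E0 v B E v1 B1 E1 (A x0 : Z3 -> R) L : 0 < nu -> 1 <= lam ->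
  (forall n, 0 <= A n) -> sums A L ->
  img nu T v0 B0 E0 v B E v1 B1 E1 ->
  (forall n k, [/\ cmod (v0 n 0 k) <= x0 n, cmod (B0 n 0 k) <= x0 n & cmod (E0 n 0 k) <= x0 n]) ->
  (forall t n k, 0 <= t <= T -> [/\ cmod (v t n 0 k) <= A n,
     cmod (B t n 0 k) <= A n & cmod (E t n 0 k) <= A n]) ->
  forall t n k, 0 <= t <= T -> 
    [/\ cmod (v1 t n 0 k) <= expR (lam * t) * (3 * x0 n + energy_gain nu lam * NL_majorant A n),
     cmod (B1 t n 0 k) <= expR (lam * t) * (3 * x0 n + energy_gain nu lam * NL_majorant A n) &
     cmod (E1 t n 0 k) <= expR (lam * t) * (3 * x0 n + energy_gain nu lam * NL_majorant A n)].
Proof.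
move=> nu0 lam1 A0 sA i1 hD hS t n k tT.
have [V [Bm [Em [h1 h2 h3 h4 h5]]]] := i1 n.
have [a1 a2 a3] := h5 t tT; rewrite a1 a2 a3.
have NL s j (sT : 0 <= s <= T) : _ :=
  @NL_major R A L A0 sA (v s) (B s) (E s)
   (fun n k => let: And3 z _ _ := hS s n k sT in z) (fun n k => let: And3 _ z _ := hS s n k sT in z)
   (fun n k => let: And3 _ _ z := hS s n k sT in z) n j.
have g0 := NL_majorant_ge0 A0 sA n.
have E1' s : 0 <= s <= T -> NL_majorant A n <= NL_majorant A n * expR (lam * s).
  move=> /andP[s0 _]; rewrite ler_peMr // -expR0 ler_expR mulr_ge0 //.
  by apply: le_trans lam1.
apply: (mode_est nu0 lam1 h1) => //.
- move=> s j sT; have [h _] := NL s j sT; apply: le_trans h _; apply: ler_wpM2l (E1' s sT).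
  by rewrite addr_ge0 // mulr_ge0 // sqrtr_ge0.
- move=> s j sT; have [_ h] := NL s j sT; exact: le_trans (E1' s sT).
- by move=> j; rewrite h2 h3 h4.
Qed.

Lemma energy_gain_small nu (d : R) : 0 < nu -> 0 < d -> exists lam : R, 1 <= lam /\ energy_gain nu lam <= d.
Proof.
move=> nu0 d0; have K0 := energy_cst_ge0 nu0.
have d20 : 0 < d ^+ 2 by rewrite exprn_gt0.
have l1 : 1 <= 1 + energy_cst nu / d ^+ 2 by rewrite lerDl divr_ge0 // ltW.
exists (1 + energy_cst nu / d ^+ 2); split => //.
have l0 : 0 < 1 + energy_cst nu / d ^+ 2 by apply: lt_le_trans l1.
rewrite -[leRHS]ger0_norm ?(ltW d0) // -sqrtr_sqr ler_wsqrtr //.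
by rewrite ler_pdivrMr // mulrDr mulr1 mulrCA mulfV ?gt_eqF // mulr1 lerDr ltW.
Qed.

Lemma halving (x D c : R) : 0 <= c -> (forall j : nat, x <= D + c / 2 ^+ j) -> x <= D.
Proof.
move=> c0 h; rewrite leNgt; apply/negP => Dx.
have d0 : 0 < x - D by rewrite subr_gt0.
have q0 : 0 <= c / (x - D) by rewrite divr_ge0 // ltW.
set j := Num.bound (c / (x - D)).
have := h j; have := archi_boundP q0; rewrite -/j => h1.
have h2 : c / (x - D) < 2 ^+ j.
  apply: lt_trans h1 _; rewrite -natrX ltr_nat; exact: ltn_expl.
have p : 0 < 2 ^+ j :> R by rewrite exprn_gt0.
move: h2; rewrite ltr_pdivrMr // mulrC -ltr_pdivrMr //; lra.
Qed.

Lemma uniqueness nu T v0 B0 E0 v B E v' B' E' : 0 < nu -> 0 <= T ->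
  contX0 T v -> contX0 T B -> contX0 T E -> contX0 T v' -> contX0 T B' -> contX0 T E' ->
  img nu T v0 B0 E0 v B E v B E -> img nu T v0 B0 E0 v' B' E' v' B' E' ->
  forall t, 0 <= t <= T -> [/\ v t = v' t, B t = B' t & E t = E' t].
Proof.
move=> nu0 T0 cv cB cE cv' cB' cE' i1 i2.
have T00 : 0 <= (0 : R) <= T by rewrite lexx.
have [M1 H1] := contX0_fl1 T0 cv; have [M2 H2] := contX0_fl1 T0 cB; have [M3 H3] := contX0_fl1 T0 cE.
have [M4 H4] := contX0_fl1 T0 cv'; have [M5 H5] := contX0_fl1 T0 cB'; have [M6 H6] := contX0_fl1 T0 cE'.
have p1 := fl1_ge0 (H1 0 T00); have p2 := fl1_ge0 (H2 0 T00); have p3 := fl1_ge0 (H3 0 T00).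
have p4 := fl1_ge0 (H4 0 T00); have p5 := fl1_ge0 (H5 0 T00); have p6 := fl1_ge0 (H6 0 T00).
set M := M1 + M2 + M3 + M4 + M5 + M6.
have M0 : 0 <= M by rewrite /M; lra.
have hM t : 0 <= t <= T -> [/\ fl1 (v t) M, fl1 (B t) M & fl1 (E t) M].
  by move=> tT; split; [apply: fl1_le (H1 t tT)|apply: fl1_le (H2 t tT)|apply: fl1_le (H3 t tT)]; rewrite /M; lra.
have hM' t : 0 <= t <= T -> [/\ fl1 (v' t) M, fl1 (B' t) M & fl1 (E' t) M].
  by move=> tT; split; [apply: fl1_le (H4 t tT)|apply: fl1_le (H5 t tT)|apply: fl1_le (H6 t tT)]; rewrite /M; lra.
have L0 : 0 <= Lip M by rewrite addr_ge0 ?mulr_ge0 ?sqr_ge0.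
(* The gain times the Lipschitz constant is brought below 1/2, whatever the length of the
   interval. *)
have d0 : 0 < (2 * (Lip M + 1))^-1 by rewrite invr_gt0; lra.
have [lam [lam1 hk]] := energy_gain_small nu0 d0.
have kL : energy_gain nu lam * Lip M <= 2^-1.
  apply: le_trans (ler_wpM2r L0 hk) _; rewrite mulrC ler_pdivrMr; lra.
have key (j : nat) : forall t n k, 0 <= t <= T -> [/\ cmod (v t n 0 k - v' t n 0 k) <= expR (lam * t) * (2 * M / 2 ^+ j),
     cmod (B t n 0 k - B' t n 0 k) <= expR (lam * t) * (2 * M / 2 ^+ j) &
     cmod (E t n 0 k - E' t n 0 k) <= expR (lam * t) * (2 * M / 2 ^+ j)].
  elim: j => [|j IH] t n k tT.
    have e1 : 2 * M <= expR (lam * t) * (2 * M / 2 ^+ 0).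
      rewrite expr0 divr1 ler_peMl ?mulr_ge0 // -expR0 ler_expR mulr_ge0 //; last by case/andP: tT.
      exact: le_trans lam1.
    have [a1 a2 a3] := hM t tT; have [b1 b2 b3] := hM' t tT.
    have tri x y : cmod x <= M -> cmod y <= M -> cmod (x - y) <= expR (lam * t) * (2 * M / 2 ^+ 0) :> R.
      by move=> hx hy; apply: le_trans e1; apply: le_trans (cmodB _ _) _; lra.
    split; apply: tri; [exact: l1_sup (a1 k)|exact: l1_sup (b1 k)|exact: l1_sup (a2 k)|exact: l1_sup (b2 k)
      |exact: l1_sup (a3 k)|exact: l1_sup (b3 k)].
  have [a1 a2 a3] := diff_step nu0 lam1 i1 i2 hM hM' IH n k tT.
  have h : expR (lam * t) * (energy_gain nu lam * (Lip M * (2 * M / 2 ^+ j))) <= expR (lam * t) * (2 * M / 2 ^+ j.+1).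
    rewrite ler_wpM2l ?expR_ge0 // mulrA.
    have p : 0 <= 2 * M / 2 ^+ j by rewrite divr_ge0 ?mulr_ge0 ?exprn_ge0.
    apply: le_trans (ler_wpM2r p kL) _.
    by rewrite exprS invfM mulrCA.
  by split; [apply: le_trans a1 h|apply: le_trans a2 h|apply: le_trans a3 h].
move=> t tT.
have zero z : (forall j : nat, cmod z <= expR (lam * t) * (2 * M / 2 ^+ j)) -> z = 0 :> R[i].
  move=> h; apply: cmod_eq0; apply: le_anti; rewrite cmod_ge0 andbT.
  apply: (@halving _ _ (expR (lam * t) * (2 * M))) => [|j]; first by rewrite !mulr_ge0 ?expR_ge0.
  by rewrite add0r -mulrA.
by split; apply/funext => n; apply: cvec_eq => k; apply/eqP; rewrite -subr_eq0; apply/eqP;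
   apply: zero => j; have [] := key j t n k tT.
Qed.

End Steps.

(** * Existence *)

Section Reality.
Variable R : realType.
Implicit Types (u w : field R) (n : Z3).

(** Integrability is not assumed: positive and negative parts are exchanged, and [fine] sends the
    infinite cases to 0 on both sides. Conjugation symmetry thus passes through [tint] for arbitrary
    integrands. *)
Lemma RintegralN (f : R -> R) (D : set R) :
  \int[lebesgue_measure]_(x in D) (- f x) = - \int[lebesgue_measure]_(x in D) f x.
Proof.
rewrite /Rintegral integralE [in RHS]integralE.
have -> : (fun x => (- f x)%:E)^\+%E = (fun x => (f x)%:E)^\-%E.
  by rewrite -funeposN.
have -> : (fun x => (- f x)%:E)^\-%E = (fun x => (f x)%:E)^\+%E.
  by rewrite -funenegN; congr (_^\-%E); apply/funext => x /=; rewrite EFinN.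
have := @integral_ge0 _ _ R lebesgue_measure D (fun x => (f x)%:E)^\+%E (fun x _ => funepos_ge0 _ x).
have := @integral_ge0 _ _ R lebesgue_measure D (fun x => (f x)%:E)^\-%E (fun x _ => funeneg_ge0 _ x).
case: (integral _ _ _) => [x||]; case: (integral _ _ _) => [y||] //= _ _; rewrite ?oppr0 //.
by rewrite opprB.
Qed.

Lemma zrN n k : zr R (- n) k = - zr R n k.
Proof. by rewrite /zr mxE mulrNz. Qed.
Lemma nsqN n : nsq R (- n) = nsq R n.
Proof. by apply: eq_bigr => k _; rewrite zrN sqrrN. Qed.

Lemma rf_tint t (G : R -> field R) : (forall s, 0 <= s <= t -> real_field (G s)) -> real_field (tint t G).
Proof.
move=> h n k; rewrite !mxE; apply: complex_eq => /=.
  apply: eq_Rintegral => s; rewrite inE /= in_itv /= => hs; rewrite (h s hs).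
  by case: (G s n 0 k).
rewrite -RintegralN; apply: eq_Rintegral => s; rewrite inE /= in_itv /= => hs; rewrite (h s hs).
by case: (G s n 0 k).
Qed.

Lemma rf_mult (m : Z3 -> R) u : (forall n, m (- n) = m n) -> real_field u -> real_field (mult m u).
Proof. by move=> hm hu n k; rewrite /mult !cvecE hm hu conjcM conj_rC. Qed.
Lemma rf_fadd u w : real_field u -> real_field w -> real_field (fadd u w).
Proof. by move=> hu hw n k; rewrite /fadd !cvecE hu hw conjcD. Qed.
Lemma rf_fsub u w : real_field u -> real_field w -> real_field (fsub u w).
Proof. by move=> hu hw n k; rewrite /fsub !cvecB hu hw conjcB. Qed.
Lemma rf_fscale c u : conjc c = c -> real_field u -> real_field (fscale c u).
Proof. by move=> hc hu n k; rewrite /fscale !cvecE hu conjcM hc. Qed.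
Lemma conjc_iC : conjc (iC R) = - iC R.
Proof. by rewrite /iC /=; apply: complex_eq => /=; rewrite ?oppr0. Qed.
Lemma rf_curl u : real_field u -> real_field (curl u).
Proof.
move=> hu n k; rewrite (_ : curl u (- n) = curln (- n) (u (- n))) // (_ : curl u n = curln n (u n)) //.
rewrite !curlnE !zrN !hu conjcM conjcB !conjcM !conj_rC conjc_iC !rCN; ring.
Qed.

Lemma rf_gradpart u : real_field u -> real_field (gradpart u).
Proof.
move=> hu n k; rewrite (_ : gradpart u (- n) = gradn (- n) (u (- n))) // (_ : gradpart u n = gradn n (u n)) //.
rewrite !gradnE !ndotE !zrN nsqN !hu !conjcM !conjcD !conjcM !conj_rC !rCN; ring.
Qed.

Lemma rf_leray u : real_field u -> real_field (leray u).
Proof. by move=> hu; apply: rf_fsub => //; exact: rf_gradpart. Qed.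
Lemma rf_conv u w j k n : real_field u -> real_field w ->
  conv (comp u j) (comp w k) (- n) = conjc (conv (comp u j) (comp w k) n).
Proof. by move=> hu hw; apply: conv_conj => m; [exact: hu|exact: hw]. Qed.
Lemma rf_cross u w : real_field u -> real_field w -> real_field (cross u w).
Proof. by move=> hu hw n k; rewrite !crossE !rf_conv // conjcB. Qed.
Lemma rf_divtens u w : real_field u -> real_field w -> real_field (divtens u w).
Proof.
move=> hu hw n k; rewrite !mxE !I3_sum !rf_conv // !zrN conjcM !conjcD !conjcM !conj_rC conjc_iC !rCN; ring.
Qed.

Lemma rf_FF u w z : real_field u -> real_field w -> real_field z -> real_field (FF u w z).
Proof.
move=> hu hw hz; apply: rf_fsub; [apply: rf_fsub|]; [exact: rf_divtens|exact: rf_cross|].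
by apply: rf_cross => //; exact: rf_cross.
Qed.

Lemma Phi1N t n : Phi1 t (- n) = Phi1 t n :> R. Proof. by rewrite /Phi1 nsqN. Qed.
Lemma Phi2N t n : Phi2 t (- n) = Phi2 t n :> R. Proof. by rewrite /Phi2 nsqN. Qed.
Lemma dPhi2N t n : dPhi2 t (- n) = dPhi2 t n :> R.
Proof.
rewrite /dPhi2; have -> // : (fun s : R => Phi2 s (- n)) = (fun s => Phi2 s n).
by apply/funext => s; exact: Phi2N.
Qed.

Lemma rf_mildV nu v0 (F : R -> field R) t : real_field v0 ->
  (forall s, 0 <= s <= t -> real_field (F s)) -> real_field (mildV nu v0 F t).
Proof.
move=> hv hF; apply: rf_fsub; first by apply: rf_mult => // n; rewrite /heatk nsqN.
apply: rf_tint => s hs; apply: rf_mult => [n|]; first by rewrite /heatk nsqN.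
by apply: rf_leray; exact: hF.
Qed.

Lemma rf_mildB B0 E0 (f : R -> field R) t : real_field B0 -> real_field E0 ->
  (forall s, 0 <= s <= t -> real_field (f s)) -> real_field (mildB B0 E0 f t).
Proof.
move=> hB hE hf; apply: rf_fadd.
  apply: rf_fadd; first by apply: rf_mult => // n; exact: Phi1N.
  apply: rf_mult => [n|]; first exact: Phi2N.
  apply: rf_fadd; first by apply: rf_fscale => //; exact: conj_rC.
  apply: rf_fscale; last exact: rf_curl.
  by rewrite -rC1 -rCN conj_rC.
apply: rf_tint => s hs; apply: rf_mult => [n|]; first exact: Phi2N.
by apply: rf_curl; exact: hf.
Qed.

Lemma rf_mildE B0 E0 f0 (f : R -> field R) t : 0 <= t -> real_field B0 -> real_field E0 -> real_field f0 ->
  (forall s, 0 <= s <= t -> real_field (f s)) -> real_field (mildE B0 E0 f0 f t).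
Proof.
move=> t0 hB hE hf0 hf; apply: rf_fadd; apply: rf_fsub.
- apply: rf_fadd; [apply: rf_fadd|].
  + by apply: rf_mult => [n|]; [exact: Phi1N|exact: rf_leray].
  + apply: rf_mult => [n|]; first exact: Phi2N.
    apply: rf_fadd; first by apply: rf_fscale; [exact: conj_rC|exact: rf_leray].
    by apply: rf_leray; apply: rf_fsub => //; apply: rf_fsub => //; exact: rf_curl.
  + apply: rf_mult => [n|]; [exact: Phi2N|apply: rf_leray; apply: hf].
    by rewrite lexx.
- apply: rf_tint => s hs; apply: rf_mult => [n|]; first exact: dPhi2N.
  by apply: rf_leray; exact: hf.
- by apply: rf_mult => //; exact: rf_gradpart.
- by apply: rf_tint => s hs; apply: rf_mult => //; apply: rf_gradpart; exact: hf.
Qed.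

End Reality.

(** * Continuity of images and geometric limits *)

Section Existence.
Variable R : realType.
Implicit Types (T t lam nu : R).

Lemma cont_ext_eq T (f g : R -> R) : (forall t, 0 <= t <= T -> f t = g t) -> cont_ext T f -> cont_ext T g.
Proof. by move=> fg [h ch hf]; exists h => // t tT; rewrite hf // fg. Qed.
Lemma cont_ext_dist T (f : R -> R) t0 e : cont_ext T f -> 0 <= t0 <= T -> 0 < e ->
  exists d : R, 0 < d /\ forall t, 0 <= t <= T -> `|t - t0| < d -> `|f t - f t0| < e.
Proof.
move=> [g cg gf] t0T e0.
have /(@cvgrPdist_lt R R^o) /(_ _ e0) /nbhs_ballP[d /= d0 hd] := cg t0.
exists d; split => // t tT td; rewrite -!gf // distrC.
by apply: hd; rewrite /ball /= distrC.
Qed.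

Lemma der_cont_ext T (f : R -> R) (l : R -> R) : 0 <= T ->
  (forall t, 0 <= t <= T -> der f t (l t)) -> cont_ext T f.
Proof.
move=> T0 h; apply: cont_extE => // t0 t0T e e0.
have /(@cvgrPdist_lt R R^o) /(_ _ e0) /nbhs_ballP[d /= d0 hd] := der_cont (h _ t0T).
exists d; split => // t tT td; rewrite distrC.
by apply: hd; rewrite /ball /= distrC.
Qed.

Lemma vder_vcont T (V W u : R -> cvec R) : 0 <= T -> (forall t, 0 <= t <= T -> vder V t (W t)) ->
  (forall t, 0 <= t <= T -> u t = V t) -> vcont T u.
Proof.
move=> T0 h huV k; split.
  apply: (@cont_ext_eq _ (fun t => complex.Re (V t 0 k))) => [t tT|]; first by rewrite huV.
  by apply: (der_cont_ext (l := fun t => complex.Re (W t 0 k)) T0) => t /h /(_ k) [].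
apply: (@cont_ext_eq _ (fun t => complex.Im (V t 0 k))) => [t tT|]; first by rewrite huV.
by apply: (der_cont_ext (l := fun t => complex.Im (W t 0 k)) T0) => t /h /(_ k) [].
Qed.

Lemma contX0_maj T (u : R -> field R) A D : 0 <= T -> (forall n, 0 <= A n) -> sums A D ->
  (forall t n k, 0 <= t <= T -> cmod (u t n 0 k) <= A n) -> (forall n, vcont T (fun t => u t n)) ->
  contX0 T u.
Proof.
move=> T0 A0 hA hu hc; apply/contX0_cont1 => k; apply: (cont1_maj T0 A0 hA) => [t n tT|n].
  exact: hu.
exact: hc.
Qed.

Lemma img_contX0 nu T (v0 B0 E0 : field R) (v B E v' B' E' : R -> field R) A D : 0 <= T ->
  img nu T v0 B0 E0 v B E v' B' E' -> (forall n, 0 <= A n) -> sums A D ->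
  (forall t n k, 0 <= t <= T -> [/\ cmod (v' t n 0 k) <= A n, cmod (B' t n 0 k) <= A n & cmod (E' t n 0 k) <= A n]) ->
  [/\ contX0 T v', contX0 T B', contX0 T E', v' 0 = v0 & B' 0 = B0].
Proof.
move=> T0 i1 A0 hA hb; have T00 : 0 <= (0 : R) <= T by rewrite lexx.
split.
- apply: (contX0_maj T0 A0 hA) => [t n k tT|n]; first by have [] := hb t n k tT.
  have [V [Bm [Em [h1 _ _ _ h5]]]] := i1 n.
  by apply: (vder_vcont T0 (V := V)) => t tT; [have [h _ _] := h1 t tT; exact: h|have [] := h5 t tT].
- apply: (contX0_maj T0 A0 hA) => [t n k tT|n]; first by have [] := hb t n k tT.
  have [V [Bm [Em [h1 _ _ _ h5]]]] := i1 n.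
  by apply: (vder_vcont T0 (V := Bm)) => t tT; [have [_ h _] := h1 t tT; exact: h|have [] := h5 t tT].
- apply: (contX0_maj T0 A0 hA) => [t n k tT|n]; first by have [] := hb t n k tT.
  have [V [Bm [Em [h1 _ _ _ h5]]]] := i1 n.
  by apply: (vder_vcont T0 (V := Em)) => t tT; [have [_ _ h] := h1 t tT; exact: h|have [] := h5 t tT].
- apply/funext => n; have [V [Bm [Em [_ <- _ _ h5]]]] := i1 n; by have [] := h5 0 T00.
- apply/funext => n; have [V [Bm [Em [_ _ <- _ h5]]]] := i1 n; by have [] := h5 0 T00.
Qed.

(** The intervals of radius [2 * c / 2 ^+ k] around [x k] are nested; the limit is the supremum of
    their left ends and lies in all of them, which is the rate. *)
Lemma geometric_limit (x : nat -> R) c : 0 <= c -> (forall k, `|x k.+1 - x k| <= c / 2 ^+ k) ->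
  exists l, forall k, `|x k - l| <= 2 * c / 2 ^+ k.
Proof.
move=> c0 h.
pose y k := x k + 2 * c / 2 ^+ k; pose z k := x k - 2 * c / 2 ^+ k.
have half k : 2 * c / 2 ^+ k.+1 = c / 2 ^+ k by rewrite exprS invfM; field; rewrite expf_neq0.
have half2 k : 2 * c / 2 ^+ k = c / 2 ^+ k + c / 2 ^+ k by field; rewrite expf_neq0.
have yS k : y k.+1 <= y k.
  by rewrite /y half half2; have := h k; rewrite ler_norml; lra.
have zS k : z k <= z k.+1.
  by rewrite /z half half2; have := h k; rewrite ler_norml; lra.
have yD j k : (j <= k)%N -> y k <= y j.
  by move=> /subnK <-; elim: (k - j)%N => // m IH; apply: le_trans (yS _) _.
have zI j k : (j <= k)%N -> z j <= z k.
  by move=> /subnK <-; elim: (k - j)%N => // m IH; apply: le_trans (zS _).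
have p k : 0 <= 2 * c / 2 ^+ k by rewrite divr_ge0 ?mulr_ge0 ?exprn_ge0.
have zy j k : z j <= y k.
  apply: le_trans (zI _ _ (leq_maxl j k)) _; apply: le_trans (yD _ _ (leq_maxr j k)).
  by rewrite /z /y; have := p (maxn j k); lra.
exists (sup (range z)) => k; rewrite ler_norml.
have h1 : z k <= sup (range z).
  by apply: ub_le_sup; [exists (y 0%N) => _ [j _ <-]|exists k].
have h2 : sup (range z) <= y k.
  by apply: ge_sup; [exists (z 0%N), 0%N|move=> _ [j _ <-]].
by move: h1 h2; rewrite /z /y; lra.
Qed.

End Existence.

(** * Picard iteration *)

Section Picard.
Variable R : realType.
Implicit Types (T t lam nu : R).

Lemma pow2_small (c e : R) : 0 <= c -> 0 < e -> exists k : nat, c / 2 ^+ k < e.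
Proof.
move=> c0 e0; apply: contrapT => H.
have : e <= 0; last lra.
by apply: (halving c0) => j; rewrite add0r leNgt; apply/negP => h; apply: H; exists j.
Qed.

(** Monotone convergence on finite sets: by monotonicity, finitely many suprema are approached
    simultaneously at one index [k], where the bound [D] is available. *)
Lemma sup_majorant (A : nat -> Z3 -> R) D : (forall k n, A k n <= A k.+1 n) -> (forall k, sums (A k) D) ->
  exists A', (forall k n, A k n <= A' n) /\ sums A' D.
Proof.
move=> hm hA.
have mono j k n : (j <= k)%N -> A j n <= A k n.
  by move=> /subnK <-; elim: (k - j)%N => // m IH; apply: le_trans (hm _ _).
have hs n : has_sup (range (A ^~ n)).
  by split; [exists (A 0%N n), 0%N|exists D => _ [k _ <-]; exact: sums_term (hA k)].
pose A' n := sup (range (A ^~ n)).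
have le k n : A k n <= A' n by apply: ub_le_sup; [exact: (hs n).2|exists k].
exists A'; split => // s us.
have key e : 0 < e -> exists k, \sum_(n <- s) A' n <= \sum_(n <- s) A k n + e.
  elim: (s) e => [|n r IH] e e0; first by exists 0%N; rewrite !big_nil add0r ltW.
  have e2 : 0 < e / 2 by lra.
  have [k hk] := IH _ e2.
  have [_ [j _ <-] hj] := sup_adherent e2 (hs n).
  exists (maxn j k); rewrite !big_cons.
  have h1 := mono _ _ n (leq_maxl j k).
  have h2 : \sum_(m <- r) A k m <= \sum_(m <- r) A (maxn j k) m.
    by apply: ler_sum => m _; apply: mono; exact: leq_maxr.
  rewrite -/(A' n) in hj; lra.
apply/ler_addgt0Pr => e e0; have [k hk] := key e e0.
by apply: le_trans hk _; rewrite lerD2r; exact: hA.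
Qed.

Section Limit.
Variables (T lam S : R) (W : nat -> R -> field R).
Hypotheses (T0 : 0 <= T) (lam0 : 0 <= lam) (S0 : 0 <= S).
Hypothesis hW : forall k t n i, 0 <= t <= T ->
  cmod (W k.+1 t n 0 i - W k t n 0 i) <= expR (lam * t) * (S / 2 ^+ k).

(** The 4 is the 2 of [geometric_limit] times 2 for real and imaginary parts. Outside [0,T] the
    limit is set to 0. *)
Lemma seq_limit : exists w : R -> field R, forall t n i k, 0 <= t <= T ->
  cmod (W k t n 0 i - w t n 0 i) <= expR (lam * t) * (4 * S / 2 ^+ k).
Proof.
have : forall p : R * Z3 * 'I_3, exists l : R[i], 0 <= p.1.1 <= T ->
  forall k, cmod (W k p.1.1 p.1.2 0 p.2 - l) <= expR (lam * p.1.1) * (4 * S / 2 ^+ k).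
  move=> [[t n] i] /=; case: (boolP (0 <= t <= T)) => tT; last by exists 0.
  have c0 : 0 <= expR (lam * t) * S by rewrite mulr_ge0 ?expR_ge0.
  have hR k : `|complex.Re (W k.+1 t n 0 i) - complex.Re (W k t n 0 i)| <= expR (lam * t) * S / 2 ^+ k.
    rewrite -cReN -cReD; apply: le_trans (Re_le _) _; rewrite -mulrA; exact: hW.
  have hI k : `|complex.Im (W k.+1 t n 0 i) - complex.Im (W k t n 0 i)| <= expR (lam * t) * S / 2 ^+ k.
    rewrite -cImN -cImD; apply: le_trans (Im_le _) _; rewrite -mulrA; exact: hW.
  have [a ha] := geometric_limit c0 hR; have [b hb] := geometric_limit c0 hI.
  exists (Complex a b) => _ k; apply: le_trans (cmod_le _) _.
  rewrite cReD cImD cReN cImN /=; have := ha k; have := hb k => p q.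
  have -> : expR (lam * t) * (4 * S / 2 ^+ k) = 2 * (expR (lam * t) * S) / 2 ^+ k + 2 * (expR (lam * t) * S) / 2 ^+ k.
    by field; rewrite expf_neq0.
  exact: lerD.
move=> /choice [l hl]; exists (fun t n => \row_i l (t, n, i)) => t n i k tT.
by rewrite mxE; exact: (hl (t, n, i)).
Qed.

Variable w : R -> field R.
Hypothesis hw : forall t n i k, 0 <= t <= T ->
  cmod (W k t n 0 i - w t n 0 i) <= expR (lam * t) * (4 * S / 2 ^+ k).
Let c0 t : 0 <= expR (lam * t) * (4 * S).
Proof. by rewrite mulr_ge0 ?expR_ge0 // mulr_ge0. Qed.

Lemma limit_bd A : (forall k t n i, 0 <= t <= T -> cmod (W k t n 0 i) <= A n) ->
  forall t n i, 0 <= t <= T -> cmod (w t n 0 i) <= A n.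
Proof.
move=> hA t n i tT; apply: (halving (c0 t)) => k.
have -> : w t n 0 i = W k t n 0 i - (W k t n 0 i - w t n 0 i) by ring.
by apply: le_trans (cmodB _ _) _; apply: lerD; [exact: hA|rewrite -mulrA; exact: hw].
Qed.

Lemma limit_eq t n i z : 0 <= t <= T -> (forall k, W k t n 0 i = z) -> w t n 0 i = z.
Proof.
move=> tT hz; apply/eqP; rewrite eq_sym -subr_eq0; apply/eqP/cmod_eq0/le_anti; rewrite cmod_ge0 andbT.
by apply: (halving (c0 t)) => k; rewrite add0r -mulrA -{1}(hz k); exact: hw.
Qed.

Lemma limit_real : (forall k t, 0 <= t <= T -> real_field (W k t)) ->
  forall t, 0 <= t <= T -> real_field (w t).
Proof.
move=> hr t tT n i; apply/eqP; rewrite -subr_eq0; apply/eqP/cmod_eq0/le_anti; rewrite cmod_ge0 andbT.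
have cc : 0 <= 2 * (expR (lam * t) * (4 * S)) by rewrite mulr_ge0.
apply: (halving cc) => k; rewrite add0r.
have -> : w t (- n) 0 i - conjc (w t n 0 i) = conjc (W k t n 0 i - w t n 0 i) - (W k t (- n) 0 i - w t (- n) 0 i).
  by rewrite conjcB (hr k t tT); ring.
apply: le_trans (cmodB _ _) _; rewrite cmod_conj.
have := hw n i k tT; have := hw (- n) i k tT; rewrite -!mulrA; lra.
Qed.

(** On [0,T] the weight is at most its value at [T], so the convergence at a fixed frequency is
    uniform in time. *)
Lemma limit_vcont n : (forall k, vcont T (fun t => W k t n)) -> vcont T (fun t => w t n).
Proof.
move=> hc i.
have key (f : R[i] -> R) : (forall x y, `|f x - f y| <= cmod (x - y)) ->
    (forall k, cont_ext T (fun t => f (W k t n 0 i))) -> cont_ext T (fun t => f (w t n 0 i)).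
  move=> hf hk; apply: cont_extE => // t0 t0T e e0.
  have e3 : 0 < e / 3 by lra.
  have [k hkk] := pow2_small (c0 T) e3.
  have near t : 0 <= t <= T -> `|f (W k t n 0 i) - f (w t n 0 i)| < e / 3.
    move=> tT; apply: le_lt_trans (hf _ _) _; apply: le_lt_trans (hw n i k tT) _.
    apply: le_lt_trans hkk; rewrite -[leRHS]mulrA ler_wpM2r ?divr_ge0 ?mulr_ge0 ?exprn_ge0 //.
    by rewrite ler_expR ler_wpM2l //; case/andP: tT.
  have [d [d0 hd]] := cont_ext_dist (hk k) t0T e3.
  exists d; split => // t tT td.
  have := hd t tT td; have := near t tT; have := near t0 t0T; rewrite !ltr_norml; lra.
split; apply: key.
- by move=> x y; rewrite -cReN -cReD; exact: Re_le.
- by move=> k; have [] := hc k i.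
- by move=> x y; rewrite -cImN -cImD; exact: Im_le.
- by move=> k; have [] := hc k i.
Qed.

End Limit.

Lemma existence nu (v0 B0 E0 : field R) : 0 < nu -> inX0 v0 -> inX0 B0 -> inX0 E0 ->
  real_field v0 -> real_field B0 -> real_field E0 -> divfree B0 ->
  exists T, 0 < T /\ exists v B E, mild_solution nu v0 B0 E0 T v B E.
Proof.
move=> nu0 /(esum_fin (fun n => vnorm_ge0 _)) [X1 hX1] /(esum_fin (fun n => vnorm_ge0 _)) [X2 hX2].
move=> /(esum_fin (fun n => vnorm_ge0 _)) [X3 hX3] rv rB rE dB.
pose x0 n := vnorm (v0 n) + vnorm (B0 n) + vnorm (E0 n).
set X := X1 + X2 + X3; have sX : sums x0 X by exact: sumsD (sumsD hX1 hX2) hX3.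
have X0 : 0 <= X := sums_ge0 sX.
have x00 n : 0 <= x0 n by rewrite /x0; have := vnorm_ge0 (v0 n); have := vnorm_ge0 (B0 n); have := vnorm_ge0 (E0 n); lra.
have hx0 n k : [/\ cmod (v0 n 0 k) <= x0 n, cmod (B0 n 0 k) <= x0 n & cmod (E0 n 0 k) <= x0 n].
  rewrite /x0; have := vnorm_ge0 (v0 n); have := vnorm_ge0 (B0 n); have := vnorm_ge0 (E0 n).
  have := cmod_vnorm (v0 n) k; have := cmod_vnorm (B0 n) k; have := cmod_vnorm (E0 n) k.
  by move=> ? ? ? ? ? ?; split; lra.
(* [M] is to bound the l^1 norms of all majorants: a step turns [M] into
   [2 * (3 * X + energy_gain nu lam * G)], and the part with [G] is kept below 1. *)
set M := 6 * X + 1; have M0 : 0 <= M by rewrite /M; lra.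
set G := 4 * M ^+ 2 + 16 * M ^+ 3.
have G0 : 0 <= G by rewrite addr_ge0 // mulr_ge0 ?exprn_ge0.
have L0 : 0 <= Lip M by rewrite addr_ge0 ?mulr_ge0 ?sqr_ge0.
(* [Q] combines two smallness conditions on the gain: [kG] keeps the majorants bounded by [M], [kL]
   makes the differences contract by 1/2. *)
set Q := 2 * G + 2 * Lip M + 1.
have Q0 : 0 < Q by rewrite /Q; lra.
have Qi : 0 < Q^-1 by rewrite invr_gt0.
have [lam [lam1 hk]] := energy_gain_small nu0 Qi.
have lam0 : 0 < lam by apply: lt_le_trans lam1.
have k0 := energy_gain_ge0 nu lam.
have kQ : energy_gain nu lam * Q <= 1.
  by apply: le_trans (ler_wpM2r (ltW Q0) hk) _; rewrite mulVf // gt_eqF.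
have kG : 2 * (energy_gain nu lam * G) <= 1.
  have := mulr_ge0 k0 L0; have := mulr_ge0 k0 G0; move: kQ; rewrite /Q; lra.
have kL : energy_gain nu lam * Lip M <= 2^-1.
  have := mulr_ge0 k0 L0; have := mulr_ge0 k0 G0; move: kQ; rewrite /Q; lra.
(* For this time the weight [expR (lam * t)] stays between 1 and 2; the upper value is the leading
   factor 2 in the recursion for [A]. *)
set T := ln 2 / lam.
have ln2 : 0 < ln 2 :> R by rewrite ln_gt0 // ltr1n.
have T0 : 0 < T by rewrite divr_gt0.
have T0' := ltW T0.
have T00 : 0 <= (0 : R) <= T by rewrite lexx.
have e2 t : 0 <= t <= T -> expR (lam * t) <= 2.
  move=> /andP[_ tT]; rewrite -[leRHS]lnK ?posrE // ler_expR mulrC -ler_pdivlMr //.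
have e1 t : 0 <= t <= T -> 1 <= expR (lam * t).
  by move=> /andP[t0 _]; rewrite -expR0 ler_expR mulr_ge0 // ltW.
pose nxt (u : (R -> field R) * (R -> field R) * (R -> field R)) :=
  (mildV nu v0 (fun s => FF (u.1.1 s) (u.1.2 s) (u.2 s)),
   mildB B0 E0 (fun s => cross (u.1.1 s) (u.1.2 s)),
   mildE B0 E0 (cross v0 B0) (fun s => cross (u.1.1 s) (u.1.2 s))).
pose U k := iter k nxt (fun=> v0, fun=> B0, fun=> E0).
pose A k := iter k (fun A n => 2 * (3 * x0 n + energy_gain nu lam * NL_majorant A n)) (fun n => 6 * x0 n).
have A0 k n : 0 <= A k n /\ sums (A k) M.
  elim: k n => [|k IH] n /=.
    split; first by rewrite mulr_ge0.
    have h6 : (0 : R) <= 6 by [].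
    by apply: (sums_le _ _ (sumsZ h6 sX)) => //; rewrite /M; lra.
  have Ak m : 0 <= A k m by have [] := IH m.
  have sAk : sums (A k) M by have [] := IH 0.
  split.
    by rewrite mulr_ge0 // addr_ge0 ?mulr_ge0 //; exact: NL_majorant_ge0 Ak sAk n.
  have h2 : (0 : R) <= 2 by []; have h3 : (0 : R) <= 3 by [].
  apply: (sums_le _ _ (sumsZ h2 (sumsD (sumsZ h3 sX) (sumsZ k0 (sums_NL_majorant Ak sAk))))) => //.
  by rewrite -/G /M; lra.
have A0' k n : 0 <= A k n by have [] := A0 k n.
have sA k : sums (A k) M by have [] := A0 k 0.
have Am k n : A k n <= A k.+1 n.
  elim: k n => [|k IH] n.
    rewrite /=; have := mulr_ge0 k0 (NL_majorant_ge0 (A0' 0%N) (sA 0%N) n); rewrite /=; lra.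
  rewrite [A k.+1 n]/= [A k.+2 n]/=.
  have := NL_majorant_mono n (A0' k) IH (sA k.+1) => h.
  by rewrite ler_wpM2l // lerD2l ler_wpM2l.
(* [Ai] dominates all iterates at once and still sums to [M]. The convergence below holds only in
   the supremum over frequencies; this majorant brings the limit back into X^0. *)
have [Ai [hAi sAi]] := sup_majorant Am sA.
have Ai0 n : 0 <= Ai n by apply: le_trans (hAi 0%N n).
pose bd (u : (R -> field R) * (R -> field R) * (R -> field R)) (a : Z3 -> R) := forall t n k, 0 <= t <= T ->
  [/\ cmod (u.1.1 t n 0 k) <= a n, cmod (u.1.2 t n 0 k) <= a n & cmod (u.2 t n 0 k) <= a n].
pose good (u : (R -> field R) * (R -> field R) * (R -> field R)) :=
  [/\ contX0 T u.1.1, contX0 T u.1.2, contX0 T u.2, u.1.1 0 = v0 & u.1.2 0 = B0].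
have good_img u : good u -> img nu T v0 B0 E0 u.1.1 u.1.2 u.2 (nxt u).1.1 (nxt u).1.2 (nxt u).2.
  by move=> [g1 g2 g3 g4 g5]; exact: mild_img.
have inv k : good (U k) /\ bd (U k) (A k).
  elim: k => [|k [gk bk]].
    have b0 : bd (U 0%N) (A 0%N).
      move=> t n k tT; have [h1 h2 h3] := hx0 n k; rewrite /=.
      have h6 : x0 n <= 6 * x0 n by have := x00 n; lra.
      by split; [apply: le_trans h1 h6|apply: le_trans h2 h6|apply: le_trans h3 h6].
    split => //.
    have cc (c : field R) n : vcont T (fun=> c n).
      by move=> i; split; apply: (der_cont_ext (l := fun=> 0)) => // t _; exact: der_cst.
    split => //; apply: (contX0_maj T0' (A0' 0%N) (sA 0%N)) => [t n i tT|n]; try exact: cc.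
    - by have [] := b0 t n i tT. - by have [] := b0 t n i tT. - by have [] := b0 t n i tT.
  have ik := good_img _ gk.
  have bS : bd (U k.+1) (A k.+1).
    move=> t n i tT.
    have [h1 h2 h3] := major_step nu0 lam1 (A0' k) (sA k) ik hx0 bk n i tT.
    have p : expR (lam * t) * (3 * x0 n + energy_gain nu lam * NL_majorant (A k) n) <= A k.+1 n.
      rewrite /= ler_wpM2r ?e2 // addr_ge0 ?mulr_ge0 //; exact: NL_majorant_ge0 (A0' k) (sA k) n.
    by split; [apply: le_trans h1 p|apply: le_trans h2 p|apply: le_trans h3 p].
  by split; [exact: (img_contX0 T0' ik (A0' k.+1) (sA k.+1) bS)|exact: bS].
have bdi k : bd (U k) Ai.
  move=> t n i tT; have [_ b] := inv k; have [h1 h2 h3] := b t n i tT.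
  by split; [apply: le_trans h1 (hAi k n)|apply: le_trans h2 (hAi k n)|apply: le_trans h3 (hAi k n)].
have bfl u a : (forall n, 0 <= a n) -> sums a M -> bd u a -> forall t, 0 <= t <= T -> [/\ fl1 (u.1.1 t) M, fl1 (u.1.2 t) M & fl1 (u.2 t) M].
  move=> a0 sa b t tT; split => i; apply: sums_le (lexx _) sa => n; by have [] := b t n i tT.
have hfl k := bfl (U k) Ai Ai0 sAi (bdi k).
have diff k t n i : 0 <= t <= T ->
   [/\ cmod ((U k.+1).1.1 t n 0 i - (U k).1.1 t n 0 i) <= expR (lam * t) * (2 * M / 2 ^+ k),
    cmod ((U k.+1).1.2 t n 0 i - (U k).1.2 t n 0 i) <= expR (lam * t) * (2 * M / 2 ^+ k) &
    cmod ((U k.+1).2 t n 0 i - (U k).2 t n 0 i) <= expR (lam * t) * (2 * M / 2 ^+ k)].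
  elim: k t n i => [|k IH] t n i tT.
    have [a1 a2 a3] := hfl 1%N t tT; have [b1 b2 b3] := hfl 0%N t tT.
    have tri x y : cmod x <= M -> cmod y <= M -> cmod (x - y) <= expR (lam * t) * (2 * M / 2 ^+ 0) :> R.
      move=> hx hy; apply: (@le_trans _ _ (2 * M)); first by apply: le_trans (cmodB _ _) _; lra.
      by rewrite expr0 divr1 ler_peMl ?mulr_ge0 // e1.
    split; apply: tri; [exact: l1_sup (a1 i)|exact: l1_sup (b1 i)|exact: l1_sup (a2 i)|exact: l1_sup (b2 i)
      |exact: l1_sup (a3 i)|exact: l1_sup (b3 i)].
  have [a1 a2 a3] := diff_step nu0 lam1 (good_img _ (inv k.+1).1) (good_img _ (inv k).1) (hfl k.+1) (hfl k) IH n i tT.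
  have h : expR (lam * t) * (energy_gain nu lam * (Lip M * (2 * M / 2 ^+ k))) <= expR (lam * t) * (2 * M / 2 ^+ k.+1).
    rewrite ler_wpM2l ?expR_ge0 // mulrA.
    have p : 0 <= 2 * M / 2 ^+ k by rewrite divr_ge0 ?mulr_ge0 ?exprn_ge0.
    apply: le_trans (ler_wpM2r p kL) _.
    by rewrite exprS invfM mulrCA.
  by split; [apply: le_trans a1 h|apply: le_trans a2 h|apply: le_trans a3 h].
have M2 : 0 <= 2 * M by rewrite mulr_ge0.
have d1 k t n i (tT : 0 <= t <= T) := let: And3 h _ _ := diff k t n i tT in h.
have d2 k t n i (tT : 0 <= t <= T) := let: And3 _ h _ := diff k t n i tT in h.
have d3 k t n i (tT : 0 <= t <= T) := let: And3 _ _ h := diff k t n i tT in h.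
have [v hv] := seq_limit M2 d1; have [B hB] := seq_limit M2 d2; have [E hE] := seq_limit M2 d3.
have b1 k t n i (tT : 0 <= t <= T) := let: And3 h _ _ := bdi k t n i tT in h.
have b2 k t n i (tT : 0 <= t <= T) := let: And3 _ h _ := bdi k t n i tT in h.
have b3 k t n i (tT : 0 <= t <= T) := let: And3 _ _ h := bdi k t n i tT in h.
have bu : bd (v, B, E) Ai.
  move=> t n i tT; split => /=; [exact: (limit_bd M2 hv b1)|exact: (limit_bd M2 hB b2)|exact: (limit_bd M2 hE b3)].
have cU k n : [/\ vcont T (fun t => (U k).1.1 t n), vcont T (fun t => (U k).1.2 t n) & vcont T (fun t => (U k).2 t n)].
  have [[g1 g2 g3 _ _] _] := inv k.
  by split; [exact: contX0_vcont g1|exact: contX0_vcont g2|exact: contX0_vcont g3].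
have gu : good (v, B, E).
  split => /=.
  - apply: (contX0_maj T0' Ai0 sAi) => [t n i tT|n]; first by have [] := bu t n i tT.
    by apply: (limit_vcont T0' (ltW lam0) M2 hv) => k; have [] := cU k n.
  - apply: (contX0_maj T0' Ai0 sAi) => [t n i tT|n]; first by have [] := bu t n i tT.
    by apply: (limit_vcont T0' (ltW lam0) M2 hB) => k; have [] := cU k n.
  - apply: (contX0_maj T0' Ai0 sAi) => [t n i tT|n]; first by have [] := bu t n i tT.
    by apply: (limit_vcont T0' (ltW lam0) M2 hE) => k; have [] := cU k n.
  - apply/funext => n; apply: cvec_eq => i; apply: (limit_eq M2 hv T00) => k.
    by have [[_ _ _ -> _] _] := inv k.
  - apply/funext => n; apply: cvec_eq => i; apply: (limit_eq M2 hB T00) => k.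
    by have [[_ _ _ _ ->] _] := inv k.
(* The iterate of index k+1 is close to the limit and, by [diff_step] applied to the iterate of
   index k and the limit, to the image of the limit; hence the two agree. *)
have fix_ t n i : 0 <= t <= T -> [/\ v t n 0 i = (nxt (v, B, E)).1.1 t n 0 i,
   B t n 0 i = (nxt (v, B, E)).1.2 t n 0 i & E t n 0 i = (nxt (v, B, E)).2 t n 0 i].
  move=> tT.
  have st k := diff_step nu0 lam1 (good_img _ (inv k).1) (good_img _ gu) (hfl k) (bfl (v, B, E) Ai Ai0 sAi bu)
     (fun t n i tT => And3 (hv t n i k tT) (hB t n i k tT) (hE t n i k tT)) n i tT.
  have cc : 0 <= expR (lam * t) * (4 * (2 * M)) * 2 by rewrite !mulr_ge0 ?expR_ge0.
  have p k : 0 <= expR (lam * t) * (4 * (2 * M) / 2 ^+ k) by rewrite mulr_ge0 ?expR_ge0 // divr_ge0 ?mulr_ge0 ?exprn_ge0.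
  have fin (x y : R[i]) (z : nat -> R[i]) : (forall k, cmod (z k - x) <= expR (lam * t) * (4 * (2 * M) / 2 ^+ k)) ->
     (forall k, cmod (z k.+1 - y) <= expR (lam * t) * (energy_gain nu lam * (Lip M * (4 * (2 * M) / 2 ^+ k)))) -> x = y.
    move=> hx hy; apply/eqP; rewrite -subr_eq0; apply/eqP/cmod_eq0/le_anti; rewrite cmod_ge0 andbT.
    apply: (halving cc) => k; rewrite add0r.
    have -> : x - y = (z k.+1 - y) - (z k.+1 - x) by ring.
    apply: le_trans (cmodB _ _) _.
    have q1 : expR (lam * t) * (energy_gain nu lam * (Lip M * (4 * (2 * M) / 2 ^+ k))) <= expR (lam * t) * (4 * (2 * M) / 2 ^+ k).
      have := p k; set q := 4 * (2 * M) / 2 ^+ k => q0.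
      have -> : expR (lam * t) * (energy_gain nu lam * (Lip M * q)) = energy_gain nu lam * Lip M * (expR (lam * t) * q) by ring.
      by apply: le_trans (ler_wpM2r q0 kL) _; move: q0; set r := _ * q; lra.
    have q2 : expR (lam * t) * (4 * (2 * M) / 2 ^+ k.+1) <= expR (lam * t) * (4 * (2 * M) / 2 ^+ k).
      rewrite ler_wpM2l ?expR_ge0 // ler_wpM2l ?mulr_ge0 // lef_pV2 ?posrE ?exprn_gt0 //.
      by rewrite exprS ler_peMl ?exprn_ge0 // ler1n.
    have -> : expR (lam * t) * (4 * (2 * M)) * 2 / 2 ^+ k = expR (lam * t) * (4 * (2 * M) / 2 ^+ k) + expR (lam * t) * (4 * (2 * M) / 2 ^+ k).
      by field; rewrite expf_neq0.
    apply: lerD; [apply: le_trans (hy k) q1|apply: le_trans (hx k.+1) q2].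
  split.
  - apply: (fin _ _ (fun k => (U k).1.1 t n 0 i)) => k; first exact: hv.
    by have [] := st k.
  - apply: (fin _ _ (fun k => (U k).1.2 t n 0 i)) => k; first exact: hB.
    by have [] := st k.
  - apply: (fin _ _ (fun k => (U k).2 t n 0 i)) => k; first exact: hE.
    by have [] := st k.
have rU k t : 0 <= t <= T -> [/\ real_field ((U k).1.1 t), real_field ((U k).1.2 t) & real_field ((U k).2 t)].
  elim: k t => [|k IH] t tT; first by split.
  have sT s : 0 <= s <= t -> 0 <= s <= T.
    by move=> /andP[-> st]; case/andP: tT => _; exact: le_trans.
  split.
  - by apply: rf_mildV => // s /sT /IH [? ? ?]; exact: rf_FF.
  - by apply: rf_mildB => // s /sT /IH [? ? ?]; exact: rf_cross.
  - apply: rf_mildE => //; [by case/andP: tT|exact: rf_cross|].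
    by move=> s /sT /IH [? ? ?]; exact: rf_cross.
have [g1 g2 g3 g4 g5] := gu; rewrite /= in g1 g2 g3 g4 g5.
exists T; split => //; exists v, B, E; split => //.
  move=> t tT; split.
  - by apply: (limit_real M2 hv _ tT) => k s sT; have [] := rU k s sT.
  - by apply: (limit_real M2 hB _ tT) => k s sT; have [] := rU k s sT.
  - by apply: (limit_real M2 hE _ tT) => k s sT; have [] := rU k s sT.
by move=> t tT; split; apply/funext => n; apply: cvec_eq => i; have [h1 h2 h3] := fix_ t n i tT.
Qed.

End Picard.

(** * Regularity *)

Section Weights.
Variable R : realType.
Implicit Types (n m : Z3) (T t : R).

(** One plus the sum norm: at least 1, subadditive and submultiplicative. It can be split over a
    convolution additively, for truncated weights, or multiplicatively, for rapid decay. *)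
Definition ang n : R := 1 + \sum_j `|zr R n j|.

Lemma ang_ge1 n : 1 <= ang n.
Proof. by rewrite lerDl; apply: sumr_ge0 => j _; exact: normr_ge0. Qed.
Lemma ang_gt0 n : 0 < ang n. Proof. exact: lt_le_trans (ang_ge1 n). Qed.
Lemma ang_ge0 n : 0 <= ang n. Proof. exact: ltW (ang_gt0 n). Qed.
Lemma zr_ang n j : `|zr R n j| <= ang n.
Proof.
rewrite /ang (bigD1 j) //=.
have h : 0 <= \sum_(i < 3 | i != j) `|zr R n i| by apply: sumr_ge0 => i _; exact: normr_ge0.
lra.
Qed.

Lemma zr1_ang n j : 1 + `|zr R n j| <= ang n.
Proof.
rewrite /ang (bigD1 j) //= addrA lerDl.
by apply: sumr_ge0 => i _; exact: normr_ge0.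
Qed.

Lemma zrD n m k : zr R (n + m) k = zr R n k + zr R m k.
Proof. by rewrite /zr mxE intrD. Qed.
Lemma ang_triangle n m : ang n <= ang m + ang (n - m) - 1.
Proof.
have : \sum_j `|zr R n j| <= \sum_j `|zr R m j| + \sum_j `|zr R (n - m) j|.
  rewrite -big_split; apply: ler_sum => j _ /=.
  by apply: le_trans (ler_normD _ _); rewrite -zrD addrC subrK.
rewrite /ang; lra.
Qed.

Lemma angD n m : ang n <= ang m + ang (n - m).
Proof. by apply: le_trans (ang_triangle n m) _; rewrite gerBl. Qed.

Lemma angM n m : ang n <= ang m * ang (n - m).
Proof. have := ang_triangle n m; have := ang_ge1 m; have := ang_ge1 (n - m); nra. Qed.

Lemma nsq_ang n : nsq R n <= 3 * ang n ^+ 2.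
Proof.
rewrite /nsq; have -> : 3 * ang n ^+ 2 = \sum_(k < 3) ang n ^+ 2 by rewrite sumr_const card_ord mulr_natl.
apply: ler_sum => k _; rewrite -real_normK ?num_real // ler_sqr ?nnegrE ?ang_ge0 //.
exact: zr_ang.
Qed.

Lemma sum_subset_le (I : eqType) (s r : seq I) (f : I -> R) : uniq s -> uniq r -> {subset s <= r} ->
  (forall i, 0 <= f i) -> \sum_(i <- s) f i <= \sum_(i <- r) f i.
Proof.
move=> us ur sr f0; rewrite [leRHS](bigID (mem s)) /= -[leLHS]addr0; apply: lerD; last exact: sumr_ge0.
rewrite -[leRHS]big_filter (perm_big [seq i <- r | i \in s]) //.
apply: uniq_perm; rewrite ?filter_uniq // => i; rewrite mem_filter.
by case: (boolP (i \in s)) => // /sr ->.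
Qed.

Lemma sums_prod (I J : eqType) (a : I -> R) (b : J -> R) L M : (forall i, 0 <= a i) -> (forall j, 0 <= b j) ->
  sums a L -> sums b M -> sums (fun p : I * J => a p.1 * b p.2) (L * M).
Proof.
move=> a0 b0 ha hb s us.
pose s1 := undup (map fst s); pose s2 := undup (map snd s).
apply: (@le_trans _ _ (\sum_(p <- [seq (i, j) | i <- s1, j <- s2]) a p.1 * b p.2)).
  apply: sum_subset_le => //; last by move=> p; rewrite mulr_ge0.
    by apply: allpairs_uniq; rewrite ?undup_uniq // => -[? ?] [? ?] _ _ [-> ->].
  move=> [i j] ps; apply/allpairsP; exists (i, j); split => //=; rewrite mem_undup.
    by apply/mapP; exists (i, j).
  by apply/mapP; exists (i, j).
rewrite big_allpairs /=; under eq_bigr do rewrite -big_distrr.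
rewrite -big_distrl /=; apply: ler_pM; rewrite ?sumr_ge0 //.
  by apply: ha; exact: undup_uniq.
by apply: hb; exact: undup_uniq.
Qed.

(** Telescoping: from [N] to [N + 1] the bound [2 * (1 - (N + 1)^-1)] grows by 2 / ((N + 1) (N +
    2)), at least the new term. *)
Lemma sums_nat : sums (fun m : nat => (1 + m%:R : R) ^- 2) 2.
Proof.
have tel (N : nat) : \sum_(m <- iota 0 N) (1 + m%:R : R) ^- 2 <= 2 * (1 - (N%:R + 1)^-1).
  elim: N => [|N IH]; first by rewrite big_nil add0r invr1 subrr mulr0.
  rewrite -addn1 iotaD big_cat big_seq1 add0n /= natrD.
  apply: le_trans (lerD IH (lexx _)) _.
  have p : 0 <= N%:R :> R by []; move: (N%:R : R) p => x p.
  rewrite -subr_ge0.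
  have -> : 2 * (1 - (x + 1 + 1)^-1) - (2 * (1 - (x + 1)^-1) + (1 + x) ^- 2) = x / ((x + 1 + 1) * (1 + x) ^+ 2).
    by field; apply/andP; split; rewrite gt_eqF //; lra.
  by rewrite divr_ge0 // mulr_ge0 ?sqr_ge0 //; lra.
move=> s us; apply: (@le_trans _ _ (\sum_(m <- iota 0 (\max_(m <- s) m).+1) (1 + m%:R : R) ^- 2)).
  apply: sum_subset_le; [by []|exact: iota_uniq|move=> m ms|move=> m].
    by rewrite mem_iota /= add0n ltnS; apply: leq_bigmax_seq.
  by rewrite invr_ge0 sqr_ge0.
apply: le_trans (tel _) _.
have : 0 <= ((\max_(m <- s) m).+1%:R + 1 : R)^-1 by rewrite invr_ge0 addr_ge0.
lra.
Qed.

(** Absolute value and sign embed the integers into pairs of a natural number and a boolean; the two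
    signs double the bound 2. *)
Lemma sums_int : sums (fun k : int => (1 + `|k%:~R| : R) ^- 2) 4.
Proof.
have hb : sums (fun _ : bool => 1 : R) 2.
  move=> s us; rewrite big_const_seq count_predT iter_addr addr0.
  have : (size s <= #|{: bool}|)%N by rewrite -(card_uniqP us) max_card.
  by rewrite card_bool => h; rewrite ler_nat.
have e : (4 : R) = 2 * 2 by ring.
rewrite e.
have p2 (m : nat) : 0 <= (1 + m%:R : R) ^- 2 by rewrite invr_ge0 sqr_ge0.
have := @sums_inj R _ int _ _ (fun k : int => (`|k|%N, (k < 0)%R)) _ (sums_prod p2 (fun=> ler01) sums_nat hb).
have inj : injective (fun k : int => (`|k|%N, (k < 0)%R)).
  by move=> [a|a] [b|b] //= [] -> .
move=> /(_ inj); apply: sums_le => // k /=.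
by rewrite mulr1 natr_absz intr_norm.
Qed.

Definition Kang : R := 4 * (4 * 4).
(** Each [1 + |n_j|] is at most [ang n], so the sixth power dominates the product of three squares,
    one per coordinate. These are the six powers spent whenever a rapidly decaying series is
    summed. *)
Lemma sums_ang : sums (fun n : Z3 => ang n ^- 6) Kang.
Proof.
have p2 (k : int) : 0 <= (1 + `|k%:~R| : R) ^- 2 by rewrite invr_ge0 sqr_ge0.
have pp (p : int * int) : 0 <= (1 + `|p.1%:~R| : R) ^- 2 * (1 + `|p.2%:~R| : R) ^- 2 by rewrite mulr_ge0.
have := @sums_inj R _ Z3 _ _ (fun n : Z3 => (n 0 0, (n 0 1, n 0 2))) _ (sums_prod p2 pp sums_int (sums_prod p2 p2 sums_int sums_int)).
have inj : injective (fun n : Z3 => (n 0 0, (n 0 1, n 0 2))).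
  by move=> n m [h0 h1 h2]; apply/rowP; apply: I3_ind.
move=> /(_ inj); apply: sums_le => // n /=.
have q j : 0 < 1 + `|zr R n j| by rewrite ltr_pwDl.
rewrite -!invfM lef_pV2 ?posrE ?exprn_gt0 ?mulr_gt0 ?exprn_gt0 ?ang_gt0 ?q //.
rewrite (_ : 6 = 2 + (2 + 2))%N // !exprD.
have h j : (1 + `|zr R n j|) ^+ 2 <= ang n ^+ 2.
  by rewrite ler_sqr ?nnegrE ?ang_ge0 ?(ltW (q j)) // zr1_ang.
by apply: ler_pM; rewrite ?mulr_ge0 ?sqr_ge0 ?h //; apply: ler_pM; rewrite ?sqr_ge0 ?h.
Qed.

(** Decay faster than every power of the frequency, relative to a gauge [g] of the parameter. The
    gauges 1, |t - u| and |t - u|^2 give bounded families, Lipschitz families and Taylor remainders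
    in time; under convolution gauges multiply. *)
Definition rapid (I : Type) (D : I -> Prop) (f : I -> Z3 -> R[i]) (g : I -> R) :=
  forall s : nat, exists C : R, 0 <= C /\ forall i n, D i -> ang n ^+ s * cmod (f i n) <= C * g i.

Section rapid.
Variables (I : Type) (D : I -> Prop).
Implicit Types (f h : I -> Z3 -> R[i]) (g : I -> R).
Lemma rapid_ext f h g : (forall i n, D i -> f i n = h i n) -> rapid D f g -> rapid D h g.
Proof.
move=> e hf s; have [C [C0 hC]] := hf s; exists C; split => // i n Di.
by rewrite -e //; exact: hC.
Qed.

Lemma rapidD f h g : rapid D f g -> rapid D h g -> rapid D (fun i n => f i n + h i n) g.
Proof.
move=> hf hh s; have [C [C0 hC]] := hf s; have [C' [C'0 hC']] := hh s.
exists (C + C'); split; first exact: addr_ge0.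
move=> i n Di; apply: le_trans (ler_wpM2l _ (cmodD _ _)) _; first by rewrite exprn_ge0 // ang_ge0.
by rewrite mulrDr mulrDl lerD ?hC ?hC'.
Qed.

Lemma rapid_mult (sg : Z3 -> R[i]) (C : R) p f g : (forall n, cmod (sg n) <= C * ang n ^+ p) ->
  rapid D f g -> rapid D (fun i n => sg n * f i n) g.
Proof.
move=> hs hf s; have [C' [C'0 hC']] := hf (s + p)%N.
have C0 : 0 <= C.
  rewrite -(pmulr_lge0 _ (exprn_gt0 p (ang_gt0 0))); exact: le_trans (cmod_ge0 _) (hs 0).
exists (C * C'); split; first exact: mulr_ge0.
move=> i n Di; rewrite cmodM.
apply: (@le_trans _ _ (ang n ^+ s * (C * ang n ^+ p * cmod (f i n)))).
  by rewrite ler_wpM2l ?exprn_ge0 ?ang_ge0 // ler_wpM2r ?cmod_ge0.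
have -> : ang n ^+ s * (C * ang n ^+ p * cmod (f i n)) = C * (ang n ^+ (s + p) * cmod (f i n)) by rewrite exprD; ring.
by rewrite -mulrA ler_wpM2l // hC'.
Qed.

Lemma rapid_l1 f g i : rapid D f g -> D i -> exists L, l1 (f i) L.
Proof.
move=> hf Di; have [C [C0 hC]] := hf 6%N.
have g0 : 0 <= C * g i by apply: le_trans (hC i 0 Di); rewrite mulr_ge0 ?cmod_ge0 ?exprn_ge0 ?ang_ge0.
exists (C * g i * Kang); apply: sums_le (lexx _) (sumsZ g0 sums_ang) => n.
by rewrite ler_pdivlMr ?exprn_gt0 ?ang_gt0 // mulrC hC.
Qed.

Lemma rapid_conv f h g g' : rapid D f g -> rapid D h g' ->
  rapid D (fun i => conv (f i) (h i)) (fun i => g i * g' i).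
Proof.
move=> hf hh s; have [C [C0 hC]] := hf (s + 6)%N; have [C' [C'0 hC']] := hh s.
exists (2 * (C * C' * Kang)); split; first by rewrite !mulr_ge0.
move=> i n Di.
have g0 : 0 <= C * g i by apply: le_trans (hC i 0 Di); rewrite mulr_ge0 ?cmod_ge0 ?exprn_ge0 ?ang_ge0.
have g'0 : 0 <= C' * g' i by apply: le_trans (hC' i 0 Di); rewrite mulr_ge0 ?cmod_ge0 ?exprn_ge0 ?ang_ge0.
have [L hL] := rapid_l1 hf Di; have [L' hL'] := rapid_l1 hh Di.
have -> : ang n ^+ s * cmod (conv (f i) (h i) n) = cmod (csum (fun m => rC (ang n ^+ s) * (f i m * h i (n - m)))).
  by rewrite (csumZ _ (l1_convand n hL hL')) cmodM cmod_rC ger0_norm // exprn_ge0 // ang_ge0.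
have -> : 2 * (C * C' * Kang) * (g i * g' i) = 2 * ((C * g i) * (C' * g' i) * Kang) by ring.
apply: (csum_bd _ (sumsZ (mulr_ge0 g0 g'0) sums_ang)) => m.
rewrite !cmodM cmod_rC ger0_norm; last by rewrite exprn_ge0 // ang_ge0.
apply: (@le_trans _ _ (ang m ^+ s * ang (n - m) ^+ s * (cmod (f i m) * cmod (h i (n - m))))).
  rewrite ler_wpM2r ?mulr_ge0 ?cmod_ge0 // -exprMn lerXn2r ?nnegrE ?mulr_ge0 ?ang_ge0 //; exact: angM.
have -> : ang m ^+ s * ang (n - m) ^+ s * (cmod (f i m) * cmod (h i (n - m))) =
  (ang m ^+ s * cmod (f i m)) * (ang (n - m) ^+ s * cmod (h i (n - m))) by ring.
have -> : C * g i * (C' * g' i) * ang m ^- 6 = (C * g i * ang m ^- 6) * (C' * g' i) by ring.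
apply: ler_pM; rewrite ?mulr_ge0 ?cmod_ge0 ?exprn_ge0 ?ang_ge0 ?hC' //.
by rewrite ler_pdivlMr ?exprn_gt0 ?ang_gt0 // mulrAC -exprD hC.
Qed.

End rapid.
End Weights.

(** * Time regularity with rapidly decaying constants *)

Section SmoothClass.
Variable R : realType.
Variable T : R.
Implicit Types (a b : R -> Z3 -> R[i]) (n : Z3) (t u : R).

Definition tI t := 0 <= t <= T.
Definition tI2 (p : R * R) := tI p.1 /\ tI p.2.
Definition bdd a := rapid tI a (fun=> 1).
Definition lip a := rapid tI2 (fun p n => a p.2 n - a p.1 n) (fun p => `|p.2 - p.1|).
(** A quadratic remainder with constants uniform in time and rapidly decaying in frequency, instead
    of differentiability of each coefficient: such a bound passes through the infinite sums in a
    convolution. *)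
Definition dq a a' := rapid tI2 (fun p n => a p.2 n - a p.1 n - rC (p.2 - p.1) * a' p.1 n)
  (fun p => `|p.2 - p.1| ^+ 2).

(* quantitative C^{m-1,1} in time, with all constants rapidly decaying in the frequency *)
Fixpoint SM m a : Prop := bdd a /\ match m with 0 => True | m'.+1 => lip a /\
  match m' with 0 => True | _.+1 => exists a', dq a a' /\ SM m' a' end end.

Lemma SM_bdd m a : SM m a -> bdd a. Proof. by case: m => [|m] []. Qed.
Lemma SM_lip m a : SM m.+1 a -> lip a. Proof. by move=> [_ []]. Qed.
Lemma SM_dq m a : SM m.+2 a -> exists a', dq a a' /\ SM m.+1 a'. Proof. by move=> [_ [_]]. Qed.
Lemma SMS m a : SM m.+1 a -> SM m a.
Proof.
elim: m a => [|m IH] a; first by move=> [].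
move=> h; split; [exact: SM_bdd h|split; first exact: SM_lip h].
case: m IH h => // m IH h; have [a' [h1 h2]] := SM_dq h; exists a'; split => //; exact: IH.
Qed.

Lemma SM1_of m a : SM m.+1 a -> SM 1 a.
Proof. by elim: m => // m IH /SMS. Qed.

Lemma bddD a b : bdd a -> bdd b -> bdd (fun t n => a t n + b t n). Proof. exact: rapidD. Qed.
Lemma lipD a b : lip a -> lip b -> lip (fun t n => a t n + b t n).
Proof. by move=> ha hb; apply: rapid_ext (rapidD ha hb) => p n _; ring. Qed.
Lemma dqD a b a' b' : dq a a' -> dq b b' -> dq (fun t n => a t n + b t n) (fun t n => a' t n + b' t n).
Proof. by move=> ha hb; apply: rapid_ext (rapidD ha hb) => p n _; ring. Qed.
Lemma SM_D m a b : SM m a -> SM m b -> SM m (fun t n => a t n + b t n).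
Proof.
elim: m a b => [|m IH] a b ha hb; first by split => //; apply: bddD; [exact: SM_bdd ha|exact: SM_bdd hb].
split; first by apply: bddD; [exact: SM_bdd ha|exact: SM_bdd hb].
split; first by apply: lipD; [exact: SM_lip ha|exact: SM_lip hb].
case: m IH ha hb => // m IH ha hb.
have [a' [h1 h2]] := SM_dq ha; have [b' [h3 h4]] := SM_dq hb.
by exists (fun t n => a' t n + b' t n); split; [exact: dqD|exact: IH].
Qed.

Lemma SM_mult m (sg : Z3 -> R[i]) (C : R) p a : (forall n, cmod (sg n) <= C * ang R n ^+ p) ->
  SM m a -> SM m (fun t n => sg n * a t n).
Proof.
move=> hs; have hb b : bdd b -> bdd (fun t n => sg n * b t n) by exact: rapid_mult hs.
have hl b : lip b -> lip (fun t n => sg n * b t n).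
  by move=> h; apply: rapid_ext (rapid_mult hs h) => q n _; ring.
have hd b b' : dq b b' -> dq (fun t n => sg n * b t n) (fun t n => sg n * b' t n).
  by move=> h; apply: rapid_ext (rapid_mult hs h) => q n _; ring.
elim: m a => [|m IH] a ha; first by split => //; apply: hb; exact: SM_bdd ha.
split; first by apply: hb; exact: SM_bdd ha.
split; first by apply: hl; exact: SM_lip ha.
case: m IH ha => // m IH ha; have [a' [h1 h2]] := SM_dq ha.
by exists (fun t n => sg n * a' t n); split; [exact: hd|exact: IH].
Qed.

Lemma SM_Z m z a : SM m a -> SM m (fun t n => z * a t n).
Proof. by apply: (SM_mult (C := cmod z) (p := 0)) => n; rewrite expr0 mulr1. Qed.
Lemma SM_N m a : SM m a -> SM m (fun t n => - a t n).
Proof. by move=> h; under [X in SM _ X]funext do under eq_fun do rewrite -mulN1r; exact: SM_Z. Qed.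
Lemma SM_B m a b : SM m a -> SM m b -> SM m (fun t n => a t n - b t n).
Proof. by move=> ha /SM_N; exact: SM_D. Qed.

Lemma bdd_fst a : bdd a -> rapid tI2 (fun p => a p.1) (fun=> 1).
Proof. by move=> h s; have [C [C0 hC]] := h s; exists C; split => // p n [h1 _]; exact: hC. Qed.
Lemma bdd_snd a : bdd a -> rapid tI2 (fun p => a p.2) (fun=> 1).
Proof. by move=> h s; have [C [C0 hC]] := h s; exists C; split => // p n [_ h1]; exact: hC. Qed.
Lemma bdd_l1 a t : bdd a -> tI t -> exists L, l1 (a t) L.
Proof. exact: rapid_l1. Qed.
Lemma rapid_g (I : Type) (D : I -> Prop) f (g g' : I -> R) : g =1 g' -> @rapid R I D f g -> rapid D f g'.
Proof. by move=> /funext ->. Qed.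

Lemma bdd_conv a b : bdd a -> bdd b -> bdd (fun t => conv (a t) (b t)).
Proof. by move=> ha hb; apply: rapid_g (rapid_conv ha hb) => t; rewrite mulr1. Qed.
Lemma lip_conv a b : bdd a -> bdd b -> lip a -> lip b -> lip (fun t => conv (a t) (b t)).
Proof.
move=> ha hb la lb.
have h1 := rapid_g (fun p => mulr1 _) (rapid_conv la (bdd_snd hb)).
have h2 := rapid_g (fun p => mul1r _) (rapid_conv (bdd_fst ha) lb).
apply: rapid_ext (rapidD h1 h2) => -[t u] n [/= tT uT].
have [L hL] := bdd_l1 ha tT; have [L' hL'] := bdd_l1 ha uT.
have [M hM] := bdd_l1 hb tT; have [M' hM'] := bdd_l1 hb uT.
by rewrite (convB n hL' hL hM' hM).
Qed.

(** The remainder of a product is the remainder of [a] against [b u], plus [rC (u - t)] times [a' t]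
    against the increment of [b], plus [a t] against the remainder of [b]. Each piece is quadratic
    in [u - t]; the middle one uses that [b] is Lipschitz. *)
Lemma dq_conv a b a' b' : bdd a -> bdd b -> bdd a' -> bdd b' -> lip b -> dq a a' -> dq b b' ->
  dq (fun t => conv (a t) (b t)) (fun t n => conv (a' t) (b t) n + conv (a t) (b' t) n).
Proof.
move=> ha hb ha' hb' lb da db.
have h1 := rapid_g (fun p => mulr1 _) (rapid_conv da (bdd_snd hb)).
have h3 := rapid_g (fun p => mul1r _) (rapid_conv (bdd_fst ha) db).
have ht : rapid tI2 (fun p n => rC (p.2 - p.1) * a' p.1 n) (fun p => `|p.2 - p.1|).
  move=> s; have [C [C0 hC]] := ha' s; exists C; split => // p n [h _].
  rewrite cmodM cmod_rC mulrCA mulrC ler_wpM2r //; have := hC p.1 n h; by rewrite mulr1.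
have h2 := rapid_g (fun p => esym (expr2 _)) (rapid_conv ht lb).
apply: rapid_ext (rapidD (rapidD h1 h2) h3) => -[t u] n [/= tT uT].
have [L hL] := bdd_l1 ha tT; have [L' hL'] := bdd_l1 ha uT.
have [M hM] := bdd_l1 hb tT; have [M' hM'] := bdd_l1 hb uT.
have [N hN] := bdd_l1 ha' tT; have [N' hN'] := bdd_l1 hb' tT.
set h := rC (u - t); have hhN := l1Z h hN; have hhN' := l1Z h hN'.
rewrite (convBl n (l1B hL' hL) hhN hM') (convBl n hL' hL hM') (convBr n hhN hM' hM).
rewrite (convBr n hL (l1B hM' hM) hhN') (convBr n hL hM' hM).
have -> : conv (fun m => h * a' t m) (b t) n = h * conv (a' t) (b t) n.
  rewrite /conv -(csumZ _ (l1_convand n hN hM)); apply: csum_eq => m; by rewrite mulrA.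
have -> : conv (a t) (fun m => h * b' t m) n = h * conv (a t) (b' t) n.
  rewrite /conv -(csumZ _ (l1_convand n hL hN')); apply: csum_eq => m; by rewrite mulrCA.
ring.
Qed.

Lemma SM_conv m a b : SM m a -> SM m b -> SM m (fun t => conv (a t) (b t)).
Proof.
elim: m a b => [|m IH] a b ha hb; have ba := SM_bdd ha; have bb := SM_bdd hb.
  by split => //; exact: bdd_conv.
split; first exact: bdd_conv.
split; first by apply: lip_conv => //; [exact: SM_lip ha|exact: SM_lip hb].
case: m IH ha hb => // m IH ha hb.
have [a' [h1 h2]] := SM_dq ha; have [b' [h3 h4]] := SM_dq hb.
exists (fun t n => conv (a' t) (b t) n + conv (a t) (b' t) n); split.
  by apply: dq_conv => //; [exact: SM_bdd h2|exact: SM_bdd h4|exact: SM_lip hb].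
by apply: SM_D; apply: IH => //; exact: SMS.
Qed.

Lemma cder_MVT (Y G : R -> R[i]) (a b c t u : R) :
  (forall s, a <= s <= b -> cder Y s (G s)) -> (forall s, a <= s <= b -> cmod (G s) <= c) ->
  a <= t <= b -> a <= u <= b -> cmod (Y u - Y t) <= 2 * c * `|u - t|.
Proof.
move=> hY hc ht hu; apply: le_trans (cmod_le _) _.
rewrite cReD cImD cReN cImN (_ : 2 * c * `|u - t| = c * `|u - t| + c * `|u - t|); last by ring.
apply: lerD.
  apply: (@MVT_abs R (fun s => complex.Re (Y s)) (fun s => complex.Re (G s)) a b) => // s hs.
    by have [] := hY s hs.
  by apply: le_trans (Re_le _) _; exact: hc.
apply: (@MVT_abs R (fun s => complex.Im (Y s)) (fun s => complex.Im (G s)) a b) => // s hs.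
  by have [] := hY s hs.
by apply: le_trans (Im_le _) _; exact: hc.
Qed.

(** One level is gained by integrating the equation: the mean value inequality turns bounds on [G]
    into Lipschitz bounds on [a], and Lipschitz bounds on [G] into quadratic remainders. *)
Lemma SM_ode m a (G : R -> Z3 -> R[i]) :
  (forall n, exists Y : R -> R[i], forall t, tI t -> a t n = Y t /\ cder Y t (G t n)) ->
  bdd a -> SM m G -> SM m.+1 a.
Proof.
move=> hY ba hG; have bG := SM_bdd hG.
split => //; split.
  move=> s; have [C [C0 hC]] := bG s; exists (2 * C); split; first exact: mulr_ge0.
  move=> [t u] n [/= tT uT]; have [Y hYn] := hY n.
  have [-> _] := hYn t tT; have [-> _] := hYn u uT.
  have p : 0 < ang R n ^+ s by rewrite exprn_gt0 // ang_gt0.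
  have hb r : 0 <= r <= T -> cmod (G r n) <= C / ang R n ^+ s.
    by move=> rT; rewrite ler_pdivlMr // mulrC; have := hC r n rT; rewrite mulr1.
  have q := @cder_MVT Y (fun r => G r n) 0 T (C / ang R n ^+ s) t u (fun r rT => (hYn r rT).2) hb tT uT.
  rewrite mulrC -ler_pdivlMr //; apply: le_trans q _.
  by rewrite le_eqVlt; apply/orP; left; apply/eqP => /=; ring.
case: m hG => // m hG; exists G; split => //.
move=> s; have [C [C0 hC]] := SM_lip hG s; exists (2 * C); split; first exact: mulr_ge0.
move=> [t u] n [/= tT uT]; have [Y hYn] := hY n.
have [-> _] := hYn t tT; have [-> _] := hYn u uT.
have p : 0 < ang R n ^+ s by rewrite exprn_gt0 // ang_gt0.
(* With the tangent at [t] subtracted, the Taylor remainder is an increment of [Z], whose derivative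
   [G r n - G t n] is of order [u - t] between the two times. *)
pose Z r := Y r - rC r * G t n.
have dZ r : tI r -> cder Z r (G r n - G t n).
  move=> rT; apply: cder_eq (cderB (hYn r rT).2 (cderM (cder_rC (der_id r)) (cder_cst _ _))) _.
  by rewrite mulr0 addr0 mul1r.
have sub r : Num.min t u <= r <= Num.max t u -> tI r /\ `|r - t| <= `|u - t|.
  move: tT uT; rewrite /tI; case: (leP t u) => h /andP[h1 h2] /andP[h3 h4] /andP[h5 h6].
    split; first by apply/andP; split; lra.
    by rewrite !ger0_norm; lra.
  split; first by apply/andP; split; lra.
  by rewrite !ler0_norm; lra.
have -> : Y u - Y t - rC (u - t) * G t n = Z u - Z t by rewrite /Z rCD rCN; ring.
have hb r : Num.min t u <= r <= Num.max t u -> cmod (G r n - G t n) <= C * `|u - t| / ang R n ^+ s.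
  move=> /sub [rT hr]; rewrite ler_pdivlMr // mulrC.
  by apply: le_trans (hC (t, r) n (conj tT rT)) _; rewrite ler_wpM2l.
have q := @cder_MVT Z (fun r => G r n - G t n) (Num.min t u) (Num.max t u) (C * `|u - t| / ang R n ^+ s) t u
  (fun r rI => dZ r (sub r rI).1) hb _ _.
rewrite mulrC -ler_pdivlMr //; apply: le_trans (q _ _) _.
- by rewrite ge_min lexx le_max lexx.
- by rewrite ge_min lexx orbT le_max lexx orbT.
- by rewrite le_eqVlt; apply/orP; left; apply/eqP => /=; ring.
Qed.

End SmoothClass.

(** * Propagation of decay and bootstrap in time *)

Section Regularity.
Variable R : realType.
Implicit Types (T t nu : R) (n : Z3).

Lemma pow_subadd (x y : R) s : 0 <= x -> 0 <= y -> (x + y) ^+ s <= 2 ^+ s * (x ^+ s + y ^+ s).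
Proof.
move=> x0 y0; wlog xy : x y x0 y0 / x <= y.
  move=> W; case: (leP x y) => h; first exact: W.
  by rewrite addrC [x ^+ s + _]addrC; apply: W => //; exact: ltW.
apply: (@le_trans _ _ ((2 * y) ^+ s)); first by rewrite lerXn2r ?nnegrE ?addr_ge0 ?mulr_ge0 //; lra.
by rewrite exprMn ler_wpM2l ?exprn_ge0 // lerDr exprn_ge0.
Qed.

Lemma min_subadd (x y z K : R) : x <= y + z -> 1 <= y -> 1 <= z -> 1 <= K ->
  Num.min x K <= Num.min y K + Num.min z K.
Proof. by case: (leP x K); case: (leP y K); case: (leP z K); lra. Qed.

(** A solution is its own image, so [weight_step] can be applied to it repeatedly; being affine with
    slope at most 1/2 for large [lam], it improves any finite bound towards its fixed point. Here
    [lam] depends on [s], the interval does not. *)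
Lemma solution_decay nu T (v0 B0 E0 : field R) (v B E : R -> field R) s (D : R) : 0 < nu -> 0 <= T ->
  contX0 T v -> contX0 T B -> contX0 T E -> img nu T v0 B0 E0 v B E v B E ->
  (forall n k, [/\ ang R n ^+ s * cmod (v0 n 0 k) <= D, ang R n ^+ s * cmod (B0 n 0 k) <= D &
    ang R n ^+ s * cmod (E0 n 0 k) <= D]) ->
  exists C, 0 <= C /\ forall t n k, 0 <= t <= T -> [/\ ang R n ^+ s * cmod (v t n 0 k) <= C,
    ang R n ^+ s * cmod (B t n 0 k) <= C & ang R n ^+ s * cmod (E t n 0 k) <= C].
Proof.
move=> nu0 T0 cv cB cE i1 hD.
have T00 : 0 <= (0 : R) <= T by rewrite lexx.
have [M1 H1] := contX0_fl1 T0 cv; have [M2 H2] := contX0_fl1 T0 cB; have [M3 H3] := contX0_fl1 T0 cE.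
have p1 := fl1_ge0 (H1 0 T00); have p2 := fl1_ge0 (H2 0 T00); have p3 := fl1_ge0 (H3 0 T00).
set M := M1 + M2 + M3.
have M0 : 0 <= M by rewrite /M; lra.
have hM t : 0 <= t <= T -> [/\ fl1 (v t) M, fl1 (B t) M & fl1 (E t) M].
  by move=> tT; split; [apply: fl1_le (H1 t tT)|apply: fl1_le (H2 t tT)|apply: fl1_le (H3 t tT)]; rewrite /M; lra.
(* The constant of [pow_subadd], with which a power of a subadditive weight is again almost
   subadditive. *)
pose c : R := 2 ^+ s; have c1 : 1 <= c by rewrite /c exprn_ege1 // ler1n.
set L := 8 * c * M + 48 * c ^+ 2 * M ^+ 2.
have L0 : 0 <= L by rewrite addr_ge0 ?mulr_ge0 ?sqr_ge0 //; lra.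
have d0 : 0 < (2 * (L + 1))^-1 by rewrite invr_gt0; lra.
have [lam [lam1 hk]] := energy_gain_small nu0 d0.
have lam0 : 0 < lam by apply: lt_le_trans lam1.
have kL : energy_gain nu lam * L <= 2^-1.
  apply: le_trans (ler_wpM2r L0 hk) _; rewrite mulrC ler_pdivrMr; lra.
have D0 : 0 <= D by have [h _ _] := hD 0 0; apply: le_trans h; rewrite mulr_ge0 ?cmod_ge0 ?exprn_ge0 ?ang_ge0.
(* [6 * D] is the fixed point of the recursion [x = 3 * D + x / 2] obtained from [weight_step]. *)
exists (expR (lam * T) * (6 * D)); split; first by rewrite !mulr_ge0 ?expR_ge0.
move=> t n0 k tT.
(* truncating the weight makes the a priori quantity finite; the bound does not depend on K *)
pose K := ang R n0; have K1 : 1 <= K by exact: ang_ge1.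
pose w n := (Num.min (ang R n) K) ^+ s.
have mn1 n : 1 <= Num.min (ang R n) K by rewrite le_min ang_ge1.
have mn0 n : 0 <= Num.min (ang R n) K by apply: le_trans (mn1 n).
have w0 n : 0 < w n by rewrite exprn_gt0 // (lt_le_trans _ (mn1 n)).
have wa n : w n <= ang R n ^+ s by rewrite lerXn2r ?nnegrE ?ang_ge0 ?mn0 // ge_min lexx.
have wK n : w n <= K ^+ s.
  by rewrite lerXn2r ?nnegrE ?mn0 ?ge_min ?lexx ?orbT //; apply: le_trans K1.
have hw (n m : Z3) : w n <= c * (w m + w (n - m)).
  apply: le_trans (pow_subadd s (mn0 m) (mn0 (n - m))).
  rewrite lerXn2r ?nnegrE ?addr_ge0 ?mn0 //.
  exact: min_subadd (angD R n m) (ang_ge1 R m) (ang_ge1 R (n - m)) K1.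
have wD n j : [/\ w n * cmod (v0 n 0 j) <= D, w n * cmod (B0 n 0 j) <= D & w n * cmod (E0 n 0 j) <= D].
  by have [h1 h2 h3] := hD n j; split; [apply: le_trans h1|apply: le_trans h2|apply: le_trans h3];
    rewrite ler_wpM2r ?cmod_ge0.
have e1 u : 0 <= u <= T -> 1 <= expR (lam * u).
  by move=> /andP[t0 _]; rewrite -expR0 ler_expR mulr_ge0 // ltW.
have S0 : 0 <= K ^+ s * M by rewrite mulr_ge0 // exprn_ge0 //; apply: le_trans K1.
(* The truncated weight makes the crude bound [K ^+ s * M] available at the start; each application
   of [weight_step] halves its contribution. *)
have key (j : nat) : forall u n k, 0 <= u <= T -> [/\ w n * cmod (v u n 0 k) <= expR (lam * u) * (6 * D + K ^+ s * M / 2 ^+ j),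
     w n * cmod (B u n 0 k) <= expR (lam * u) * (6 * D + K ^+ s * M / 2 ^+ j) &
     w n * cmod (E u n 0 k) <= expR (lam * u) * (6 * D + K ^+ s * M / 2 ^+ j)].
  elim: j => [|j IH] u n i uT.
    have [a1 a2 a3] := hM u uT.
    have tri x : cmod x <= M -> w n * cmod x <= expR (lam * u) * (6 * D + K ^+ s * M / 2 ^+ 0) :> R.
      move=> hx; rewrite expr0 divr1; apply: (@le_trans _ _ (K ^+ s * M)).
        by apply: ler_pM => //; [exact: ltW|exact: cmod_ge0].
      apply: (@le_trans _ _ (6 * D + K ^+ s * M)); first by rewrite lerDr mulr_ge0.
      by rewrite ler_peMl ?e1 // addr_ge0 // mulr_ge0.
    by split; apply: tri; [exact: l1_sup (a1 i)|exact: l1_sup (a2 i)|exact: l1_sup (a3 i)].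
  have [a1 a2 a3] := weight_step nu0 lam1 w0 c1 hw i1 hM wD IH n i uT.
  have h : expR (lam * u) * (3 * D + energy_gain nu lam * (L * (6 * D + K ^+ s * M / 2 ^+ j))) <=
     expR (lam * u) * (6 * D + K ^+ s * M / 2 ^+ j.+1).
    rewrite ler_wpM2l ?expR_ge0 // mulrA.
    have p : 0 <= 6 * D + K ^+ s * M / 2 ^+ j by rewrite addr_ge0 ?mulr_ge0 // ?invr_ge0 ?exprn_ge0 //; apply: le_trans K1.
    have q := ler_wpM2r p kL.
    have e : K ^+ s * M / 2 ^+ j.+1 = 2^-1 * (K ^+ s * M / 2 ^+ j) by rewrite exprS invfM mulrCA.
    rewrite e; move: q; set z := K ^+ s * M / 2 ^+ j; lra.
  by split; [apply: le_trans a1 h|apply: le_trans a2 h|apply: le_trans a3 h].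
(* The truncation level was set at [n0], so the truncation is inactive at this frequency. *)
have wn0 : w n0 = ang R n0 ^+ s by rewrite /w /K min_l.
have fin x : (forall j : nat, w n0 * x <= expR (lam * t) * (6 * D + K ^+ s * M / 2 ^+ j)) ->
    ang R n0 ^+ s * x <= expR (lam * T) * (6 * D).
  move=> h; rewrite -wn0.
  apply: (@le_trans _ _ (expR (lam * t) * (6 * D))); last first.
    rewrite ler_wpM2r ?mulr_ge0 // ler_expR ler_wpM2l ?(ltW lam0) //; by case/andP: tT.
  apply: (@halving _ _ _ (expR (lam * t) * (K ^+ s * M))) => [|j]; first by rewrite mulr_ge0 ?expR_ge0.
  by rewrite -mulrA -mulrDr.
by split; apply: fin => j; have [] := key j t n0 k tT.
Qed.

(** Induction on [m]: the right-hand sides arise from the fields by convolutions and by multipliers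
    of polynomial growth, under which [SM T m] is stable, and [SM_ode] raises the level. The powers
    of n lost in the equations cost nothing against rapid decay. *)
Lemma solution_SM nu T (v0 B0 E0 : field R) (v B E : R -> field R) : 0 < nu -> 0 <= T ->
  contX0 T v -> contX0 T B -> contX0 T E -> img nu T v0 B0 E0 v B E v B E ->
  (forall s, exists D : R, forall n k, [/\ ang R n ^+ s * cmod (v0 n 0 k) <= D, ang R n ^+ s * cmod (B0 n 0 k) <= D &
    ang R n ^+ s * cmod (E0 n 0 k) <= D]) ->
  forall m k, [/\ SM T m (fun t => comp (v t) k), SM T m (fun t => comp (B t) k) & SM T m (fun t => comp (E t) k)].
Proof.
move=> nu0 T0 cv cB cE i1 hD.
have bd k : [/\ bdd T (fun t => comp (v t) k), bdd T (fun t => comp (B t) k) & bdd T (fun t => comp (E t) k)].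
  by split => s; have [D hDs] := hD s;
    have [C [C0 hC]] := solution_decay nu0 T0 cv cB cE i1 hDs; exists C; split => // t n tT;
    rewrite mulr1; have [] := hC t n k tT.
have zb j n : cmod (rC (zr R n j)) <= 1 * ang R n ^+ 1 by rewrite cmod_rC mul1r expr1 zr_ang.
(* A nonzero integer vector has squared length at least 1; at [n = 0] the inverse of 0 is 0. *)
have Vb n : cmod (rC (nsq R n)^-1) <= 1 * ang R n ^+ 0.
  rewrite expr0 mulr1 cmod_rC ger0_norm ?invr_ge0 ?nsq_ge0 //.
  have [->|n0] := eqVneq n 0; first by rewrite (_ : nsq R 0 = 0) ?invr0 //; apply/eqP; rewrite nsq_eq0.
  have p : 0 < nsq R n by rewrite lt_def nsq_eq0 n0 nsq_ge0.
  rewrite invf_le1 //.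
  have : exists k, n 0 k != 0.
    apply/existsP; rewrite -[X in is_true X]negbK negb_exists; apply/negP => /forallP h.
    by move/eqP: n0; apply; apply/rowP => k; rewrite mxE; move: (h k); rewrite negbK => /eqP.
  move=> [k hk]; apply: le_trans (zr2_le R n k).
  rewrite -real_normK ?num_real // /zr -intr_norm expr_ge1 ?ler0z // ler1z.
  by rewrite -gtz0_ge1 normr_gt0.
have hcross m (u w : R -> field R) : (forall k, SM T m (fun t => comp (u t) k)) -> (forall k, SM T m (fun t => comp (w t) k)) ->
    forall k, SM T m (fun t => comp (cross (u t) (w t)) k).
  move=> hu hw k; rewrite /comp; under [X in SM _ _ X]funext do under eq_fun do rewrite crossE.
  by apply: SM_B; exact: (SM_conv (hu _) (hw _)).
have hcurl m (u : R -> field R) : (forall k, SM T m (fun t => comp (u t) k)) ->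
    forall k, SM T m (fun t n => curln n (u t n) 0 k).
  move=> hu k; under [X in SM _ _ X]funext do under eq_fun do rewrite curlnE.
  by apply: SM_Z; apply: SM_B; [exact: (SM_mult (zb _) (hu (k + 2)))|exact: (SM_mult (zb _) (hu (k + 1)))].
have hlern m (u : R -> field R) : (forall k, SM T m (fun t => comp (u t) k)) ->
    forall k, SM T m (fun t n => lern n (u t n) 0 k).
  move=> hu k; under [X in SM _ _ X]funext do under eq_fun do rewrite lernE cvecB gradnE ndotE mulrC.
  apply: SM_B; first exact: hu.
  apply: (SM_mult (zb _)); apply: (SM_mult Vb).
  apply: SM_D; last exact: (SM_mult (zb _) (hu 2)).
  by apply: SM_D; [exact: (SM_mult (zb _) (hu 0))|exact: (SM_mult (zb _) (hu 1))].
have hFF m (u w z : R -> field R) : (forall k, SM T m (fun t => comp (u t) k)) -> (forall k, SM T m (fun t => comp (w t) k)) ->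
    (forall k, SM T m (fun t => comp (z t) k)) ->
    forall k, SM T m (fun t => comp (FF (u t) (w t) (z t)) k).
  move=> hu hw hz k; rewrite /comp; under [X in SM _ _ X]funext do under eq_fun do rewrite FFE I3_sum.
  apply: SM_B; last exact: (hcross _ _ _ (hcross _ _ _ hu hw) hw k).
  apply: SM_B; last exact: (hcross _ _ _ hz hw k).
  apply: SM_Z; apply: SM_D; last exact: (SM_mult (zb _) (SM_conv (hu _) (hu _))).
  by apply: SM_D; exact: (SM_mult (zb _) (SM_conv (hu _) (hu _))).
elim=> [|m IH] k; first by have [b1 b2 b3] := bd k; split; split.
have hv j : SM T m (fun t => comp (v t) j) by have [] := IH j.
have hB j : SM T m (fun t => comp (B t) j) by have [] := IH j.
have hE j : SM T m (fun t => comp (E t) j) by have [] := IH j.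
have [b1 b2 b3] := bd k.
split.
- apply: (SM_ode (G := fun t n => (- (rC (nu * nsq R n) *: v t n) - lern n (FF (v t) (B t) (E t) n)) 0 k)) => //.
    move=> n; have [V [Bm [Em [h1 _ _ _ h5]]]] := i1 n; exists (fun t => V t 0 k) => t tT.
    have [e1 e2 e3] := h5 t tT; have [a1 a2 a3] := h1 t tT; rewrite /comp e1; split => //; exact: a1.
  under [X in SM _ _ X]funext do under eq_fun do rewrite cvecB cvecN cvecZ.
  apply: SM_B; last by apply: hlern => j; exact: hFF.
  apply: SM_N; apply: (SM_mult (C := nu * 3) (p := 2)) (hv k) => n.
  rewrite cmod_rC normrM (ger0_norm (ltW nu0)) (ger0_norm (nsq_ge0 _ _)) -mulrA ler_wpM2l ?(ltW nu0) //.
  exact: nsq_ang.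
- apply: (SM_ode (G := fun t n => (- curln n (E t n)) 0 k)) => //.
    move=> n; have [V [Bm [Em [h1 _ _ _ h5]]]] := i1 n; exists (fun t => Bm t 0 k) => t tT.
    have [e1 e2 e3] := h5 t tT; have [a1 a2 a3] := h1 t tT; rewrite /comp e2 e3; split => //; exact: a2.
  by under [X in SM _ _ X]funext do under eq_fun do rewrite cvecN; apply: SM_N; exact: hcurl.
- apply: (SM_ode (G := fun t n => (curln n (B t n) - E t n - cross (v t) (B t) n) 0 k)) => //.
    move=> n; have [V [Bm [Em [h1 _ _ _ h5]]]] := i1 n; exists (fun t => Em t 0 k) => t tT.
    have [e1 e2 e3] := h5 t tT; have [a1 a2 a3] := h1 t tT; rewrite /comp e2 e3; split => //; exact: a3.
  under [X in SM _ _ X]funext do under eq_fun do rewrite !cvecB.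
  by apply: SM_B; [apply: SM_B; [exact: hcurl|exact: hE]|exact: hcross].
Qed.

End Regularity.

(** * Smoothness of the space-time Fourier series *)

Section PhysSmooth.
Variable R : realType.
Implicit Types (n : Z3).

Lemma MVT_all (f df : R -> R) (c t s : R) : (forall x, der f x (df x)) ->
  (forall x, `|x - s| <= `|t - s| -> `|df x| <= c) -> `|f t - f s| <= c * `|t - s|.
Proof.
move=> hd hc; apply: (@MVT_abs R f df (Num.min s t) (Num.max s t)) => // [x||].
- case: (leP s t) => h /andP[h1 h2]; apply: hc.
    by rewrite !ger0_norm; lra.
  by rewrite !ler0_norm; lra.
- by rewrite ge_min lexx orbT le_max lexx orbT.
- by rewrite ge_min lexx le_max lexx.
Qed.

Lemma cos_lip (a b : R) : `|cos a - cos b| <= `|a - b|.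
Proof.
rewrite -[leRHS]mul1r; apply: (MVT_all (df := fun x => - sin x)) => [x|x _]; first exact: is_derive_cos.
by rewrite normrN ler_norml sin_geN1 sin_le1.
Qed.

Lemma sin_lip (a b : R) : `|sin a - sin b| <= `|a - b|.
Proof.
rewrite -[leRHS]mul1r; apply: (MVT_all (df := cos)) => [x|x _]; first exact: is_derive_sin.
by rewrite ler_norml cos_geN1 cos_le1.
Qed.

Lemma expi_lip (a b : R) : cmod (expi a - expi b) <= 2 * `|a - b|.
Proof.
apply: le_trans (cmod_le _) _ => /=; rewrite mulr2n mulrDl mul1r.
by apply: lerD; [exact: cos_lip|exact: sin_lip].
Qed.

Lemma expiD (a b : R) : expi (a + b) = expi a * expi b.
Proof. by apply: complex_eq; rewrite ?cReM ?cImM /= ?cosD ?sinD //; ring. Qed.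
Lemma expi0 : expi (0 : R) = 1.
Proof. by rewrite /expi cos0 sin0. Qed.
Lemma expi_quad (a d : R) : cmod (expi (a + d) - expi a - iC R * rC d * expi a) <= 2 * d ^+ 2.
Proof.
have -> : expi (a + d) - expi a - iC R * rC d * expi a = expi a * (expi d - 1 - iC R * rC d).
  by rewrite expiD; ring.
rewrite cmodM cmod_expi mul1r; apply: le_trans (cmod_le _) _.
have -> : complex.Re (expi d - 1 - iC R * rC d) = cos d - 1 by rewrite /=; ring.
have -> : complex.Im (expi d - 1 - iC R * rC d) = sin d - d by rewrite /=; ring.
rewrite -[d ^+ 2]real_normK ?num_real // expr2 mulr2n mulrDl mul1r; apply: lerD.
  have := @MVT_all cos (fun x => - sin x) `|d| d 0; rewrite cos0 subr0; apply => [x|x].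
    exact: is_derive_cos.
  rewrite subr0 normrN => h; apply: le_trans h.
  by have := sin_lip x 0; rewrite sin0 !subr0.
have := @MVT_all (fun x => sin x - x) (fun x => cos x - 1) `|d| d 0; rewrite sin0 !subr0; apply => [x|x].
  exact: derB (is_derive_sin x) (der_id x).
rewrite subr0 => h; apply: le_trans h.
by have := cos_lip x 0; rewrite cos0 !subr0.
Qed.

Lemma csum_rapid (x : Z3 -> R[i]) C : 0 <= C -> (forall n, ang R n ^+ 6 * cmod (x n) <= C) ->
  cmod (csum x) <= 2 * (C * Kang R).
Proof.
move=> C0 hx; apply: (csum_bd _ (sumsZ C0 (sums_ang R))) => n.
by rewrite ler_pdivlMr ?exprn_gt0 ?ang_gt0 // mulrC hx.
Qed.

Lemma lip_within m (D : set 'rV[R]_m) (f : 'rV[R]_m -> R) (C : R) : 0 <= C ->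
  (forall p q, D p -> D q -> `|f p - f q| <= C * `|p - q|) -> {within D, continuous f}.
Proof.
move=> C0 hf; apply/subspace_continuousP => x Dx; apply/(@cvgrPdist_lt R R^o) => e e0.
have d0 : 0 < e / (C + 1) by rewrite divr_gt0 //; lra.
apply/nbhs_ballP; exists (e / (C + 1)) => //= y xy Dy.
apply: le_lt_trans (hf _ _ Dx Dy) _.
have {}xy : `|x - y| < e / (C + 1) by move: xy; rewrite -ball_normE.
rewrite ltr_pdivlMr in xy; last lra.
have := normr_ge0 (x - y); lra.
Qed.

(** Only increments that stay in [D] are tested, so at t = 0 and t = T the same bound covers the
    one-sided time derivatives. *)
Lemma pder_quad m (D : set 'rV[R]_m) (f : 'rV[R]_m -> R) j p (l C : R) : 0 <= C ->
  (forall h : R, D (p + h *: delta_mx 0 j) -> `|f (p + h *: delta_mx 0 j) - f p - h * l| <= C * h ^+ 2) ->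
  pderiv_within D f j p l.
Proof.
move=> C0 hf; apply/(@cvgrPdist_lt R R^o) => e e0.
have d0 : 0 < e / (C + 1) by rewrite divr_gt0 //; lra.
apply/nbhs_ballP; exists (e / (C + 1)) => //= h hd hn Dh.
have h0 : h != 0 by [].
have hd' : `|h| < e / (C + 1) by move: hd; rewrite /ball /= sub0r normrN.
have -> : l - h^-1 * (f (p + h *: delta_mx 0 j) - f p) = - (h^-1 * (f (p + h *: delta_mx 0 j) - f p - h * l)).
  by field.
rewrite normrN normrM normfV ltr_pdivrMl ?normr_gt0 //.
apply: le_lt_trans (hf h Dh) _.
have hp : 0 < `|h| by rewrite normr_gt0.
rewrite -real_normK ?num_real // expr2 mulrCA ltr_pM2l //.
rewrite ltr_pdivlMr in hd'; last lra.
lra.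
Qed.

Section Series.
Variable T : R.
Definition phase (p : 'rV[R]_4) n : R := \sum_j zr R n j * p 0 (lift ord0 j).
Definition series_at (a : R -> Z3 -> R[i]) (p : 'rV[R]_4) : R :=
  complex.Re (csum (fun n => a (p 0 0) n * expi (phase p n))).
Definition slab := [set p : 'rV[R]_4 | 0 <= p 0 0 <= T].

Lemma coord_le (p q : 'rV[R]_4) i : `|p 0 i - q 0 i| <= `|p - q|.
Proof.
have -> : p 0 i - q 0 i = (p - q) 0 i by rewrite !mxE.
rewrite [leRHS]/Num.norm /= mx_normrE.
exact: (le_bigmax _ (fun ij : 'I_1 * 'I_4 => `|(p - q) ij.1 ij.2|) (0, i)).
Qed.

Lemma phase_lip (p q : 'rV[R]_4) n : `|phase p n - phase q n| <= ang R n * `|p - q|.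
Proof.
rewrite /phase -sumrB; apply: le_trans (ler_norm_sum _ _ _) _.
apply: (@le_trans _ _ (\sum_j `|zr R n j| * `|p - q|)).
  by apply: ler_sum => j _; rewrite -mulrBr normrM ler_wpM2l // coord_le.
rewrite -big_distrl /= ler_wpM2r //.
by rewrite /ang lerDr.
Qed.

Lemma term_l1 a (p : 'rV[R]_4) : bdd T a -> slab p -> exists L, l1 (fun n => a (p 0 0) n * expi (phase p n)) L.
Proof.
move=> ha Dp; have [L hL] := bdd_l1 ha Dp; exists (1 * L).
by apply: l1_mul_sup => // n; rewrite cmod_expi.
Qed.

Lemma series_lip a : SM T 1 a -> exists C : R, 0 <= C /\ forall p q, slab p -> slab q ->
  `|series_at a p - series_at a q| <= C * `|p - q|.
Proof.
(* Six powers of [ang] pay for the summation; the seventh is the Lipschitz constant of the phase in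
   space. *)
move=> ha; have hb := SM_bdd ha; have [C6 [C60 h6]] := SM_lip ha 6%N; have [C7 [C70 h7]] := hb 7%N.
exists (2 * ((C6 + 2 * C7) * Kang R)); split; first by rewrite !mulr_ge0 // addr_ge0 // mulr_ge0.
move=> p q Dp Dq; have [L hL] := term_l1 hb Dp; have [L' hL'] := term_l1 hb Dq.
rewrite /series_at -cReN -cReD -(csumB hL hL'); apply: le_trans (Re_le _) _.
have -> : 2 * ((C6 + 2 * C7) * Kang R) * `|p - q| = 2 * ((C6 + 2 * C7) * `|p - q| * Kang R) by ring.
apply: csum_rapid; first by rewrite mulr_ge0 // addr_ge0 // mulr_ge0.
move=> n; set tp := p 0 0; set tq := q 0 0.
have -> : a tp n * expi (phase p n) - a tq n * expi (phase q n) =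
  (a tp n - a tq n) * expi (phase p n) + a tq n * (expi (phase p n) - expi (phase q n)) by ring.
have a0 k : 0 <= ang R n ^+ k by rewrite exprn_ge0 // ang_ge0.
apply: le_trans (ler_wpM2l (a0 _) (cmodD _ _)) _; rewrite [leLHS]mulrDr [leRHS]mulrDl !cmodM cmod_expi mulr1.
apply: lerD.
  apply: le_trans (h6 (tq, tp) n (conj Dq Dp)) _; rewrite ler_wpM2l //; exact: coord_le.
apply: (@le_trans _ _ (ang R n ^+ 6 * (cmod (a tq n) * (2 * (ang R n * `|p - q|))))).
  rewrite ler_wpM2l // ler_wpM2l ?cmod_ge0 //; apply: le_trans (expi_lip _ _) _.
  by rewrite ler_wpM2l // phase_lip.
have -> : ang R n ^+ 6 * (cmod (a tq n) * (2 * (ang R n * `|p - q|))) = (ang R n ^+ 7 * cmod (a tq n)) * (2 * `|p - q|) by ring.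
have -> : 2 * C7 * `|p - q| = C7 * (2 * `|p - q|) by ring.
by rewrite ler_wpM2r ?mulr_ge0 //; have := h7 tq n Dq; rewrite mulr1.
Qed.

Lemma series_cont a : SM T 1 a -> {within slab, continuous (series_at a)}.
Proof. by move=> /series_lip [C [C0 h]]; exact: lip_within C0 h. Qed.

Lemma series_dt a a' p : SM T 2 a -> bdd T a' -> dq T a a' -> slab p ->
  pderiv_within slab (series_at a) 0 p (series_at a' p).
Proof.
move=> ha hb' hd Dp; have hb := SM_bdd ha; have [C [C0 hC]] := hd 6%N.
apply: (pder_quad (C := 2 * (C * Kang R))); first by rewrite !mulr_ge0.
move=> h; set q := p + _ => Dq.
have qp i : q 0 (lift ord0 i) = p 0 (lift ord0 i).
  by rewrite !mxE /= mulr0 addr0.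
have q0 : q 0 0 = p 0 0 + h by rewrite !mxE /= mulr1.
have ph n : phase q n = phase p n by apply: eq_bigr => i _; rewrite qp.
have [L hL] := term_l1 hb Dp; have [L' hL'] := term_l1 hb Dq; have [L'' hL''] := term_l1 hb' Dp.
have e : series_at a q - series_at a p - h * series_at a' p = complex.Re
   (csum (fun n => a (q 0 0) n * expi (phase q n) - a (p 0 0) n * expi (phase p n) - rC h * (a' (p 0 0) n * expi (phase p n)))).
  rewrite (csumB (l1B hL' hL) (l1Z (rC h) hL'')) (csumB hL' hL) (csumZ _ hL'') !cReD !cReN cReM /=.
  by rewrite /series_at /= mul0r subr0.
rewrite e; apply: le_trans (Re_le _) _.
have -> : 2 * (C * Kang R) * h ^+ 2 = 2 * (C * h ^+ 2 * Kang R) by ring.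
apply: csum_rapid => [|n]; first by rewrite mulr_ge0 // sqr_ge0.
rewrite ph.
have -> : a (q 0 0) n * expi (phase p n) - a (p 0 0) n * expi (phase p n) - rC h * (a' (p 0 0) n * expi (phase p n)) =
  (a (q 0 0) n - a (p 0 0) n - rC h * a' (p 0 0) n) * expi (phase p n) by ring.
rewrite cmodM cmod_expi mulr1.
have dh : q 0 0 - p 0 0 = h by rewrite q0; ring.
have := hC (p 0 0, q 0 0) n (conj Dp Dq); rewrite /= dh.
by rewrite real_normK ?num_real.
Qed.

Lemma series_dx a p i : SM T 1 a -> slab p ->
  pderiv_within slab (series_at a) (lift ord0 i) p (series_at (fun t n => iC R * rC (zr R n i) * a t n) p).
Proof.
(* Eight powers: six for the summation and two for the factor [zr R n i ^+ 2] in the second-order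
   remainder of the exponential. *)
move=> ha Dp; have hb := SM_bdd ha; have [C [C0 hC]] := hb 8%N.
apply: (pder_quad (C := 2 * (2 * C * Kang R))); first by rewrite !mulr_ge0.
move=> h; set q := p + _ => Dq.
have q0 : q 0 0 = p 0 0 by rewrite !mxE /= mulr0 addr0.
have ph n : phase q n = phase p n + h * zr R n i.
  have qi : q 0 (lift ord0 i) = p 0 (lift ord0 i) + h.
    by rewrite /q mxE mxE (mxE _ _ _ (lift ord0 i)) !eqxx mulr1.
  rewrite /phase (bigD1 i) //= [in RHS](bigD1 i) //= qi.
  have -> : \sum_(j < 3 | j != i) zr R n j * q 0 (lift ord0 j) = \sum_(j < 3 | j != i) zr R n j * p 0 (lift ord0 j).
    apply: eq_bigr => j ji; rewrite !mxE /= (_ : (_ == _) = false) ?mulr0 ?addr0 //.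
    by apply/negbTE; apply: contra ji => /eqP /lift_inj ->.
  ring.
have hb2 : bdd T (fun t n => iC R * rC (zr R n i) * a t n).
  apply: (rapid_mult (C := 1) (p := 1)) hb => n.
  by rewrite cmodM cmod_iC cmod_rC !mul1r expr1 zr_ang.
have [L hL] := term_l1 hb Dp; have [L' hL'] := term_l1 hb Dq; have [L'' hL''] := term_l1 hb2 Dp.
have e : series_at a q - series_at a p - h * series_at (fun t n => iC R * rC (zr R n i) * a t n) p = complex.Re
   (csum (fun n => a (q 0 0) n * expi (phase q n) - a (p 0 0) n * expi (phase p n)
      - rC h * (iC R * rC (zr R n i) * a (p 0 0) n * expi (phase p n)))).
  rewrite (csumB (l1B hL' hL) (l1Z (rC h) hL'')) (csumB hL' hL) (csumZ _ hL'') !cReD !cReN cReM /=.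
  by rewrite /series_at /= mul0r subr0.
rewrite e; apply: le_trans (Re_le _) _.
have -> : 2 * (2 * C * Kang R) * h ^+ 2 = 2 * (2 * C * h ^+ 2 * Kang R) by ring.
apply: csum_rapid => [|n]; first by rewrite mulr_ge0 ?sqr_ge0 // mulr_ge0.
rewrite ph q0.
have -> : a (p 0 0) n * expi (phase p n + h * zr R n i) - a (p 0 0) n * expi (phase p n) - rC h * (iC R * rC (zr R n i) * a (p 0 0) n * expi (phase p n)) =
  a (p 0 0) n * (expi (phase p n + h * zr R n i) - expi (phase p n) - iC R * rC (h * zr R n i) * expi (phase p n)).
  by rewrite rCM; ring.
rewrite cmodM.
have a0 k : 0 <= ang R n ^+ k by rewrite exprn_ge0 // ang_ge0.
apply: (@le_trans _ _ (ang R n ^+ 6 * (cmod (a (p 0 0) n) * (2 * (h ^+ 2 * ang R n ^+ 2))))).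
  rewrite ler_wpM2l // ler_wpM2l ?cmod_ge0 //; apply: le_trans (expi_quad _ _) _.
  rewrite ler_wpM2l // exprMn ler_wpM2l ?sqr_ge0 //.
  by rewrite -[leLHS]real_normK ?num_real // ler_sqr ?nnegrE ?ang_ge0 // zr_ang.
have -> : ang R n ^+ 6 * (cmod (a (p 0 0) n) * (2 * (h ^+ 2 * ang R n ^+ 2))) = (ang R n ^+ 8 * cmod (a (p 0 0) n)) * (2 * h ^+ 2) by ring.
have -> : 2 * C * h ^+ 2 = C * (2 * h ^+ 2) by ring.
apply: ler_wpM2r; first by apply: mulr_ge0 => //; exact: sqr_ge0.
by have := hC (p 0 0) n Dp; rewrite mulr1.
Qed.

(** The index is one higher because continuity at the last order comes from a Lipschitz bound. A
    space derivative multiplies by i n_j and keeps the level; a time derivative lowers it by one. *)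
Lemma SM_Ck k a : SM T k.+1 a -> Ck_on slab k (series_at a).
Proof.
elim: k a => [|k IH] a ha; first by split => //; exact: series_cont.
split; first by apply: series_cont; exact: SM1_of ha.
move=> j; case: (unliftP ord0 j) => [i ->|->].
  exists (series_at (fun t n => iC R * rC (zr R n i) * a t n)); split.
    by move=> p Dp; apply: series_dx => //; exact: SM1_of ha.
  apply: IH; apply: (SM_mult (C := 1) (p := 1)) (SMS ha) => n.
  by rewrite cmodM cmod_iC cmod_rC !mul1r expr1 zr_ang.
have [a' [h1 h2]] := SM_dq ha; exists (series_at a'); split; last exact: IH.
move=> p Dp; apply: series_dt => //; last exact: SM_bdd h2.
by elim: k {IH h2} ha => // k IH /SMS; exact: IH.
Qed.

Lemma SM_smooth_sol (u : R -> field R) : (forall m k, SM T m (fun t => comp (u t) k)) -> smooth_sol T u.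
Proof.
move=> hu k m; have := SM_Ck (hu m.+1 k); congr Ck_on; apply/funext => p.
rewrite /series_at /phys; congr (complex.Re (csum _)); apply/funext => n; congr (_ * expi _).
by apply: eq_bigr => j _; rewrite mxE.
Qed.

End Series.
End PhysSmooth.

(** * Fourier decay of smooth data *)

Section FourierDecay.
Variable R : realType.
Implicit Types (n m : Z3) (x : 'rV[R]_3) (a b : Z3 -> R[i]) (j : 'I_3) (h : R).

Definition th n x : R := \sum_j zr R n j * x 0 j.
Definition synth a x : R[i] := csum (fun n => a n * expi (th n x)).

Lemma th_shift n x j h : th n (x + h *: delta_mx 0 j) = th n x + h * zr R n j.
Proof.
rewrite /th (bigD1 j) //= [in RHS](bigD1 j) //=.
have -> : (x + h *: delta_mx 0 j) 0 j = x 0 j + h by rewrite mxE mxE (mxE _ _ _ j) !eqxx mulr1.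
have -> : \sum_(i < 3 | i != j) zr R n i * (x + h *: delta_mx 0 j) 0 i = \sum_(i < 3 | i != j) zr R n i * x 0 i.
  by apply: eq_bigr => i ij; rewrite mxE mxE (mxE _ _ _ i) eqxx (negbTE ij) mulr0 addr0.
ring.
Qed.

Lemma synth_shift a x j h : synth a (x + h *: delta_mx 0 j) = synth (fun n => expi (h * zr R n j) * a n) x.
Proof. by apply: csum_eq => n; rewrite th_shift expiD; ring. Qed.
Lemma synth_l1 a L x : l1 a L -> l1 (fun n => a n * expi (th n x)) L.
Proof. by move=> h; rewrite -[L]mul1r; apply: l1_mul_sup => // n; rewrite cmod_expi. Qed.
Lemma l1_phase (f : Z3 -> R) a L : l1 a L -> l1 (fun n => expi (f n) * a n) L.
Proof. by apply: sums_le => // n; rewrite cmodM cmod_expi mul1r. Qed.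

(** The coefficients of the half-sum of a function and its translate by [h] along axis [j]. Such
    means do not increase the supremum of the function, nor the modulus of any coefficient, and
    serve in place of the Fourier integral. *)
Definition avg j h a n : R[i] := (1 + expi (h * zr R n j)) * rC 2^-1 * a n.
Lemma avg_le j h a n : cmod (avg j h a n) <= cmod (a n).
Proof.
rewrite !cmodM cmod_rC ger0_norm ?invr_ge0 // -[leRHS]mul1r ler_wpM2r ?cmod_ge0 //.
rewrite ler_pdivrMr // mul1r; apply: le_trans (cmodD _ _) _.
by rewrite cmod_expi -rC1 cmod_rC normr1; lra.
Qed.

Lemma avg_bound j h a L C : l1 a L -> (forall x, cmod (synth a x) <= C) ->
  forall x, cmod (synth (avg j h a) x) <= C.
Proof.
move=> ha hC x.
have -> : synth (avg j h a) x = rC 2^-1 * (synth a x + synth a (x + h *: delta_mx 0 j)).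
  rewrite synth_shift /synth -(csumD (synth_l1 x ha) (synth_l1 x (l1_phase _ ha))).
  rewrite -(csumZ _ (l1D (synth_l1 x ha) (synth_l1 x (l1_phase _ ha)))).
  by apply: csum_eq => n; rewrite /avg; ring.
rewrite cmodM cmod_rC ger0_norm ?invr_ge0 // ler_pdivrMl //.
apply: le_trans (cmodD _ _) _; have := hC x; have := hC (x + h *: delta_mx 0 j); lra.
Qed.

Lemma expiN (t : R) : expi (- t) = conjc (expi t).
Proof. by rewrite /expi cosN sinN. Qed.
Lemma expi_2pi_int (k : int) : expi (pi *+ 2 * k%:~R : R) = 1.
Proof.
have nat_case (N : nat) : expi (pi *+ 2 * N%:R : R) = 1.
  elim: N => [|N IH]; first by rewrite mulr0 expi0.
  by rewrite -natr1 mulrDr mulr1 expiD IH mul1r /expi cos2pi sin2pi.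
case: k => N; first exact: nat_case.
by rewrite NegzE mulrNz mulrN expiN nat_case conjc1.
Qed.

Lemma expi_pi_odd (r : int) : expi (pi * (2 * r + 1)%:~R : R) = -1.
Proof.
have -> : pi * (2 * r + 1)%:~R = pi *+ 2 * r%:~R + pi :> R.
  by rewrite intrD intrM mulrDr mulr1 mulrA mulr_natr.
rewrite expiD expi_2pi_int mul1r /expi cospi sinpi.
by apply: complex_eq => /=; rewrite ?oppr0.
Qed.

(** Factors 2 are removed until an odd number remains; the hypothesis guarantees that this happens
    within [p] steps and excludes [k = 0]. *)
Lemma odd_part (p : nat) (k : int) : ~~ ((2 ^ p)%N %| `|k|)%N -> exists i r, k = (2 ^+ i) * (2 * r + 1).
Proof.
elim: p k => [|p IH] k; first by rewrite expn0 dvd1n.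
case: (boolP (2 %| `|k|)%N) => [/dvdnP [q hq]|ho].
  have [q' hq'] : exists q' : int, k = 2 * q'.
    case: k hq => N /= hq; first by exists q%:Z; rewrite hq mulnC PoszM.
    by exists (- q%:Z); rewrite NegzE mulrN -PoszM mulnC -hq.
  rewrite hq' abszM expnS dvdn_pmul2l // => /IH [i [r ->]].
  by exists i.+1, r; rewrite exprS mulrA.
move=> _; exists 0%N, ((k - 1) %/ 2)%Z; rewrite expr0 mul1r.
have e : ((k - 1) %% 2 = 0)%Z.
  have h0 : (k %% 2 != 0)%Z.
    by apply: contra ho => /eqP h; rewrite -(dvdzE 2%:Z k); apply/dvdz_mod0P.
  have := modz_ge0 k (isT : (2 : int) != 0); have := ltz_pmod k (isT : 0 < (2 : int)).
  move=> h1 h2; have h3 : (k %% 2 = 1)%Z.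
    by move: h0 h1 h2; case: (k %% 2)%Z => [[|[|N]]|N].
  by rewrite -modzDml h3 subrr mod0z.
by rewrite -[LHS](subrK 1) {1}(divz_eq (k - 1) 2) e addr0 mulrC.
Qed.

Definition avgs (l : seq ('I_3 * R)) a : Z3 -> R[i] := foldr (fun q b => avg q.1 q.2 b) a l.
Lemma avgs_le l a n : cmod (avgs l a n) <= cmod (a n).
Proof. by elim: l => //= q l IH; apply: le_trans IH; exact: avg_le. Qed.
Lemma avgs_l1 l a L : l1 a L -> l1 (avgs l a) L.
Proof. by apply: sums_le => // n; exact: avgs_le. Qed.
Lemma avgs_bound l a L C : l1 a L -> (forall x, cmod (synth a x) <= C) ->
  forall x, cmod (synth (avgs l a) x) <= C.
Proof.
move=> ha hC; elim: l => //= q l IH; exact: avg_bound (avgs_l1 l ha) IH.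
Qed.

Lemma avgs_0 l a : avgs l a 0 = a 0.
Proof.
elim: l => //= q l IH; rewrite /avg -/(avgs l a) IH /zr mxE mulr0 expi0.
have -> : (1 + 1) * rC 2^-1 = 1 :> R[i]; last by rewrite mul1r.
by rewrite -rC1 -rCD -rCM; congr rC; lra.
Qed.

(** The shift [pi / 2 ^+ i] turns the phase at [n] into an odd multiple of pi, where the averaging
    symbol vanishes; the other averages keep the zero. *)
Lemma avgs_zero l a n j (i : nat) (r : int) : (j, pi / 2 ^+ i) \in l -> n 0 j = 2 ^+ i * (2 * r + 1) ->
  avgs l a n = 0.
Proof.
elim: l => //= q l IH; rewrite inE => /orP[/eqP <- hn|hl hn]; last by rewrite /avg -/(avgs l a) IH ?mulr0.
rewrite /avg /=.
have -> : pi / 2 ^+ i * zr R n j = pi * (2 * r + 1)%:~R.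
  rewrite /zr hn intrM rmorphXn /=; field.
  by rewrite expf_neq0.
by rewrite expi_pi_odd subrr !mul0r.
Qed.

Lemma csum_single (c : R[i]) (n0 : Z3) : csum (fun n => if n == n0 then c else 0) = c.
Proof.
have real (y : R) : rsum (fun n : Z3 => if n == n0 then y else 0) = y.
  wlog y0 : y / 0 <= y.
    move=> W; case: (leP 0 y) => hy; first exact: W.
    rewrite -[y in RHS]opprK -(W (- y)) -?rsumN; last lra.
    by congr rsum; apply/funext => n; case: eqP; rewrite ?opprK ?oppr0.
  pose d (n : Z3) := if n == n0 then y else 0.
  have d0 n : 0 <= d n by rewrite /d; case: eqP.
  have sd : sums d y.
    move=> s us; rewrite /d -big_mkcond /= big_const_seq iter_addr addr0.
    have : (count (fun i => i == n0) s <= 1)%N by rewrite (count_uniq_mem _ us); case: (_ \in _).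
    by case: (count _ _) => [|[|]] //; rewrite mulr0n.
  have [h1 h2] := esum_fine d0 sd.
  rewrite /rsum.
  have -> : (fun n : Z3 => (Num.max (if n == n0 then y else 0) 0)%:E) = (fun n => (d n)%:E).
    by apply/funext => n; rewrite max_l ?d0.
  have -> : \esum_(n in [set: Z3]) (Num.max (- (if n == n0 then y else 0)) 0)%:E = 0.
    by apply: esum1 => n _; rewrite max_r // oppr_le0; exact: d0.
  rewrite /= subr0; apply: le_anti; rewrite h2 /=.
  by have := sums_term n0 h1; rewrite /d eqxx.
apply: complex_eq; rewrite /= -[RHS]real; congr rsum; apply/funext => n; by case: eqP.
Qed.

(* The coefficients beyond a finite set carry little mass; each remaining nonzero
   frequency has a coordinate 2^i (2r+1), hence is killed by averaging over the
   shift by pi / 2^i in that direction, while the mean a 0 is unchanged. *)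
Lemma coef0_bound a L C : l1 a L -> (forall x, cmod (synth a x) <= C) -> cmod (a 0) <= C.
Proof.
move=> ha hC; apply/ler_addgt0Pr => e e0.
(* Half of [e], because [csum_bd] doubles the mass of the tail. *)
have e2 : 0 < e / 2 by lra.
have [s [us hs]] := sums_tail (fun n => cmod_ge0 (a n)) ha e2.
pose p := (\max_(n <- s) \max_(j < 3) `|n 0%R j|%N)%N.
have hp n j : n \in s -> (`|n 0%R j|%N < 2 ^ p)%N.
  move=> ns; apply: leq_ltn_trans (ltn_expl p (isT : (1 < 2)%N)).
  apply: (@leq_trans (\max_(j < 3) `|n 0%R j|%N)%N); first exact: leq_bigmax.
  by rewrite /p; exact: (leq_bigmax_seq (F := fun n : Z3 => (\max_(j < 3) `|n 0%R j|%N)%N)).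
pose l : seq ('I_3 * R) := [seq (j, pi / 2 ^+ i) | j <- enum 'I_3, i <- iota 0 p].
set b := avgs l a.
have b0 n : n \in s -> n != 0 -> b n = 0.
  move=> ns n0.
  have [j nj] : exists j, n 0 j != 0.
    apply/existsP; rewrite -[X in is_true X]negbK negb_exists; apply/negP => /forallP H.
    by move/eqP: n0; apply; apply/rowP => k; rewrite mxE; move: (H k); rewrite negbK => /eqP.
  have nd : ~~ ((2 ^ p)%N %| `|n 0%R j|)%N.
    by apply/negP => /dvdn_leq; rewrite absz_gt0 nj => /(_ isT); rewrite leqNgt hp.
  have [i [r hir]] := odd_part nd.
  apply: (avgs_zero _ _ hir).
  apply/allpairsP; exists (j, i); split; rewrite ?mem_enum //= mem_iota add0n /=.
  have h1 : (2 ^ i <= `|n 0%R j|)%N.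
    have d : (2 ^ i %| `|n 0%R j|)%N by rewrite hir abszM abszX dvdn_mulr.
    by apply: dvdn_leq d; rewrite absz_gt0.
  by rewrite -(ltn_exp2l _ _ (isT : (1 < 2)%N)); exact: leq_ltn_trans h1 (hp n j ns).
have hb := avgs_l1 l ha; rewrite -/b in hb.
have ht : l1 (fun n => b n - (if n == 0 then b 0 else 0)) (e / 2).
  move=> r ur; rewrite (bigID (mem s)) /= big1 ?add0r.
    rewrite -big_filter; apply: le_trans (hs [seq n <- r | n \notin s] _ _).
    - apply: ler_sum => n _; case: eqP => [->|_]; first by rewrite subrr cmod0 cmod_ge0.
      by rewrite subr0; exact: avgs_le.
    - exact: filter_uniq.
    - by move=> n; rewrite mem_filter => /andP[].
  move=> n ns; case: eqP => [->|/eqP n0]; first by rewrite subrr cmod0.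
  by rewrite subr0 b0 // cmod0.
have hd : l1 (fun n : Z3 => if n == 0 then b 0 else 0) (L + e / 2).
  apply: sums_le (lexx _) (l1B hb ht) => n; rewrite opprB addrC subrK.
  by [].
(* The value of [synth b] at the origin is the sum of all coefficients. Removing those away from
   frequency 0 costs at most [e], and the value itself is at most [C]. *)
have eq0 : b 0 = synth b 0 - csum (fun n => b n - (if n == 0 then b 0 else 0)).
  rewrite (csumB hb hd) csum_single.
  have -> : synth b 0 = csum b.
    by apply: csum_eq => n; rewrite (_ : th n 0 = 0) ?expi0 ?mulr1 // /th big1 // => k _; rewrite mxE mulr0.
  by ring.
rewrite -(avgs_0 l a) -/b eq0; apply: le_trans (cmodB _ _) _.
apply: lerD; first exact: (avgs_bound l ha hC).
apply: le_trans (csum_bd (fun n => lexx _) ht) _; lra.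
Qed.

End FourierDecay.

(** * From smoothness to rapid decay of the coefficients *)

Section Decay.
Variable R : realType.
Implicit Types (n m : Z3) (x : 'rV[R]_3) (a : Z3 -> R[i]) (j : 'I_3) (h : R) (f g : 'rV[R]_3 -> R).

Lemma thD n m x : th (n + m) x = th n x + th m x.
Proof. by rewrite /th -big_split; apply: eq_bigr => j _ /=; rewrite zrD mulrDl. Qed.

(** Multiplication by a character moves frequency [n] to 0 and leaves the modulus of the function
    unchanged. *)
Lemma coef_bound a L C n : l1 a L -> (forall x, cmod (synth a x) <= C) -> cmod (a n) <= C.
Proof.
move=> ha hC; pose b m := a (m + n).
have hb : l1 b L by apply: (@sums_inj _ _ _ (fun m => cmod (a m)) L (fun m => m + n)) ha; exact: addIr.
have e : a n = b 0 by rewrite /b add0r.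
rewrite e; apply: (coef0_bound hb) => x.
have -> : synth b x = expi (- th n x) * synth a x.
  rewrite /synth -(csumZ _ (synth_l1 x ha)).
  have bij : bijective (fun m : Z3 => m + n) by exists (fun m => m - n) => m; rewrite ?addrK ?subrK.
  rewrite -[RHS](csum_reindex _ bij); apply: csum_eq => m /=.
  transitivity (a (m + n) * expi (th m x) * (expi (- th n x) * expi (th n x))).
    by rewrite -expiD addNr expi0 mulr1.
  by rewrite thD expiD; ring.
by rewrite cmodM cmod_expi mul1r.
Qed.

Lemma synth_real a x : (forall n, a (- n) = conjc (a n)) -> synth a x = rC (complex.Re (synth a x)).
Proof.
move=> ha; have e : synth a x = conjc (synth a x).
  rewrite {2}/synth -csum_conj.
  have bij : bijective (fun m : Z3 => - m) by exists (fun m => - m) => m; rewrite opprK.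
  rewrite -[RHS](csum_reindex _ bij); apply: csum_eq => m /=.
  rewrite ha conjcM -expiN (_ : th (- m) x = - th m x); last first.
    by rewrite /th -sumrN; apply: eq_bigr => j _; rewrite zrN mulNr.
  by rewrite opprK; case: (a m) => u v /=; rewrite opprK.
move: e; case: (synth a x) => u v e; have := congr1 (@complex.Im R) e => /= h; apply: complex_eq => //=; lra.
Qed.

Fixpoint fdiff j h k f x : R :=
  match k with 0 => f x | k'.+1 => fdiff j h k' f (x + h *: delta_mx 0 j) - fdiff j h k' f x end.

(** Smoothness is assumed for the real part, which is what [phys] records; conjugation symmetry
    makes [synth] real, so finite differences of the real part have the expected coefficients. *)
Lemma synth_fdiff a L j h k x : l1 a L -> (forall n, a (- n) = conjc (a n)) ->
  (exists M, l1 (fun n => (expi (h * zr R n j) - 1) ^+ k * a n) M) /\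
  forall x, synth (fun n => (expi (h * zr R n j) - 1) ^+ k * a n) x = rC (fdiff j h k (fun x => complex.Re (synth a x)) x).
Proof.
move=> ha hr; elim: k => [|k [[M IHl] IH]].
  have e : (fun n => (expi (h * zr R n j) - 1) ^+ 0 * a n) = a by apply/funext => n; rewrite expr0 mul1r.
  by rewrite e; split; [exists L|move=> y; rewrite {1}synth_real].
have e : (fun n => (expi (h * zr R n j) - 1) ^+ k.+1 * a n) =
    (fun n => expi (h * zr R n j) * ((expi (h * zr R n j) - 1) ^+ k * a n) - (expi (h * zr R n j) - 1) ^+ k * a n).
  by apply/funext => n; rewrite exprS; ring.
rewrite e; split; first by exists (M + M); apply: l1B => //; exact: l1_phase.
move=> y; rewrite /= rCD rCN -!IH synth_shift.
rewrite /synth -(csumB (synth_l1 y (l1_phase _ IHl)) (synth_l1 y IHl)).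
by apply: csum_eq => n; ring.
Qed.

Definition periodic f := forall x j, f (x + (pi *+ 2) *: delta_mx 0 j) = f x.

Lemma periodic_int f x j (k : int) : periodic f -> f (x + (pi *+ 2 * k%:~R) *: delta_mx 0 j) = f x.
Proof.
move=> hf.
have nat_case (N : nat) y : f (y + (pi *+ 2 * N%:R) *: delta_mx 0 j) = f y.
  elim: N => [|N IH]; first by rewrite mulr0 scale0r addr0.
  by rewrite -natr1 mulrDr mulr1 scalerDl addrA hf.
case: k => N; first exact: nat_case.
rewrite NegzE mulrNz mulrN scaleNr.
have := nat_case N.+1 (x - (pi *+ 2 * N.+1%:R) *: delta_mx 0 j).
by rewrite subrK => ->.
Qed.

Lemma periodic_reduce f x : periodic f -> exists y : 'rV[R]_3, (forall j, 0 <= y 0 j <= pi *+ 2) /\ f y = f x.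
Proof.
move=> hf; have p0 : 0 < pi *+ 2 :> R by rewrite mulrn_wgt0 // pi_gt0.
pose k j : int := - Num.floor (x 0 j / (pi *+ 2)).
pose v j : 'rV[R]_3 := (pi *+ 2 * (k j)%:~R) *: delta_mx 0 j.
exists (x + v 0 + v 1 + v 2); split; last by rewrite !periodic_int.
have e j : (x + v 0 + v 1 + v 2) 0 j = x 0 j + pi *+ 2 * (k j)%:~R.
  have vE i : v i 0 j = if j == i then pi *+ 2 * (k i)%:~R else 0.
    by rewrite /v mxE mxE eqxx /=; case: eqP; rewrite ?mulr1 ?mulr0.
  rewrite mxE mxE (mxE _ _ _ j) !vE; move: j {vE}; apply: I3_ind => /=; ring.
move=> j; rewrite e /k mulrNz mulrN.
have /andP[h1 h2] := floor_itv (x 0 j / (pi *+ 2)).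
move: h1 h2; rewrite ler_pdivlMr // ltr_pdivrMr // intrD mulrDl mul1r => h1 h2.
rewrite [pi *+ 2 * _]mulrC; apply/andP; split; lra.
Qed.

Lemma periodic_bounded f : periodic f -> {within [set: 'rV[R]_3], continuous f} ->
  exists C, 0 <= C /\ forall x, `|f x| <= C.
Proof.
move=> hf cf.
pose K := [set v : 'rV[R]_3 | forall i, `[0, pi *+ 2]%classic (v ord0 i)].
have cK : compact K by apply: (rV_compact (A := fun=> `[0, pi *+ 2]%classic)) => _; exact: segment_compact.
have p0 : 0 < pi *+ 2 :> R by rewrite mulrn_wgt0 // pi_gt0.
have K0 : K !=set0 by exists 0 => i; rewrite mxE /= in_itv /= lexx ltW.
have cfK : {within K, continuous f} by apply: continuous_subspaceW cf.
have [c1 _ h1] := EVT_max_rV K0 cK cfK; have [c2 _ h2] := EVT_min_rV K0 cK cfK.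
exists (`|f c1| + `|f c2|); split; first by rewrite addr_ge0.
move=> x; have [y [hy <-]] := periodic_reduce x hf.
have yK : y \in K by rewrite inE => i /=; rewrite in_itv /=; exact: hy.
have := h1 y yK; have := h2 y yK; have := ler_norm (f c1); have := ler_norm (- f c2).
rewrite normrN ler_norml; have := normr_ge0 (f c1); have := normr_ge0 (f c2) => a1 a2 a3 a4 a5 a6.
by apply/andP; split; lra.
Qed.

Lemma pder_der f j x s l : pderiv_within [set: 'rV[R]_3] f j (x + s *: delta_mx 0 j) l ->
  der (fun u => f (x + u *: delta_mx 0 j)) s l.
Proof.
rewrite /pderiv_within => H.
have H' : (fun u : R => u^-1 *: (f (x + (u *: (1 : R) + s) *: delta_mx 0 j) - f (x + s *: delta_mx 0 j))) @ (0 : R)^' --> l.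
  have -> : (fun u : R => u^-1 *: (f (x + (u *: (1 : R) + s) *: delta_mx 0 j) - f (x + s *: delta_mx 0 j)))
     = (fun u : R => u^-1 * (f (x + s *: delta_mx 0 j + u *: delta_mx 0 j) - f (x + s *: delta_mx 0 j))).
    apply/funext => u; rewrite (_ : u *: (1 : R) = u); last exact: mulr1.
    by rewrite (addrC u) scalerDl addrA.
  apply: cvg_trans H; apply: cvg_app => P /= hP.
  have {}hP : (0 : R)^' [set y | True -> P y] := hP.
  by apply: filterS hP => y; apply.
split; first by apply/cvg_ex; exists l.
exact: (@cvg_lim R^o (@norm_hausdorff R R^o) _ _ _ _ l).
Qed.

Lemma fdiff_der f g j h k x s : (forall y, pderiv_within [set: 'rV[R]_3] f j y (g y)) ->
  der (fun u => fdiff j h k f (x + u *: delta_mx 0 j)) s (fdiff j h k g (x + s *: delta_mx 0 j)).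
Proof.
move=> H; elim: k x => [|k IH] x /=; first exact: pder_der.
apply: derB; last exact: IH.
have := IH (x + h *: delta_mx 0 j); rewrite [X in der _ _ (fdiff _ _ _ _ X)]addrAC.
by apply: der_ext => u; rewrite addrAC.
Qed.

(** Differences commute with differentiation, so the mean value inequality in [h] exchanges one
    difference of [f] for a factor [|h|] and one derivative. Only the last derivative has to be
    bounded, by continuity and periodicity. *)
Lemma fdiff_bound k f j : periodic f -> Ck_on [set: 'rV[R]_3] k f ->
  exists C, 0 <= C /\ forall h x, `|fdiff j h k f x| <= C * `|h| ^+ k.
Proof.
elim: k f => [|k IH] f hf [cf hk].
  have [C [C0 hC]] := periodic_bounded hf cf; exists C; split => // h x; rewrite expr0 mulr1; exact: hC.
have [g [hg hgk]] := hk j.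
(* At [x] and at the translated point, [g] is the derivative of one and the same function of [u]. *)
have gp : periodic g.
  move=> x i.
  have d1 := @pder_der f j x 0 (g x); rewrite scale0r addr0 in d1; have {}d1 := d1 (hg x I).
  have d2 := @pder_der f j (x + (pi *+ 2) *: delta_mx 0 i) 0 (g (x + (pi *+ 2) *: delta_mx 0 i)).
  rewrite scale0r addr0 in d2; have {}d2 := d2 (hg _ I).
  apply: etrans (etrans (esym (der_derive1 d2)) _) (der_derive1 d1); congr (derive1 _ _); apply/funext => u.
  by rewrite addrAC hf.
have [C [C0 hC]] := IH g gp hgk; exists C; split => // h x /=.
have := @MVT_all R (fun u => fdiff j h k f (x + u *: delta_mx 0 j)) (fun u => fdiff j h k g (x + u *: delta_mx 0 j)) (C * `|h| ^+ k) h 0.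
rewrite scale0r addr0 subr0 exprSr mulrA; apply => [u|u _]; last exact: hC.
by apply: fdiff_der => y; exact: hg.
Qed.

Lemma synth_periodic a : periodic (fun x => complex.Re (synth a x)).
Proof.
move=> x j; rewrite synth_shift; congr (complex.Re _); apply: csum_eq => n.
by rewrite /zr expi_2pi_int mul1r.
Qed.

Lemma coef_decay a L s : l1 a L -> (forall n, a (- n) = conjc (a n)) ->
  smooth_on [set: 'rV[R]_3] (fun x => complex.Re (synth a x)) ->
  exists D, forall n, ang R n ^+ s * cmod (a n) <= D.
Proof.
move=> ha hr hs.
have L0 := l1_ge0 ha.
have dir j : exists C, 0 <= C /\ forall n, `|zr R n j| ^+ s * cmod (a n) <= C.
  have [C [C0 hC]] := fdiff_bound j (@synth_periodic a) (hs s).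
  exists (C * pi ^+ s); split; first by rewrite mulr_ge0 // exprn_ge0 // pi_ge0.
  move=> n; set z := zr R n j; pose h := pi / z.
  have [[M hM] e] := synth_fdiff j h s 0 ha hr.
  have b : cmod ((expi (h * z) - 1) ^+ s * a n) <= C * `|h| ^+ s.
    by apply: (coef_bound n hM) => x; rewrite e cmod_rC; exact: hC.
  have cX (w : R[i]) k : cmod (w ^+ k) = cmod w ^+ k.
    elim: k => [|k IHk]; first by rewrite !expr0 -rC1 cmod_rC normr1.
    by rewrite !exprS cmodM IHk.
  move: b; rewrite cmodM cX /h.
  (* Here [h = pi / 0 = 0]: for [s = 0] the bound [b] is already the claim, and for [s > 0] the
     left-hand side vanishes. *)
  have [z0|z0] := eqVneq z 0.
    rewrite z0 invr0 !mulr0 normr0 expi0 subrr cmod0.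
    case: (s) => [|k]; first by rewrite !expr0.
    by rewrite !exprS !mul0r => _; rewrite mulr_ge0 // mulr_ge0 ?exprn_ge0 ?pi_ge0.
  rewrite divfK //.
  have -> : cmod (expi pi - 1) = 2 :> R.
    rewrite /expi cospi sinpi (_ : Complex (-1) 0 - 1 = rC (- 2)); last by apply: complex_eq; rewrite /=; ring.
    by rewrite cmod_rC normrN ger0_norm.
  rewrite normrM normfV exprMn exprVn mulrA ler_pdivlMr ?exprn_gt0 ?normr_gt0 //.
  rewrite ger0_norm ?pi_ge0 // => b; rewrite mulrC; apply: le_trans b.
  by rewrite ler_wpM2r ?exprn_ge0 // ler_peMl ?cmod_ge0 // exprn_ege1 // ler1n.
have [C0 [C00 h0]] := dir 0; have [C1 [C10 h1]] := dir 1; have [C2 [C20 h2]] := dir 2.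
exists (4 ^+ s * (L + C0 + C1 + C2)) => n.
have la := l1_sup n ha; have c0 := cmod_ge0 (a n).
(* [ang R n] is the sum of 1 and three absolute values, so one of these four terms is at least a
   quarter of it; the bound available for that term then controls the whole weight. *)
have big y : 0 <= y -> ang R n <= 4 * y -> y ^+ s * cmod (a n) <= L + C0 + C1 + C2 ->
   ang R n ^+ s * cmod (a n) <= 4 ^+ s * (L + C0 + C1 + C2).
  move=> y0 hy hb; apply: (@le_trans _ _ ((4 * y) ^+ s * cmod (a n))).
    by rewrite ler_wpM2r // lerXn2r ?nnegrE ?ang_ge0 ?mulr_ge0.
  by rewrite exprMn -mulrA ler_wpM2l ?exprn_ge0.
have hang : ang R n = 1 + (`|zr R n 0| + `|zr R n 1| + `|zr R n 2|) by rewrite /ang I3_sum.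
have q0 := normr_ge0 (zr R n 0); have q1 := normr_ge0 (zr R n 1); have q2 := normr_ge0 (zr R n 2).
have := h0 n; have := h1 n; have := h2 n => b2 b1 b0.
case: (leP (ang R n) (4 * 1)) => [h|k3]; first by apply: (big 1) => //; rewrite expr1n mul1r; lra.
case: (leP (ang R n) (4 * `|zr R n 0|)) => [h|k0]; first by apply: (big _ q0) => //; lra.
case: (leP (ang R n) (4 * `|zr R n 1|)) => [h|k1]; first by apply: (big _ q1) => //; lra.
by apply: (big _ q2); lra.
Qed.

Lemma smooth_data_decay (u : field R) s : inX0 u -> real_field u -> smooth_data u ->
  exists D, forall n k, ang R n ^+ s * cmod (u n 0 k) <= D.
Proof.
move=> /(esum_fin (fun n => vnorm_ge0 _)) [L hL] hr hs.
have key k : exists D, forall n, ang R n ^+ s * cmod (comp u k n) <= D.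
  apply: (@coef_decay _ L) => [|n|]; last exact: hs.
    by apply: sums_le (lexx _) hL => n; exact: cmod_vnorm.
  exact: hr.
have [D0 h0] := key 0; have [D1 h1] := key 1; have [D2 h2] := key 2.
have p0 : 0 <= D0 by apply: le_trans (h0 0); rewrite mulr_ge0 ?cmod_ge0 ?exprn_ge0 ?ang_ge0.
have p1 : 0 <= D1 by apply: le_trans (h1 0); rewrite mulr_ge0 ?cmod_ge0 ?exprn_ge0 ?ang_ge0.
have p2 : 0 <= D2 by apply: le_trans (h2 0); rewrite mulr_ge0 ?cmod_ge0 ?exprn_ge0 ?ang_ge0.
exists (D0 + D1 + D2) => n; apply: I3_ind.
- have := h0 n; rewrite /comp; lra. - have := h1 n; rewrite /comp; lra. - have := h2 n; rewrite /comp; lra.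
Qed.

End Decay.

Theorem theorem1p2 (R : realType) (nu : R) (v0 B0 E0 : field R) :
  0 < nu ->
  inX0 v0 -> inX0 B0 -> inX0 E0 ->
  real_field v0 -> real_field B0 -> real_field E0 ->
  divfree v0 -> divfree B0 -> B0 0 = 0 ->
  exists T : R, 0 < T /\
    exists v B E : R -> field R,
      [/\ mild_solution nu v0 B0 E0 T v B E,
          (forall v' B' E' : R -> field R,
              mild_solution nu v0 B0 E0 T v' B' E' ->
              forall t, 0 <= t <= T -> [/\ v' t = v t, B' t = B t & E' t = E t]) &
          (smooth_data v0 -> smooth_data B0 -> smooth_data E0 ->
              [/\ smooth_sol T v, smooth_sol T B & smooth_sol T E])].
Proof.
move=> nu0 xv xB xE rv rB rE _ dB _.
have [T [T0 [v [B [E sol]]]]] := existence nu0 xv xB xE rv rB rE dB.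
have i1 := mild_solution_img (ltW T0) dB sol; have [cv cB cE _ _] := sol.
exists T; split => //; exists v, B, E; split => // [v' B' E' sol'|sv sB sE].
  have i2 := mild_solution_img (ltW T0) dB sol'; have [cv' cB' cE' _ _] := sol'.
  exact: (uniqueness nu0 (ltW T0) cv' cB' cE' cv cB cE i2 i1).
have hD s : exists D : R, forall n k, [/\ ang R n ^+ s * cmod (v0 n 0 k) <= D, ang R n ^+ s * cmod (B0 n 0 k) <= D &
    ang R n ^+ s * cmod (E0 n 0 k) <= D].
  have [D1 h1] := smooth_data_decay s xv rv sv; have [D2 h2] := smooth_data_decay s xB rB sB.
  have [D3 h3] := smooth_data_decay s xE rE sE.
  exists (Num.max D1 (Num.max D2 D3)) => n k; rewrite !le_max h1 h2 h3 !orbT; by split.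
have SMs := solution_SM nu0 (ltW T0) cv cB cE i1 hD.
by split; apply: SM_smooth_sol => m k; have [] := SMs m k.
Qed.
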